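(* Let $a,b>0$ and $q\in(0,1)$ satisfy $$\ln\big(qe^{-a}+(1-q)e^{b}\big)>0>-aq+(1-q)b .$$ Consider in $H=\ell_2$ the random dynamical system generated by $$\frac{d}{dt}u_1+\eta(t)u_1=1,\qquad \frac{d}{dt}u_k+k^4u_k=u_1u_k-u_k^3,\quad k=2,3,\dots,$$ where $u=(u_1,u_2,\dots)\in H$ and $\eta$ is generated by the Bernoulli process with values $a$ (probability $q$) and $-b$ (probability $1-q$). Then the random attractor $\mathcal A(\eta)$ of this system in $H$ has infinite Hausdorff and fractal dimensions: $$\dim_H(\mathcal A(\eta),H)=\dim_f(\mathcal A(\eta),H)=\infty$$ for almost all $\eta\in\Gamma$.
   Context: $\ell_2$ is the space of square summable real sequences. $\Gamma:=\{a,-b\}^{\mathbb Z}$ is the two-sided Bernoulli scheme with the Tychonoff topology and the product probability measure $\mu$ with one-coordinate marginals $\mu(\{a\})=q$, $\mu(\{-b\})=1-q$; $(T_l\eta)_n=\eta_{n+l}$, $l\in\mathbb Z$, are the shifts. An element $\eta=(\eta_n)\in\Gamma$ is identified with the piecewise constant function $\eta(t):=\eta_{[t]}$, where $[t]$ is the integer part of $t$. ''Almost all'' refers to $\mu$. $U_\eta(t,\tau):H\to H$, $t\ge\tau$, denotes the solution operator of the system with given $\eta$. A function $\varphi:\mathbb R\to\mathbb R$ is tempered if $\lim_{t\to-\infty}e^{\theta t}|\varphi(t)|=0$ for all $\theta>0$. A tempered random set is a $\mu$-measurable set-valued function $\eta\mapsto B(\eta)\subset H$ such that $l\mapsto\|B(T_l\eta)\|_H:=\sup_{x\in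 B(T_l\eta)}\|x\|_H$ is tempered (along the shifts, as $l\to-\infty$) for almost all $\eta$. A tempered random set $\mathcal A(\eta)$ is the random attractor if, for almost all $\eta$: $\mathcal A(\eta)$ is compact in $H$; $U_\eta(l,0)\mathcal A(\eta)=\mathcal A(T_l\eta)$ for all $l\ge0$; and $\lim_{l\to-\infty}\operatorname{dist}_H(U_\eta(0,l)B(T_l\eta),\mathcal A(\eta))=0$ for every tempered random set $B$, where $\operatorname{dist}_H(X,Y):=\sup_{x\in X}\inf_{y\in Y}\|x-y\|_H$. Here $\dim_f$ is the fractal (box-counting) dimension and $\dim_H$ the Hausdorff dimension. *)

(* Defs.v *)
From HB Require Import structures.
From mathcomp Require Import all_boot all_order all_algebra.
From mathcomp Require Import all_classical all_reals all_analysis.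
From mathcomp Require Import measurable_realfun.
From mathcomp Require Import ring lra.

Set Implicit Arguments.
Unset Strict Implicit.
Unset Printing Implicit Defensive.
Import Order.TTheory GRing.Theory Num.Def Num.Theory.
Import numFieldNormedType.Exports.

Local Open Scope classical_set_scope.
Local Open Scope ring_scope.

Section square_summable.
Variable R : realType.
Implicit Types u v : nat -> R.

Definition square_summable u : Prop := cvgn (series (fun k => u k ^+ 2)).

Definition sqsum : {pred (nat -> R)} := [pred u | `[< square_summable u >]].

Definition sqnorm u : R := limn (series (fun k => u k ^+ 2)).

Lemma sqsumP u : reflect (square_summable u) (u \in sqsum).
Proof. exact: asboolP. Qed.

Lemma sqsum_le (c d : R) u v w : square_summable u -> square_summable v ->
  (forall k, w k ^+ 2 <= c * u k ^+ 2 + d * v k ^+ 2) ->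
  square_summable w /\ sqnorm w <= c * sqnorm u + d * sqnorm v.
Proof.
move=> su sv wle.
pose f := c *: (fun k => u k ^+ 2); pose g := d *: (fun k => v k ^+ 2).
have sf : cvgn (series f) by exact: is_cvg_seriesZ.
have sg : cvgn (series g) by exact: is_cvg_seriesZ.
have sw : square_summable w.
  apply: (@series_le_cvg _ _ (f + g)); last exact: is_cvg_seriesD.
  - by move=> k; exact: sqr_ge0.
  - by move=> k; apply: le_trans (wle k); exact: sqr_ge0.
  - by move=> k; exact: wle.
split=> //; rewrite /sqnorm.
have -> : c * limn (series (fun k => u k ^+ 2)) = limn (series f).
  by rewrite lim_seriesZ.
have -> : d * limn (series (fun k => v k ^+ 2)) = limn (series g).
  by rewrite lim_seriesZ.
rewrite -lim_seriesD//; apply: lim_series_le => //; exact: is_cvg_seriesD.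
Qed.

Lemma sqnorm_ge u n : square_summable u -> series (fun k => u k ^+ 2) n <= sqnorm u.
Proof.
move=> su; apply: nondecreasing_cvgn_le => //.
by apply: nondecreasing_series => k _ _; exact: sqr_ge0.
Qed.

Lemma sqnorm_ge0 u : square_summable u -> 0 <= sqnorm u.
Proof. by move=> /(sqnorm_ge 0); rewrite /series/= big_geq. Qed.

Lemma sqnorm_eq0 u : square_summable u -> sqnorm u = 0 -> u = 0.
Proof.
move=> su u0; apply/funext => k; apply/eqP; rewrite -sqrf_eq0 eq_le sqr_ge0 andbT.
rewrite -u0; apply: le_trans (sqnorm_ge k.+1 su).
by rewrite /series/= big_nat_recr//= lerDr sumr_ge0// => j _; exact: sqr_ge0.
Qed.

Lemma sqsum0 : square_summable 0.
Proof.
rewrite /square_summable (_ : series _ = cst 0); first exact: is_cvg_cst.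
by apply/funext => n; rewrite /series/= big1// => k _; rewrite expr0n.
Qed.

Lemma sqsumZ c u : square_summable u -> square_summable (c *: u).
Proof.
move=> su; have [|//] := @sqsum_le (c ^+ 2) 0 u u (c *: u) su su.
by move=> k; rewrite mul0r addr0 -exprMn.
Qed.

Lemma sqnormZ c u : square_summable u -> sqnorm (c *: u) = c ^+ 2 * sqnorm u.
Proof.
move=> su; rewrite /sqnorm -[RHS](lim_seriesZ _ su); congr (limn (series _)).
by apply/funext => k; rewrite [LHS]exprMn.
Qed.

Lemma sqsumD u v :
  square_summable u -> square_summable v -> square_summable (u + v).
Proof.
move=> su sv; have [|//] := @sqsum_le 2 2 u v (u + v) su sv.
by move=> k; rewrite fctE; have := sqr_ge0 (u k - v k); nra.
Qed.

Lemma sqrt_sqnormD u v : square_summable u -> square_summable v ->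
  Num.sqrt (sqnorm (u + v)) <= Num.sqrt (sqnorm u) + Num.sqrt (sqnorm v).
Proof.
move=> su sv.
have [u0|u0] := eqVneq (sqnorm u) 0.
  by rewrite (sqnorm_eq0 su u0) add0r lerDr sqrtr_ge0.
have [v0|v0] := eqVneq (sqnorm v) 0.
  by rewrite (sqnorm_eq0 sv v0) addr0 lerDl sqrtr_ge0.
set x := Num.sqrt (sqnorm u); set y := Num.sqrt (sqnorm v).
have x0 : 0 < x by rewrite sqrtr_gt0 lt_neqAle eq_sym u0 sqnorm_ge0.
have y0 : 0 < y by rewrite sqrtr_gt0 lt_neqAle eq_sym v0 sqnorm_ge0.
have xE : sqnorm u = x ^+ 2 by rewrite sqr_sqrtr// sqnorm_ge0.
have yE : sqnorm v = y ^+ 2 by rewrite sqr_sqrtr// sqnorm_ge0.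
have [|_] := @sqsum_le (1 + y / x) (1 + x / y) u v (u + v) su sv.
  move=> k; rewrite fctE -subr_ge0.
  rewrite (_ : _ - _ = (y * u k - x * v k) ^+ 2 / (x * y)).
    by rewrite divr_ge0 ?sqr_ge0// mulr_ge0// ltW.
  by field; rewrite !gt_eqF.
rewrite xE yE (_ : _ + _ = (x + y) ^+ 2); last by field; rewrite !gt_eqF.
move=> le; have <- : Num.sqrt ((x + y) ^+ 2) = x + y.
  by rewrite sqrtr_sqr ger0_norm// addr_ge0 ?ltW.
exact: ler_wsqrtr le.
Qed.

Lemma sqsum_submod_closed : submod_closed sqsum.
Proof.
split; first exact/sqsumP/sqsum0.
by move=> c u v /sqsumP su /sqsumP sv; apply/sqsumP/sqsumD => //; exact: sqsumZ.
Qed.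
HB.instance Definition _ :=
  GRing.isSubmodClosed.Build R (nat -> R) sqsum sqsum_submod_closed.
End square_summable.

(* The coordinate u_k of the mathematical notation, k = 1, 2, ..., is [u k.-1]. *)
Record l2 (R : realType) := L2 {
  l2_val :> nat -> R;
  l2_valP : l2_val \in @sqsum R
}.

Section l2_normed.
Variable R : realType.

HB.instance Definition _ := [isSub for @l2_val R].
HB.instance Definition _ := [Choice of l2 R by <:].
HB.instance Definition _ := [SubChoice_isSubLmodule of l2 R by <:].

Definition l2norm (u : l2 R) : R := Num.sqrt (sqnorm u).

Lemma l2P (u : l2 R) : square_summable u.
Proof. by case: u => u /= /sqsumP. Qed.
Arguments l2P u : clear implicits.

Lemma l2_valD (u v : l2 R) : l2_val (u + v) = l2_val u + l2_val v.
Proof. exact: (raddfD (val : l2 R -> nat -> R)). Qed.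

Lemma l2_valZ (c : R) (u : l2 R) : l2_val (c *: u) = c *: l2_val u.
Proof. by rewrite -[LHS]/(val (c *: u)) GRing.valZ. Qed.

Lemma l2norm_triangle (u v : l2 R) : l2norm (u + v) <= l2norm u + l2norm v.
Proof. by rewrite /l2norm l2_valD; exact: sqrt_sqnormD (l2P u) (l2P v). Qed.

Lemma l2normZ (c : R) (u : l2 R) : l2norm (c *: u) = `|c| * l2norm u.
Proof.
by rewrite /l2norm l2_valZ (sqnormZ c (l2P u)) sqrtrM ?sqr_ge0// sqrtr_sqr.
Qed.

Lemma l2norm_eq0 (u : l2 R) : l2norm u = 0 -> u = 0.
Proof.
move=> /eqP; rewrite sqrtr_eq0 => u0; apply/val_inj.
apply: (sqnorm_eq0 (l2P u)); apply/eqP; rewrite eq_le u0.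
exact: sqnorm_ge0 (l2P u).
Qed.

HB.instance Definition _ :=
  Lmodule_isNormed.Build R (l2 R) l2norm_triangle l2normZ l2norm_eq0.
End l2_normed.

Section metric.
Variables (R : realType) (V : normedModType R).
Local Open Scope ereal_scope.
Implicit Types (A B : set V) (s delta eps : R).

(* [+oo] if [A] is unbounded, [-oo] if [A] is empty *)
Definition set_norm A : \bar R := ereal_sup [set `|x|%:E | x in A].

(* Hausdorff semidistance sup_{x in A} inf_{y in B} |x - y| *)
Definition hdist A B : \bar R :=
  ereal_sup [set ereal_inf [set `|x - y|%:E | y in B] | x in A].

(* the maximum with 0 only serves to give the empty set diameter 0 *)
Definition diam A : \bar R :=
  maxe 0 (ereal_sup [set `|x - y|%:E | x in A & y in A]).

Definition hausdorff_premeasure s delta A : \bar R :=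
  ereal_inf [set \sum_(0 <= i <oo) poweR (diam (C i)) s | C in
    [set C : (set V)^nat |
      A `<=` \bigcup_i C i /\ forall i, diam (C i) <= delta%:E]].

Definition hausdorff_measure s A : \bar R :=
  ereal_sup [set hausdorff_premeasure s delta A | delta in [set d : R | (0 < d)%R]].

(* Only exponents s > 0 occur, so that the convention for 0 ^ 0 plays no role;
   this does not change the infimum. *)
Definition hausdorff_dim A : \bar R :=
  ereal_inf [set s%:E | s in [set s : R | (0 < s)%R /\ hausdorff_measure s A = 0]].

Definition covering_number eps A : \bar R :=
  ereal_inf [set (size c)%:R%:E | c in
    [set c : seq V | A `<=` \bigcup_(x in [set` c]) ball x eps]].

Definition fractal_dim A : \bar R :=
  limf_esup (fun eps => lne (covering_number eps A) * ((ln eps^-1)^-1)%:E) 0%R^'+.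
End metric.

Definition coordinate_sets : set (set (int -> bool)) :=
  [set X | exists n b, X = [set eta | eta n = b]].

(* [true] stands for the letter a and [false] for the letter -b; the
   sigma-algebra is the product one. *)
Definition Gamma := g_sigma_algebraType coordinate_sets.

Definition bshift (l : int) (eta : Gamma) : Gamma := fun n => eta (n + l).

(* Product measure with marginals (q, 1 - q): the values on cylinders
   characterize it. *)
Definition bernoulli_scheme (R : realType) (q : R) (mu : probability Gamma R) :=
  forall (s : seq int) (b : int -> bool), uniq s ->
    mu [set eta | forall n, n \in s -> eta n = b n] =
    (\prod_(n <- s) (if b n then q else 1 - q))%:E.

Section random_attractor.
Variables (R : realType) (V : normedModType R) (mu : probability Gamma R).

Definition mu_measurable (X : set Gamma) : Prop := completed_algebra_gen mu X.

(* mu-measurability of set-valued functions (Castaing--Valadier): the preimages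
   of open sets are measurable for the completion of mu. *)
Definition measurable_set_valued (B : Gamma -> set V) : Prop :=
  forall O : set V, open O -> mu_measurable [set eta | B eta `&` O !=set0].

Definition tempered (phi : int -> \bar R) : Prop :=
  (forall l, phi l \is a fin_num) /\
  forall theta : R, 0 < theta ->
    ((expR (theta * - n%:R)%R)%:E * `|phi (- n%:Z)%R|)%E @[n --> \oo] --> 0%E.

(* Finiteness of the norms makes the sets B(T_l eta) bounded and nonempty. *)
Definition tempered_random_set (B : Gamma -> set V) : Prop :=
  measurable_set_valued B /\
  {ae mu, forall eta, tempered (fun l => set_norm (B (bshift l eta)))}.

(* [U eta t tau] is the evolution operator from time tau to time t. In the
   attraction property the exceptional null set may depend on B, as it already
   does in the definition of a tempered random set. *)
Definition random_attractor (U : Gamma -> R -> R -> V -> V)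
    (A : Gamma -> set V) : Prop :=
  [/\ tempered_random_set A,
      {ae mu, forall eta, compact (A eta)},
      {ae mu, forall eta, forall l : nat,
        U eta l%:R 0 @` A eta = A (bshift l%:Z eta)} &
      forall B, tempered_random_set B ->
        {ae mu, forall eta,
          hdist (U eta 0 (- n%:R) @` B (bshift (- n%:Z) eta)) (A eta)
            @[n --> \oo] --> 0%E}].
End random_attractor.

Section system.
Variables (R : realType) (a b : R).

Definition noise (eta : Gamma) (t : R) : R :=
  if eta (Num.floor t) then a else - b.

(* [u] solves the system on [tau, +oo[. As the coefficient eta(t) is only
   piecewise constant, the first equation is required between its jumps, i.e.
   off the integers. *)
Definition solution (eta : Gamma) (tau : R) (u : R -> l2 R) : Prop :=
  [/\ {within `[tau, +oo[, continuous u},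
      forall t, tau < t -> t \isn't a Num.int ->
        is_derive t 1 (fun s => u s 0%N) (1 - noise eta t * u t 0%N) &
      forall k t, (2 <= k)%N -> tau < t ->
        is_derive t 1 (fun s => u s k.-1)
          (u t 0%N * u t k.-1 - u t k.-1 ^+ 3 - k%:R ^+ 4 * u t k.-1)].

(* The value at time t of the (unique) solution starting from u0 at time tau;
   only meaningful for tau <= t. *)
Definition evolution (eta : Gamma) (t tau : R) (u0 : l2 R) : l2 R :=
  xget 0 [set u t | u in [set u | solution eta tau u /\ u tau = u0]].
End system.

(* Main.v *)
Require Import Defs.
From HB Require Import structures.
From mathcomp Require Import all_boot all_order all_algebra.
From mathcomp Require Import all_classical all_reals all_analysis.
From mathcomp Require Import measurable_realfun.
From mathcomp Require Import ring lra zify.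

Set Implicit Arguments.
Unset Strict Implicit.
Unset Printing Implicit Defensive.
Import Order.TTheory GRing.Theory Num.Def Num.Theory.
Import numFieldNormedType.Exports.
Local Open Scope classical_set_scope.
Local Open Scope ring_scope.

(** The first coordinate solves a linear equation that forgets its initial value
    (the mean of eta is positive), and for almost every eta it has exactly one
    trajectory that is tempered in the past, u_1(t) = lead S L t, where S is the
    primitive of eta with S(0) = 0 and L is the integral of e^S over the past.
    Along it the equation of index k >= 2 is u_k' = (u_1 - k^4) u_k - u_k^3, a
    Bernoulli equation: v = u_k^-2 satisfies the linear equation
    v' + 2 (u_1 - k^4) v = 2. Its entire solutions fill the interval
    |u_k| <= r_k, where r_k^-2 is twice the integral over the past of
    exp (- 2 int_s^0 (u_1 - k^4)). Hence the attractor is a box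
    {L} x prod_k [- r_k, r_k] ([abox]), and everything depends on r_k > 0 for all
    k, that is, on the convergence of this integral for all k.

    The convergence expresses that the mean of u_1 over [- T, 0] tends to infinity
    with T. A stretch of n letters multiplies u_1 by exp (- sum of the letters),
    which has expectation la^n for la = q e^-a + (1 - q) e^b > 1. Averaging over
    disjoint blocks of length n therefore gives a mean of u_1 of order la^n / n,
    for every n ([averages_superlinear], [ae_superlinear]); the required half of
    the law of large numbers is a Chernoff estimate for patterns of blocks
    ([block_averages]).

    The box is compact, because r_k is bounded by a multiple of (1 + u_1(0)) / k^2
    ([rate_growth_le]); this bound is polynomial in u_1 and so also makes the box
    tempered. Solving the equations explicitly shows that the evolution maps the
    box at one integer time onto the box at a later one ([evolution_abox_at]), and
    that all the trajectories started far in the past from a tempered set end up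
    close to the box ([abox_attracts]). Measurability holds because L and the r_k
    are limits of functions of finitely many letters ([measurable_abox]).

    Any other random attractor attracts the box, which is tempered and invariant,
    and hence contains it ([box_attractor_subset]). A set that contains
    n-dimensional cubes for every n has infinite dimensions: a Cantor set in the
    cube is parametrized by [0, 1[ with an inverse that is Hoelder continuous of
    any prescribed exponent s, so that the sums of diam^s over coverings are
    bounded below ([abox_cover_sum]), which bounds both dimensions from below. *)

(** * Primitives of continuous functions *)

Section calculus.
Variable R : realType.
Implicit Types (f g F : R -> R) (a b c x y t : R).

Lemma is_derive_continuous f x (d : R) :
  is_derive x 1 f d -> {for x, continuous f}.
Proof. by move=> [df _]; exact/differentiable_continuous/derivable1_diffP. Qed.

Lemma derive_ge0_le f (df : R -> R) a b : a <= b ->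
  {within `[a, b], continuous f} ->
  (forall x, a < x < b -> is_derive x 1 f (df x)) ->
  (forall x, a < x < b -> 0 <= df x) -> f a <= f b.
Proof.
rewrite le_eqVlt => /predU1P[<-//|ab] cf fdf df0.
have [x xab E] := @MVT R f df a b ab fdf cf.
by rewrite -subr_ge0 E mulr_ge0 ?df0// subr_ge0 ltW.
Qed.

Lemma derive_eq0_eq f a b : a <= b -> {within `[a, b], continuous f} ->
  (forall x, a < x < b -> is_derive x 1 f 0) -> f a = f b.
Proof.
rewrite le_eqVlt => /predU1P[<-//|ab] cf fdf.
have [x xab E] := @MVT R f (cst 0) a b ab fdf cf.
by apply/eqP; rewrite eq_sym -subr_eq0 E mul0r.
Qed.

Lemma cont_add f g : continuous f -> continuous g -> continuous (fun s => f s + g s).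
Proof. by move=> cf cg x; apply: continuousD; [exact: cf|exact: cg]. Qed.

Lemma cont_mul f g : continuous f -> continuous g -> continuous (fun s => f s * g s).
Proof. by move=> cf cg x; apply: continuousM; [exact: cf|exact: cg]. Qed.

Lemma cont_opp f : continuous f -> continuous (fun s => - f s).
Proof. by move=> cf x; apply: continuousN; exact: cf. Qed.

Lemma cont_cst c : continuous (fun _ : R => c).
Proof. by move=> x; exact: cvg_cst. Qed.

Lemma cont_id : continuous (fun x : R => x).
Proof. by move=> x; exact: cvg_id. Qed.

Lemma cont_scale c f : continuous f -> continuous (fun s => c * f s).
Proof. by move=> cf; apply: cont_mul => //; exact: cont_cst. Qed.

Lemma cont_comp f g : continuous f -> continuous g -> continuous (fun s => f (g s)).
Proof. by move=> cf cg x; apply: continuous_comp; [exact: cg|exact: cf]. Qed.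

Lemma cont_shift c f : continuous f -> continuous (fun s => f (s + c)).
Proof.
by move=> cf; apply: cont_comp => //; apply: cont_add; [exact: cont_id|exact: cont_cst].
Qed.

(** The rules of differentiation for functions written as abstractions, which lets
    derivations be composed as terms. *)
Lemma isder_cst c t : is_derive t 1 (fun=> c : R) 0.
Proof. exact: is_derive_cst. Qed.

Lemma isder_id t : is_derive t 1 (fun s => s : R) 1.
Proof. exact: is_derive_id. Qed.

Lemma isder_add f g t (df dg : R) : is_derive t 1 f df -> is_derive t 1 g dg ->
  is_derive t 1 (fun s => f s + g s) (df + dg).
Proof. by move=> ? ?; exact: is_deriveD. Qed.

Lemma isder_opp f t (df : R) : is_derive t 1 f df ->
  is_derive t 1 (fun s => - f s) (- df).
Proof. by move=> ?; exact: is_deriveN. Qed.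

Lemma isder_sub f g t (df dg : R) : is_derive t 1 f df -> is_derive t 1 g dg ->
  is_derive t 1 (fun s => f s - g s) (df - dg).
Proof. by move=> ? ?; exact: is_deriveB. Qed.

Lemma isder_mul f g t (df dg : R) : is_derive t 1 f df -> is_derive t 1 g dg ->
  is_derive t 1 (fun s => f s * g s) (df * g t + f t * dg).
Proof.
move=> dF dG; apply: (is_derive_eq (is_deriveM dF dG)).
by rewrite addrC; congr (_ + _); rewrite [LHS]mulrC.
Qed.

Lemma isder_scale c f t (df : R) : is_derive t 1 f df ->
  is_derive t 1 (fun s => c * f s) (c * df).
Proof. by move=> ?; exact: is_deriveZ. Qed.

Lemma isder_comp f g t (df dg : R) : is_derive (g t) 1 f df ->
  is_derive t 1 g dg -> is_derive t 1 (fun s => f (g s)) (df * dg).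
Proof. by move=> ? ?; exact: is_derive1_comp. Qed.

Lemma isder_shift f c t (df : R) : is_derive (t + c) 1 f df ->
  is_derive t 1 (fun s => f (s + c)) df.
Proof.
move=> dF; rewrite -[df]mulr1; apply: (@isder_comp f (fun s => s + c)) => //.
by rewrite -[X in is_derive _ _ _ X]addr0; exact: isder_add (isder_id _) (isder_cst _ _).
Qed.

Lemma isder_exp f t (df : R) : is_derive t 1 f df ->
  is_derive t 1 (fun s => expR (f s)) (expR (f t) * df).
Proof. by move=> ?; exact: isder_comp. Qed.

Lemma isder_sqr f t (df : R) : is_derive t 1 f df ->
  is_derive t 1 (fun s => f s ^+ 2) (2 * f t * df).
Proof.
by move=> dF; apply: is_derive_eq (isder_mul dF dF) _; ring.
Qed.

(* The primitive on a half-line, normalized at 0; the half-lines grow with n. *)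
Let Fn f (n : nat) x : R :=
  (\int[lebesgue_measure]_(t in `[(- n.+1%:R : R), x]) f t)%R
  - (\int[lebesgue_measure]_(t in `[(- n.+1%:R : R), 0]) f t)%R.

Let Fn_derive f n x : continuous f -> - n.+1%:R < x -> is_derive x 1 (Fn f n) (f x).
Proof.
move=> cf nx.
pose I y := (\int[lebesgue_measure]_(t in `[(- n.+1%:R : R), y]) f t)%R.
have [d1 d2] : derivable I x 1 /\ derive1 I x = f x.
apply: (@continuous_FTC1_closed R f (- n.+1%:R) x (x + 1)).
- by rewrite ltrDl.
- apply: continuous_compact_integrable; first exact: segment_compact.
  exact: continuous_subspaceT.
- exact: nx.
- exact: cf.
rewrite -[f x]subr0 -d2 derive1E; apply: is_deriveB.
by apply: DeriveDef.
Qed.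

(** Integrals from a fixed left end give primitives on a half-line. Those obtained
    for two left ends agree on the common half-line, as their difference has derivative 0
    and vanishes at 0, so they glue to a primitive on the line. *)
Lemma primitive_exists f : continuous f ->
  exists F, F 0 = 0 /\ forall x, is_derive x 1 F (f x).
Proof.
move=> cf.
have F0 n : Fn f n 0 = 0 by rewrite /Fn subrr.
have E n m x : - n.+1%:R < x -> - m.+1%:R < x -> Fn f n x = Fn f m x.
  move=> nx mx.
  pose D t := Fn f n t - Fn f m t.
  have dD t : - n.+1%:R < t -> - m.+1%:R < t -> is_derive t 1 D 0.
    move=> nt mt; have := Fn_derive cf nt; have := Fn_derive cf mt.
    by move=> d1 d2; rewrite -(subrr (f t)); apply: is_deriveB.
  have n0 k : - k.+1%:R < 0 :> R by rewrite oppr_lt0.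
  have {}dD t : Order.min 0 x <= t -> is_derive t 1 D 0.
    by rewrite ge_min => /orP[] h; apply: dD; apply: lt_le_trans h.
  have cD a b : Order.min 0 x <= a -> {within `[a, b], continuous D}.
    move=> ha; apply: continuous_in_subspaceT => t; rewrite inE/= in_itv/= => /andP[at_ tb].
    by apply/is_derive_continuous/dD/(le_trans ha).
  have D0 : D 0 = 0 by rewrite /D !F0 subrr.
  have : D x = 0.
    have [x0|x0] := leP 0 x.
      rewrite -D0; apply/esym/derive_eq0_eq => //; first by apply: cD; rewrite ge_min lexx.
      by move=> t /andP[t0 _]; apply: dD; rewrite ge_min ltW.
    rewrite -D0; apply/derive_eq0_eq => //; first exact: ltW.
      by apply: cD; rewrite ge_min lexx orbT.
    by move=> t /andP[t0 _]; apply: dD; rewrite ge_min (ltW t0) orbT.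
  by move/eqP; rewrite subr_eq0 => /eqP.
pose N x := Num.bound `|x|.
have bN x y : `|y - x| < 1 -> - (N x).+1%:R < y.
  move=> xy; have := archi_boundP (normr_ge0 x).
  rewrite -/(N x) -natr1; have := ler_norm (- x); rewrite normrN.
  by have := ler_norm (x - y); rewrite distrC; lra.
exists (fun x => Fn f (N x) x); split; first exact: F0.
move=> x; apply: (@near_eq_is_derive _ _ _ (Fn f (N x))); last first.
  by apply: Fn_derive => //; apply: bN; rewrite subrr normr0.
near=> y.
apply: E; apply: bN; last by rewrite subrr normr0.
rewrite distrC; near: y.
exact: (@nbhsx_ballx R R x 1 ltr01).
Unshelve. all: by end_near. Qed.

Definition prim f : R -> R :=
  xget (cst 0) [set F | F 0 = 0 /\ forall x, is_derive x 1 F (f x)].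

Lemma primP f : continuous f -> prim f 0 = 0 /\ forall x, is_derive x 1 (prim f) (f x).
Proof.
move=> /primitive_exists[F hF]; rewrite /prim; case: xgetP => [G _ //|/(_ F)].
by case.
Qed.

Lemma prim0 f : continuous f -> prim f 0 = 0. Proof. by move=> /primP[]. Qed.
Lemma is_derive_prim f x : continuous f -> is_derive x 1 (prim f) (f x).
Proof. by move=> /primP[_]. Qed.
Lemma continuous_prim f : continuous f -> continuous (prim f).
Proof. by move=> cf x; exact/is_derive_continuous/is_derive_prim. Qed.

End calculus.

Section prim_more.
Variable R : realType.
Implicit Types (f g F G : R -> R) (a b c k l x y t : R).

Lemma prim_unique f G x : continuous f -> (forall x, is_derive x 1 G (f x)) ->
  prim f x = G x - G 0.
Proof.
move=> cf dG; pose D y := prim f y - G y.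
have : D x = D 0.
  apply: is_derive_0_is_cst => y; rewrite -(subrr (f y)).
  exact: isder_sub (is_derive_prim _ cf) (dG _).
by rewrite /D prim0//; lra.
Qed.

Lemma prim_shift f k l x : continuous f ->
  prim (fun t => k * f (t + l)) x = k * (prim f (x + l) - prim f l).
Proof.
move=> cf; have cg : continuous (fun t => k * f (t + l)) by exact/cont_scale/cont_shift.
have dG t : is_derive t 1 (fun t => k * prim f (t + l)) (k * f (t + l)).
  by apply/isder_scale/isder_shift/is_derive_prim.
by rewrite (prim_unique _ cg dG) add0r -mulrBr.
Qed.

Lemma prim_le f g a b : a <= b -> continuous f -> continuous g ->
  (forall t, a <= t <= b -> f t <= g t) ->
  prim f b - prim f a <= prim g b - prim g a.
Proof.
move=> ab cf cg fg; pose D t := prim g t - prim f t.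
suff : D a <= D b by rewrite /D; lra.
have dD t : is_derive t 1 D (g t - f t).
  by apply: is_deriveB; exact: is_derive_prim.
apply: (@derive_ge0_le _ D (fun t => g t - f t)) => //.
  by apply: continuous_subspaceT => t; exact: is_derive_continuous (dD t).
by move=> x /andP[ax xb]; rewrite subr_ge0 fg// !ltW.
Qed.

Lemma prim_eq f g a b : a <= b -> continuous f -> continuous g ->
  (forall t, a <= t <= b -> f t = g t) ->
  prim f b - prim f a = prim g b - prim g a.
Proof.
move=> ab cf cg fg.
by apply/le_anti/andP; split; apply: prim_le => // t /fg ->.
Qed.

Lemma prim_ge0 f a b : a <= b -> continuous f ->
  (forall t, a <= t <= b -> 0 <= f t) -> prim f a <= prim f b.
Proof.
move=> ab cf f0; apply: (@derive_ge0_le _ _ f) => //.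
- by apply: continuous_subspaceT; exact: continuous_prim.
- by move=> t _; exact: is_derive_prim.
- by move=> t /andP[a1 b1]; rewrite f0// !ltW.
Qed.

Lemma prim_gt0 f a b : a < b -> continuous f ->
  (forall t, 0 < f t) -> prim f a < prim f b.
Proof.
move=> ab cf f0.
have [|c _ E] := @MVT R (prim f) f a b ab (fun x _ => is_derive_prim x cf).
  by apply: continuous_subspaceT; exact: continuous_prim.
by rewrite -subr_gt0 E mulr_gt0// subr_gt0.
Qed.

Lemma primD f g k x : continuous f -> continuous g ->
  prim (fun t => f t + k * g t) x = prim f x + k * prim g x.
Proof.
move=> cf cg; have cfg : continuous (fun t => f t + k * g t).
  by apply: cont_add => //; exact: cont_scale.
have dG t : is_derive t 1 (fun t => prim f t + k * prim g t) (f t + k * g t).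
  have dF := is_derive_prim t cf; have dH := is_derive_prim t cg.
  exact: isder_add dF (isder_scale k dH).
by rewrite (prim_unique _ cfg dG) !prim0// mulr0 addr0 subr0.
Qed.

End prim_more.

Section prim_bounds.
Variable R : realType.
Implicit Types (f : R -> R) (a b M : R).

Lemma prim_cst M x : prim (fun=> M : R) x = M * x.
Proof.
have dM (t : R) : is_derive t (1 : R) (fun t : R => M * t) M.
  by rewrite -[X in is_derive _ _ _ X]mulr1; exact: isder_scale (isder_id t).
by rewrite (prim_unique x (@cont_cst R M) dM) mulr0 subr0.
Qed.

Lemma prim_le_cst f a b M : a <= b -> continuous f ->
  (forall t, a <= t <= b -> f t <= M) -> prim f b - prim f a <= M * (b - a).
Proof.
move=> ab cf fM; rewrite mulrBr -!prim_cst.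
by apply: prim_le => //; exact: cont_cst.
Qed.

End prim_bounds.

(** * Trajectories driven by a potential *)

Section trajectories.
Variable R : realType.
Implicit Types (S : R -> R) (c k l s t M : R).

(** If S is a primitive of eta vanishing at 0, then [lead S c] is the solution of
    u' + eta u = 1 with value c at 0. Given u_1 = [lead S c], the function
    [growth S c k] is the square of the solution of y' = (u_1 - k) y with value 1 at
    0. These functions live on the whole line, so that the past and the future of a
    path are treated alike. *)
Definition expint S := prim (fun t => expR (S t)).
Definition lead S c t := expR (- S t) * (c + expint S t).
Definition leadint S c := prim (lead S c).
Definition growth S c k t := expR (2 * (leadint S c t - k * t)).
Definition growthint S c k := prim (growth S c k).

Variable S : R -> R.
Hypothesis cS : continuous S.

Lemma cont_exp (f : R -> R) : continuous f -> continuous (fun t => expR (f t)).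
Proof. by move=> cf; apply: cont_comp => //; exact: continuous_expR. Qed.

Lemma cont_expint : continuous (expint S).
Proof. exact/continuous_prim/cont_exp. Qed.

Lemma cont_lead c : continuous (lead S c).
Proof.
apply: cont_mul; first exact/cont_exp/cont_opp.
by apply: cont_add; [exact: cont_cst|exact: cont_expint].
Qed.

Lemma cont_leadint c : continuous (leadint S c).
Proof. exact/continuous_prim/cont_lead. Qed.

Lemma cont_growth c k : continuous (growth S c k).
Proof.
apply/cont_exp/cont_scale/cont_add; first exact: cont_leadint.
exact/cont_opp/cont_scale/cont_id.
Qed.

Lemma expint0 : expint S 0 = 0. Proof. exact/prim0/cont_exp. Qed.
Lemma leadint0 c : leadint S c 0 = 0. Proof. exact/prim0/cont_lead. Qed.
Lemma growthint0 c k : growthint S c k 0 = 0. Proof. exact/prim0/cont_growth. Qed.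
Lemma growth0 c k : growth S c k 0 = 1.
Proof. by rewrite /growth leadint0 mulr0 subrr mulr0 expR0. Qed.
Lemma growth_gt0 c k t : 0 < growth S c k t. Proof. exact: expR_gt0. Qed.

Lemma expint_le s t : s <= t -> expint S s <= expint S t.
Proof.
by move=> st; apply: prim_ge0 => //; exact: cont_exp.
Qed.

Lemma growthint_le c k s t : s <= t -> growthint S c k s <= growthint S c k t.
Proof.
move=> st; apply: prim_ge0 => //; first exact: cont_growth.
by move=> *; exact/ltW/growth_gt0.
Qed.

Lemma growthint_lt c k s t : s < t -> growthint S c k s < growthint S c k t.
Proof.
by move=> st; apply: prim_gt0 => //; [exact: cont_growth|move=> *; exact: growth_gt0].
Qed.

Lemma isder_lead c t e : is_derive t 1 S e ->
  is_derive t 1 (lead S c) (1 - e * lead S c t).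
Proof.
move=> dS; have dP := is_derive_prim t (cont_exp cS).
have D := isder_mul (isder_exp (isder_opp dS)) (isder_add (isder_cst c t) dP).
apply: (is_derive_eq D).
rewrite /lead -/(expint S) add0r -expRD addNr expR0.
by ring.
Qed.

Lemma leadintD c d t :
  leadint S (c + d) t = leadint S c t + d * prim (fun s => expR (- S s)) t.
Proof.
rewrite /leadint -primD; last 2 first.
- exact: cont_lead.
- exact/cont_exp/cont_opp.
by congr (prim _ t); apply/funext => s; rewrite /lead; ring.
Qed.

Lemma growth_lead_le c c' k t : t <= 0 -> c <= c' ->
  growth S c' k t <= growth S c k t.
Proof.
move=> t0 cc; rewrite /growth ler_expR ler_pM2l// lerB//.
rewrite -(subrKC c c') leadintD gerDl mulr_ge0_le0 ?subr_ge0//.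
have ce : continuous (fun s => expR (- S s)) by exact/cont_exp/cont_opp.
rewrite -(prim0 ce); apply: prim_ge0 => // s _; exact: expR_ge0.
Qed.

Lemma growthint_lead_le c c' k t : t <= 0 -> c <= c' ->
  growthint S c k t <= growthint S c' k t.
Proof.
move=> t0 cc.
have := @prim_le R (growth S c' k) (growth S c k) t 0 t0.
rewrite -/(growthint _ _ _) -/(growthint _ _ _) !growthint0 !sub0r lerN2; apply.
- exact: cont_growth.
- exact: cont_growth.
- by move=> s /andP[_ s0]; exact: growth_lead_le.
Qed.

(** Raising c by d changes the exponent of [growth] at s by 2 d times a primitive of
    e^-S, which on [t, 0] is smallest at t. *)
Lemma growthint_lead_perturb c d k t : t <= 0 -> 0 <= d ->
  growthint S (c + d) k t <=
  expR (2 * (d * prim (fun s => expR (- S s)) t)) * growthint S c k t.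
Proof.
move=> t0 d0; set e := expR _.
have ce : continuous (fun s => expR (- S s)) by exact/cont_exp/cont_opp.
have := @prim_le R (fun s => e * growth S c k (s + 0)) (growth S (c + d) k) t 0 t0.
have cg : continuous (growth S c k) by exact: cont_growth.
rewrite !(prim_shift _ _ _ cg) !addr0 -/(growthint _ _ _) -/(growthint _ _ _) !growthint0.
rewrite subrr mulr0 !sub0r subr0 lerN2; apply.
- by apply: cont_scale; apply: cont_shift; exact: cont_growth.
- exact: cont_growth.
- move=> s /andP[ts s0]; rewrite addr0 /e /growth -expRD ler_expR -mulrDr.
  rewrite ler_pM2l// addrA lerD2r leadintD addrC lerD2l ler_wpM2l//.
  by apply: prim_ge0 => // u _; exact: expR_ge0.
Qed.

(** Over the window of length 1 / (1 + M) before t,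
    growth (t - s) >= growth t * (1 + 2 (k - M) s), by expR x >= 1 + x. The length
    is chosen to keep the bound polynomial in M: the window of length 1 would cost a
    factor exponential in M, and the bound would no longer be tempered in u_1. *)
Lemma growthint_window c k t M : 0 <= M -> 0 <= k ->
  (forall s, t - 1 <= s <= t -> lead S c s <= M) ->
  k * growth S c k t <= (1 + M) ^+ 2 * (growthint S c k t - growthint S c k (t - 1)).
Proof.
move=> M0 k0 xM; set h := growth S c k; set Q := growthint S c k.
have M1 : 0 < 1 + M by rewrite ltr_pwDl.
pose d := (1 + M)^-1.
have d0 : 0 < d by rewrite invr_gt0.
have d1 : d <= 1 by rewrite invf_le1// lerDl.
have Md : M * d <= 1.
  by rewrite /d ler_pdivrMr// mul1r lerDr.
pose phi s := - Q (- s + t) - h t * (s + (k - M) * (s * s)).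
have dphi s : is_derive s 1 phi (h (- s + t) - h t * (1 + (k - M) * (s + s))).
  have dQ := is_derive_prim (- s + t) (@cont_growth c k).
  have dst := isder_add (isder_opp (isder_id s)) (isder_cst t s).
  have d1s := isder_opp (@isder_comp _ _ (fun s => - s + t) _ _ _ dQ dst).
  have d2s := isder_add (isder_id s)
    (isder_scale (k - M) (isder_mul (isder_id s) (isder_id s))).
  apply: (is_derive_eq (isder_sub d1s (isder_scale (h t) d2s))).
  by rewrite /h; ring.
have hge s : 0 <= s <= d -> h t * (1 + (k - M) * (s + s)) <= h (- s + t).
  move=> /andP[s0 sd].
  have -> : h (- s + t) = h t * expR (2 * (leadint S c (- s + t) - leadint S c t + k * s)).
    by rewrite /h /growth -expRD; congr expR; ring.
  rewrite ler_pM2l ?growth_gt0//; apply: le_trans (expR_ge1Dx _).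
  rewrite lerD2l.
  have := @prim_le_cst R (lead S c) (- s + t) t M.
  rewrite -/(leadint S c) => /(_ _ (@cont_lead c)) W.
  have /W : - s + t <= t by rewrite gerDr oppr_le0.
  have -> : t - (- s + t) = s by ring.
  move=> {}W.
  have : leadint S c t - leadint S c (- s + t) <= M * s.
    by apply: W => u /andP[u1 u2]; apply: xM; rewrite u2 andbT; lra.
  by lra.
have : phi 0 <= phi d.
  apply: (@derive_ge0_le _ phi (fun s => h (- s + t) - h t * (1 + (k - M) * (s + s)))).
  - exact: ltW.
  - by apply: continuous_subspaceT => s; exact: is_derive_continuous (dphi s).
  - by move=> s /andP[s0 sd]; rewrite subr_ge0 hge// !ltW.
rewrite /phi oppr0 add0r !mul0r mulr0 addr0 mulr0 subr0 => Qd.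
have Q1 : Q (t - 1) <= Q (- d + t) by apply: growthint_le; rewrite addrC lerD2r lerN2.
have : h t * (k * (d * d)) <= Q t - Q (t - 1).
  apply: (@le_trans _ _ (Q t - Q (- d + t))); last by lra.
  apply: (@le_trans _ _ (h t * (d + (k - M) * (d * d)))); last by lra.
  rewrite ler_pM2l ?growth_gt0// mulrBl addrCA lerDl.
  by rewrite mulrA subr_ge0 -[leRHS]mul1r ler_pM2r.
move=> H; have -> : k * h t = (1 + M) ^+ 2 * (h t * (k * (d * d))).
  by rewrite /d; field; rewrite gt_eqF.
by rewrite ler_pM2l// exprn_gt0.
Qed.

(** c + expint is nondecreasing, so that going back in time can increase the
    trajectory only through the factor e^-S. *)
Lemma lead_window L0 c t s : (forall s t, `|S t - S s| <= L0 * `|t - s|) -> 0 <= L0 ->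
  t - 1 <= s <= t -> lead S c s <= expR L0 * `|lead S c t|.
Proof.
move=> SL L00 /andP[ts st].
have S1 : S t - S s <= L0.
  apply: le_trans (ler_norm _) _; apply: le_trans (SL s t) _.
  rewrite -[leRHS]mulr1 ler_wpM2l// ger0_norm; lra.
have e : expR (- S s) = expR (S t - S s) * expR (- S t).
  by rewrite -expRD; congr expR; ring.
rewrite /lead normrM (ger0_norm (expR_ge0 _)) e -mulrA.
apply: (@le_trans _ _ (expR (S t - S s) * (expR (- S t) * `|c + expint S t|))).
  rewrite ler_pM2l ?expR_gt0// ler_pM2l ?expR_gt0//.
  by apply: le_trans (ler_norm _); rewrite lerD2l expint_le.
by rewrite ler_wpM2r ?mulr_ge0 ?expR_ge0// ler_expR.
Qed.

End trajectories.

(** Moving the origin of time to l replaces S by S(. + l) - S(l). *)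
Section shift.
Variable R : realType.
Variables (S : R -> R) (l : R).
Hypothesis cS : continuous S.
Let S' t := S (t + l) - S l.

Let cS' : continuous S'.
Proof. by apply: cont_add; [exact: cont_shift|exact: cont_cst]. Qed.

Lemma expint_shift t : expint S' t = expR (- S l) * (expint S (t + l) - expint S l).
Proof.
rewrite /expint -prim_shift; last exact: cont_exp.
by congr (prim _ t); apply/funext => s; rewrite -expRD addrC.
Qed.

Lemma lead_shift c t : lead S' (lead S c l) t = lead S c (t + l).
Proof.
rewrite /lead expint_shift -mulrDr /S' mulrA -expRD.
by congr (expR _ * _); ring.
Qed.

Lemma leadint_shift c t :
  leadint S' (lead S c l) t = leadint S c (t + l) - leadint S c l.
Proof.
rewrite -[RHS]mul1r /leadint -prim_shift; last exact: cont_lead.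
by congr (prim _ t); apply/funext => s; rewrite mul1r lead_shift.
Qed.

Lemma growth_shift c k t :
  growth S' (lead S c l) k t = (growth S c k l)^-1 * growth S c k (t + l).
Proof.
by rewrite /growth leadint_shift -expRN -expRD; congr expR; ring.
Qed.

Lemma growthint_shift c k t : growthint S' (lead S c l) k t =
  (growth S c k l)^-1 * (growthint S c k (t + l) - growthint S c k l).
Proof.
rewrite /growthint -prim_shift; last exact: cont_growth.
by congr (prim _ t); apply/funext => s; rewrite growth_shift.
Qed.

End shift.

(** * Convergence and compactness in l2 *)

Section l2_facts.
Variable R : realType.
Implicit Types (f g : nat -> R) (u v w : l2 R).

Definition l2_of f : l2 R := insubd (0 : l2 R) f.

Lemma l2_ofE f : square_summable f -> l2_of f =1 f.
Proof.
move=> sf k; have fS : f \in @sqsum R by apply/sqsumP.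
by rewrite /l2_of -[l2_val _]/(val _) insubdK.
Qed.

Lemma l2_ext u v : (forall k, u k = v k) -> u = v.
Proof. by move=> uv; apply/val_inj/funext. Qed.

Lemma l2_normE u : `|u| ^+ 2 = sqnorm u.
Proof. by rewrite [LHS]sqr_sqrtr// sqnorm_ge0//; exact: l2P. Qed.

Lemma l2_subE u v k : (u - v) k = u k - v k.
Proof. by rewrite l2_valD -scaleN1r l2_valZ !fctE scaleN1r. Qed.

Lemma square_summable_ge0 f g : cvgn (series g) ->
  (forall k, f k ^+ 2 <= g k) -> square_summable f.
Proof.
move=> sg fg; apply: (@series_le_cvg _ _ g) => //.
- by move=> k; exact: sqr_ge0.
- by move=> k; apply: le_trans (fg k); exact: sqr_ge0.
Qed.

Lemma square_summable_fin f n : (forall k, (n <= k)%N -> f k = 0) -> square_summable f.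
Proof.
move=> f0; apply/cvg_ex; exists (series (fun k => f k ^+ 2) n).
apply: cvg_near_cst; near=> m; have nm : (n <= m)%N by near: m; exact: nbhs_infty_ge.
apply/eqP; rewrite -subr_eq0 sub_series_geq//; apply/eqP.
rewrite big_nat_cond big1// => k; rewrite andbT => /andP[nk _].
by rewrite f0// expr0n.
Unshelve. all: by end_near. Qed.

Lemma l2_norm_le u v : (forall k, u k ^+ 2 <= v k ^+ 2) -> `|u| <= `|v|.
Proof.
move=> uv; rewrite -(@ler_pXn2r _ 2)// ?nnegrE// !l2_normE.
have [|_] := @sqsum_le R 1 0 v v u (@l2P R v) (@l2P R v).
  by move=> k; rewrite mul1r mul0r addr0.
by rewrite mul1r mul0r addr0.
Qed.

Lemma l2_coord_le u k : `|u k| <= `|u|.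
Proof.
rewrite -(@ler_pXn2r _ 2)// ?nnegrE// l2_normE real_normK ?num_real//.
apply: le_trans (sqnorm_ge k.+1 (@l2P R u)).
by rewrite /series/= big_nat_recr//= lerDr sumr_ge0// => j _; exact: sqr_ge0.
Qed.

Lemma l2_coord_dist u v k : `|u k - v k| <= `|u - v|.
Proof. by rewrite -l2_subE; exact: l2_coord_le. Qed.

Lemma sqnorm_tail u g n : cvgn (series g) -> (forall k, u k ^+ 2 <= g k) ->
  sqnorm u <= series (fun k => u k ^+ 2) n + (limn (series g) - series g n).
Proof.
move=> sg ug; have g0 k : 0 <= g k by apply: le_trans (ug k); exact: sqr_ge0.
apply: limr_le; first exact: l2P.
near=> m; have nm : (n <= m)%N by near: m; exact: nbhs_infty_ge.
have gm : series g m <= limn (series g).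
  by apply: nondecreasing_cvgn_le => //; apply: nondecreasing_series.
rewrite -lerBlDl; apply: (@le_trans _ _ (series g m - series g n)); last by rewrite lerD2r.
by rewrite !sub_series_geq//; exact: ler_sum.
Unshelve. all: by end_near. Qed.

(** Dominated convergence: the tails are uniformly small by domination, and the
    initial sections converge coordinate by coordinate. *)
Lemma l2_dominated_cvg (T : Type) (F : set_system T) {FF : Filter F}
    (u : T -> l2 R) (v : l2 R) (g : nat -> R) : cvgn (series g) ->
  (forall k, (fun t => u t k) @ F --> v k) ->
  (\forall t \near F, forall k, u t k ^+ 2 <= g k) -> u @ F --> v.
Proof.
move=> sg uv ug; pose G k := 2 * g k + 2 * v k ^+ 2.
have sG : cvgn (series G).
  apply: is_cvg_seriesD; apply: is_cvg_seriesZ => //; exact: l2P.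
apply/cvgrPdist_lt => e e0.
have e2 : 0 < e ^+ 2 / 2 by rewrite divr_gt0// exprn_gt0.
have /cvgrPdist_lt/(_ _ e2)[n _ /(_ n (leqnn n))/= Gn] := sG.
have fin : (fun t => series (fun k => (v k - u t k) ^+ 2) n) @ F --> (0 : R).
  elim: (n) => [|m IH].
    by under eq_fun do rewrite /series/= big_geq//; exact: cvg_cst.
  have -> : 0 = 0 + (v m - v m) * (v m - v m) :> R by rewrite subrr mul0r addr0.
  under eq_fun do rewrite /series/= big_nat_recr//= expr2.
  by apply: cvgD => //; apply: cvgM; apply: cvgB => //; exact: cvg_cst.
near=> t.
have tn : series (fun k => (v k - u t k) ^+ 2) n < e ^+ 2 / 2.
  near: t; move/cvgrPdist_lt : fin => /(_ _ e2); apply: filterS => t.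
  by rewrite sub0r normrN; apply: le_lt_trans; exact: ler_norm.
rewrite -(@ltr_pXn2r _ 2)// ?nnegrE//; last exact: ltW.
rewrite l2_normE; apply: (@le_lt_trans _ _ (series (fun k => (v - u t) k ^+ 2) n +
    (limn (series G) - series G n))).
  apply: sqnorm_tail => // k; rewrite l2_subE /G.
  have : u t k ^+ 2 <= g k by move: k; near: t.
  by have := sqr_ge0 (v k + u t k); nra.
have -> : (fun k => (v - u t) k ^+ 2) = (fun k => (v k - u t k) ^+ 2).
  by apply/funext => k; rewrite l2_subE.
have := ler_norm (limn (series G) - series G n); lra.
Unshelve. all: by end_near. Qed.

(** The box is compact in the product topology by Tychonoff's theorem, and on it
    the norm topology is not finer, by dominated convergence. *)
Lemma compact_l2_box (lo hi g : nat -> R) : cvgn (series g) ->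
  (forall k, lo k ^+ 2 <= g k) -> (forall k, hi k ^+ 2 <= g k) ->
  compact [set u : l2 R | forall k, lo k <= u k <= hi k].
Proof.
move=> sg log hig.
have bg k x : lo k <= x <= hi k -> x ^+ 2 <= g k.
  move=> /andP[lx xh]; have [x0|x0] := leP 0 x.
    by apply: le_trans (hig k); rewrite !expr2; apply: ler_pM.
  apply: le_trans (log k); rewrite -sqrrN -[leRHS]sqrrN !expr2.
  by apply: ler_pM; rewrite ?oppr_ge0 ?lerN2 // ltW.
pose K := [set f : prod_topology (fun _ : nat => R) | forall k, `[lo k, hi k]%classic (f k)].
have cK : compact K.
  apply: (@tychonoff _ (fun=> R) (fun k => `[lo k, hi k]%classic)) => k.
  exact: segment_compact.
have KE f : K f -> forall k, f k ^+ 2 <= g k.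
  by move=> Kf k; apply: bg; have := Kf k; rewrite /= in_itv.
have KS f : K f -> square_summable f.
  by move=> /KE; exact: square_summable_ge0.
have -> : [set u : l2 R | forall k, lo k <= u k <= hi k] = l2_of @` K.
  apply/seteqP; split=> [u hu|_ [f Kf <-] k] /=.
    exists (u : nat -> R); first by move=> k; rewrite /= in_itv/=.
    by apply: l2_ext; apply: l2_ofE; exact: l2P.
  by rewrite l2_ofE; [have := Kf k; rewrite /= in_itv|exact: KS].
apply: continuous_compact cK; apply/subspace_continuousP => f Kf.
apply: (@l2_dominated_cvg _ _ _ _ _ g) => //.
  move=> k; rewrite (l2_ofE (KS _ Kf)).
  apply: (@cvg_trans _ ((fun h : prod_topology (fun _ : nat => R) => h k) @ within K (nbhs f))).
    apply: near_eq_cvg; near=> h; apply/esym/l2_ofE/KS.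
    by near: h; exact: withinT.
  apply: cvg_within_filter; exact: (@proj_continuous _ (fun _ => R) k f).
near=> h; have Kh : K h by near: h; exact: withinT.
by move=> k; rewrite (l2_ofE (KS _ Kh)); exact: KE.
Unshelve. all: by end_near. Qed.

End l2_facts.

(** * The potential of a path of the noise *)

Lemma int_le_addn (n m : int) : n <= m -> exists k : nat, m = n + k%:Z.
Proof. by move=> nm; exists `|m - n|%N; lia. Qed.

Section potential.
Variable R : realType.
Variables a b : R.
Implicit Types (eta : Gamma) (j l n : int) (s t : R).

Definition letter (x : bool) : R := if x then a else - b.

(** [Negz i] is the site - i - 1, so that at - n the letters of the sites
    - n, ..., - 1 are subtracted. *)
Definition ipot eta j : R :=
  match j with
  | Posz n => \sum_(i < n) letter (eta (i : nat)%:Z)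
  | Negz n => - \sum_(i < n.+1) letter (eta (Negz i))
  end.

Definition pot eta t : R :=
  ipot eta (Num.floor t) + (t - (Num.floor t)%:~R) * letter (eta (Num.floor t)).

Lemma ipotD1 eta j : ipot eta (j + 1) = ipot eta j + letter (eta j).
Proof.
case: j => [n|[|n]].
- by rewrite -[(n%:Z + 1)%R]/(n + 1)%N%:Z addn1 /= big_ord_recr.
- by rewrite -[(Negz 0 + 1)%R]/(0%N : int) /= big_ord0 big_ord1 addNr.
- have -> : Negz n.+1 + 1 = Negz n by rewrite !NegzE; lia.
  by rewrite /= [X in _ = - X + _]big_ord_recr/= opprD subrK.
Qed.

Lemma pot_seg eta n t : n%:~R <= t <= (n + 1)%:~R ->
  pot eta t = ipot eta n + (t - n%:~R) * letter (eta n).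
Proof.
move=> /andP[nt]; rewrite le_eqVlt => /predU1P[->|tn].
  rewrite /pot intrKfloor ipotD1 subrr mul0r addr0 intrD.
  by rewrite (addrC n%:~R) addrK mul1r.
by rewrite /pot (@floor_def _ _ n)// nt.
Qed.

Lemma pot_int eta n : pot eta n%:~R = ipot eta n.
Proof. by rewrite (@pot_seg _ n) ?lexx ?ler_int ?lerDl// subrr mul0r addr0. Qed.

Lemma pot0 eta : pot eta 0 = 0.
Proof. by rewrite -[0](mulr0z 1) pot_int /= big_ord0. Qed.

Lemma ipot_shift eta l j : ipot (bshift l eta) j = ipot eta (j + l) - ipot eta l.
Proof.
pose D j := ipot (bshift l eta) j - ipot eta (j + l).
have DS i : D (i + 1) = D i.
  by rewrite /D (addrAC i) !ipotD1 /bshift; ring.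
suff : D j = D 0 by rewrite /D (add0r l) /= big_ord0; lra.
elim: j => // n.
  by move=> <-; rewrite -addn1 PoszD DS.
by move=> <-; rewrite -[in LHS]DS; congr D; rewrite -addn1 PoszD opprD subrK.
Qed.

Lemma pot_shift eta l t : pot (bshift l eta) t = pot eta (t + l%:~R) - pot eta l%:~R.
Proof.
rewrite pot_int /pot floorDrz ?intr_int// intrKfloor ipot_shift intrD.
by rewrite /bshift; ring.
Qed.

Lemma letter_bound x : 0 < a -> 0 < b -> `|letter x| <= a + b.
Proof.
by move=> a0 b0; case: x; rewrite /letter ?normrN gtr0_norm//; lra.
Qed.

(** The potential is affine with a slope bounded by a + b on every unit interval,
    and the general case follows by cutting [s, t] at the integers in it. *)
Lemma pot_lipschitz eta s t : 0 < a -> 0 < b ->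
  `|pot eta t - pot eta s| <= (a + b) * `|t - s|.
Proof.
move=> a0 b0.
have ab : 0 <= a + b by rewrite addr_ge0// ltW.
have I n (k : nat) : `|ipot eta (n + k%:Z) - ipot eta n| <= (a + b) * k%:R.
  elim: k => [|k IH]; first by rewrite addr0 subrr normr0 mulr0.
  rewrite -addn1 PoszD addrA ipotD1 natrD mulrDr mulr1 addrAC.
  by apply: le_trans (ler_normD _ _) _; rewrite lerD// letter_bound.
have T n u v : n%:~R <= u <= (n + 1)%:~R -> n%:~R <= v <= (n + 1)%:~R ->
    `|pot eta u - pot eta v| <= (a + b) * `|u - v|.
  move=> nu nv; rewrite (pot_seg _ nu) (pot_seg _ nv).
  have -> : ipot eta n + (u - n%:~R) * letter (eta n) -
    (ipot eta n + (v - n%:~R) * letter (eta n)) = letter (eta n) * (u - v) by ring.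
  by rewrite normrM ler_wpM2r// letter_bound.
wlog st : s t / s <= t.
  move=> H; have [/H//|/ltW/H] := leP s t.
  by rewrite distrC (distrC t).
have fs := floor_itv s; have ft := floor_itv t.
have fs' : (Num.floor s)%:~R <= s <= (Num.floor s + 1)%:~R by case/andP: fs => -> /ltW.
have ft' : (Num.floor t)%:~R <= t <= (Num.floor t + 1)%:~R by case/andP: ft => -> /ltW.
have := le_floor st; rewrite le_eqVlt => /predU1P[E|].
  by apply: (@T (Num.floor t)) => //; rewrite -E.
rewrite -lezD1 => nt.
set n := Num.floor s + 1 in nt fs' *; set m := Num.floor t in nt ft' *.
have [k mE] := int_le_addn nt.
have -> : pot eta t - pot eta s = (pot eta t - pot eta m%:~R) +
  (pot eta m%:~R - pot eta n%:~R) + (pot eta n%:~R - pot eta s) by ring.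
apply: le_trans (ler_normD _ _) _; apply: le_trans (lerD (ler_normD _ _) (lexx _)) _.
have nm : n%:~R <= m%:~R :> R by rewrite ler_int.
have -> : `|t - s| = `|t - m%:~R| + `|m%:~R - n%:~R| + `|n%:~R - s|.
  case/andP: fs' => _ ?; case/andP: ft' => ? _.
  by rewrite !ger0_norm; lra.
rewrite !mulrDr; apply: lerD; first apply: lerD.
- by apply: (T m) => //; rewrite lexx ler_int lerDl.
- rewrite !pot_int mE; apply: le_trans (I _ _) _.
  by rewrite intrD (addrC n%:~R) addrK normr_nat.
- by apply: (T (Num.floor s)) => //; rewrite lexx ler_int lerDl.
Qed.

Lemma pot_continuous eta : 0 < a -> 0 < b -> continuous (pot eta).
Proof.
move=> a0 b0 t; apply/cvgrPdist_lt => e e0.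
have ab : 0 < a + b by rewrite addr_gt0.
near=> s.
apply: le_lt_trans (pot_lipschitz _ _ _ a0 b0) _.
rewrite mulrC -ltr_pdivlMr//.
near: s; exact: (@nbhsx_ballx _ R t (e / (a + b)) (divr_gt0 e0 ab)).
Unshelve. all: by end_near. Qed.

Lemma isder_pot eta t : t \isn't a Num.int ->
  is_derive t 1 (pot eta) (noise a b eta t).
Proof.
rewrite intrEfloor => tn; set n := Num.floor t.
have /andP[nt tn1] := floor_itv t.
have {}nt : n%:~R < t by rewrite lt_neqAle tn.
apply: (@near_eq_is_derive _ _ _ (fun s => ipot eta n + (s - n%:~R) * letter (eta n))).
  near=> s; apply/esym/pot_seg; apply/andP; split.
    by near: s; apply: filterS (lt_nbhsr nt) => s; exact: ltW.
  by near: s; apply: filterS (lt_nbhsl tn1) => s; exact: ltW.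
have D := isder_add (isder_cst (ipot eta n) t)
  (isder_mul (isder_sub (isder_id t) (isder_cst n%:~R t)) (isder_cst (letter (eta n)) t)).
apply: (is_derive_eq D).
by rewrite mulr0 addr0 subr0 mul1r add0r.
Unshelve. all: by end_near. Qed.

End potential.

(** * The Bernoulli equation of the higher coordinates *)

Section modes.
Variable R : realType.
Variable S : R -> R.
Hypothesis cS : continuous S.
Implicit Types (c k s t T y : R).

Definition lead_param (S : R -> R) T x := expR (S T) * x - expint S T.

Lemma lead_paramK T x : lead S (lead_param S T x) T = x.
Proof. by rewrite /lead /lead_param subrK mulrA -expRD addNr expR0 mul1r. Qed.

Definition amp (S : R -> R) c k t := expR (leadint S c t - k * t).

Lemma amp_gt0 c k t : 0 < amp S c k t. Proof. exact: expR_gt0. Qed.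

Lemma growthE c k t : growth S c k t = amp S c k t ^+ 2.
Proof. by rewrite /growth /amp expr2 -expRD mulr2n mulrDl !mul1r. Qed.

Lemma isder_amp c k t : is_derive t 1 (amp S c k) ((lead S c t - k) * amp S c k t).
Proof.
have dW := is_derive_prim t (@cont_lead _ _ cS c).
have D := isder_exp (isder_sub dW (isder_scale k (isder_id t))).
by apply: (is_derive_eq D); rewrite /amp mulr1 mulrC.
Qed.

(** The solution with value y at T, obtained from the linear equation for the
    inverse of its square. *)
Definition mode_den (S : R -> R) c k T y t :=
  1 + 2 * (y / amp S c k T) ^+ 2 * (growthint S c k t - growthint S c k T).

Definition mode (S : R -> R) c k T y t :=
  y / amp S c k T * amp S c k t / Num.sqrt (mode_den S c k T y t).

Lemma mode_den_ge1 c k T y t : T <= t -> 1 <= mode_den S c k T y t.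
Proof.
move=> Tt; rewrite /mode_den lerDl; apply: mulr_ge0.
  by rewrite mulr_ge0 ?sqr_ge0.
by rewrite subr_ge0; exact: growthint_le.
Qed.

Lemma mode_sqr c k T y t : T <= t ->
  mode S c k T y t ^+ 2 * mode_den S c k T y t = (y / amp S c k T) ^+ 2 * growth S c k t.
Proof.
move=> Tt; have D1 := mode_den_ge1 c k y Tt.
have D0 : 0 < mode_den S c k T y t by apply: lt_le_trans D1.
rewrite /mode [X in X * _]expr_div_n sqr_sqrtr ?ltW// divfK ?gt_eqF//.
by rewrite exprMn growthE.
Qed.

Lemma mode_init c k T y : mode S c k T y T = y.
Proof.
by rewrite /mode /mode_den subrr mulr0 addr0 sqrtr1 divr1 divfK// gt_eqF// amp_gt0.
Qed.

Lemma mode_bound c k T y t : 0 <= k -> T <= t -> mode S c k T y t ^+ 2 <=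
  y ^+ 2 * expR (2 * (leadint S c t - leadint S c T)).
Proof.
move=> k0 Tt; have D1 := mode_den_ge1 c k y Tt.
apply: (@le_trans _ _ (mode S c k T y t ^+ 2 * mode_den S c k T y t)).
  by rewrite -[leLHS]mulr1 ler_wpM2l// sqr_ge0.
rewrite mode_sqr// expr_div_n -mulrA ler_wpM2l ?sqr_ge0// -growthE /growth.
rewrite -expRN -expRD ler_expR -mulrN -mulrDr ler_pM2l//.
have : k * T <= k * t by rewrite ler_wpM2l.
lra.
Qed.

Lemma isder_mode c k T y t : T <= t -> is_derive t 1 (mode S c k T y)
  (lead S c t * mode S c k T y t - mode S c k T y t ^+ 3 - k * mode S c k T y t).
Proof.
move=> Tt; have D1 := mode_den_ge1 c k y Tt.
have D0 : 0 < mode_den S c k T y t by apply: lt_le_trans D1.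
pose z := y / amp S c k T.
have dQ := is_derive_prim t (@cont_growth _ _ cS c k).
have dD : is_derive t 1 (mode_den S c k T y) (2 * z ^+ 2 * growth S c k t).
  have D := isder_add (isder_cst 1 t) (isder_scale (2 * z ^+ 2)
    (isder_sub dQ (isder_cst (growthint S c k T) t))).
  by apply: (is_derive_eq D); rewrite subr0 add0r.
have dq := @isder_comp _ _ (mode_den S c k T y) _ _ _ (is_derive1_sqrt D0) dD.
set q := fun s => Num.sqrt (mode_den S c k T y s).
have q0 : q t != 0 by rewrite gt_eqF// sqrtr_gt0.
have dV := @is_deriveV _ q t _ _ q0 dq.
have D := isder_mul (isder_scale z (isder_amp c k t)) dV.
apply: (is_derive_eq D).
rewrite /mode -/(q t) -/z growthE.
rewrite [_ *: _]mulrC; move: (amp S c k t) (lead S c t) => e x.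
by field; rewrite q0.
Qed.

(** Since (y - m) (y^3 - m^3) >= 0, the square of the difference of two solutions
    divided by [growth] is nonincreasing. *)
Lemma mode_unique c k T (y : R -> R) t : T <= t ->
  {within `[T, t], continuous y} ->
  (forall s, T < s < t -> is_derive s 1 y (lead S c s * y s - y s ^+ 3 - k * y s)) ->
  y t = mode S c k T (y T) t.
Proof.
move=> Tt cy dy; set m := mode S c k T (y T).
pose G s := (y s - m s) ^+ 2 * expR (- (2 * (leadint S c s - k * s))).
have dm s : T <= s -> is_derive s 1 m (lead S c s * m s - m s ^+ 3 - k * m s).
  by move=> ?; exact: isder_mode.
have dW s := is_derive_prim s (@cont_lead _ _ cS c).
pose df s := - 2 * (y s - m s) ^+ 2 * (y s ^+ 2 + y s * m s + m s ^+ 2) *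
  expR (- (2 * (leadint S c s - k * s))).
have dG s : T < s < t -> is_derive s 1 G (df s).
  move=> /andP[Ts st].
  have dys : is_derive s 1 y (lead S c s * y s - y s ^+ 3 - k * y s) by apply: dy; rewrite Ts.
  have dms := dm s (ltW Ts).
  have D := isder_mul (isder_sqr (isder_sub dys dms))
    (isder_exp (isder_opp (isder_scale 2 (isder_sub (dW s) (isder_scale k (isder_id s)))))).
  apply: (is_derive_eq D); rewrite /df -/(leadint S c).
  by ring.
have cm : {within `[T, t], continuous m}.
  apply: continuous_in_subspaceT => s; rewrite inE/= in_itv/= => /andP[Ts _].
  exact: is_derive_continuous (dm s Ts).
have cG : {within `[T, t], continuous G}.
  have cd : {within `[T, t], continuous (fun s => y s - m s)}.
    by move=> s; apply: continuousB; [exact: cy|exact: cm].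
  have ce : {within `[T, t], continuous (fun s => expR (- (2 * (leadint S c s - k * s))))}.
    apply: continuous_subspaceT; apply/cont_exp/cont_opp/cont_scale/cont_add.
      exact: cont_leadint.
    exact/cont_opp/cont_scale/cont_id.
  have -> : G = (fun s => (y s - m s) * (y s - m s) * expR (- (2 * (leadint S c s - k * s)))).
    by apply/funext => s; rewrite /G expr2.
  by move=> s; apply: cvgM; [apply: cvgM; exact: cd|exact: ce].
have : - G T <= - G t.
  apply: (@derive_ge0_le _ (fun s => - G s) (fun s => - df s)) => //.
  - by move=> s; apply: continuousN; exact: cG.
  - by move=> s /dG ds; exact: isder_opp.
  - move=> s _; have -> : - df s = (2 * (y s - m s) ^+ 2) *
        ((y s ^+ 2 + y s * m s + m s ^+ 2) * expR (- (2 * (leadint S c s - k * s)))).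
      by rewrite /df; ring.
    apply: mulr_ge0; first by rewrite mulr_ge0 ?sqr_ge0.
    apply: mulr_ge0; last exact: expR_ge0.
    have := sqr_ge0 (y s + m s / 2); have := sqr_ge0 (m s); nra.
rewrite lerN2 /G /m mode_init subrr expr0n mul0r.
rewrite pmulr_lle0 ?expR_gt0// => le0; apply/eqP; rewrite -subr_eq0 -sqrf_eq0.
by rewrite eq_le le0 sqr_ge0.
Qed.

End modes.

(** * The evolution operator *)

Section evolution_formula.
Variable R : realType.

Lemma is_cvg_series_head (x : R) (f : nat -> R) : cvgn (series f) ->
  cvgn (series (fun k => if k == 0%N then x else f k)).
Proof.
move=> sf; pose d k := if k == 0%N then x - f 0%N else 0.
have sd : cvgn (series d).
  apply/cvg_ex; exists (x - f 0%N); apply: cvg_near_cst; near=> n.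
  have n0 : (0 < n)%N by near: n; exact: nbhs_infty_gt.
  rewrite /series/= big_ltn//= big_nat_cond big1 ?addr0// => i.
  by rewrite andbT => /andP[i0 _]; rewrite /d gtn_eqF.
have -> : (fun k => if k == 0%N then x else f k) = d + f.
  by apply/funext => -[|k]; rewrite !fctE /d/= ?subrK// add0r.
exact: is_cvg_seriesD.
Unshelve. all: by end_near. Qed.

Lemma continuous_l2_coord k : continuous (fun u : l2 R => u k).
Proof.
move=> u; have F : Filter (nbhs u) by exact: nbhs_filter.
apply/(@cvgrPdist_lt _ _ _ (nbhs u)) => e e0.
apply: filterS (nbhsx_ballx u e e0) => v uv.
apply: le_lt_trans (l2_coord_dist u v k) _; exact: uv.
Qed.

Lemma continuous_maxl (T : R) : continuous (fun t => Num.max t T).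
Proof.
under eq_fun do rewrite maxr_absE.
apply: cont_mul; last exact: cont_cst.
apply: cont_add; first by apply: cont_add; [exact: cont_id|exact: cont_cst].
move=> t; apply: (@continuous_comp _ _ _ (fun t => t - T) Num.norm).
  by apply: cont_add; [exact: cont_id|exact: cont_cst].
exact: norm_continuous.
Qed.

(** The index is shifted: [rate j] is (j + 1)^4. *)
Definition rate (j : nat) : R := j.+1%:R ^+ 4.

Lemma rate_ge0 j : 0 <= rate j. Proof. by rewrite exprn_ge0. Qed.

(** The function is constant between consecutive integers, and continuity makes the
    constants agree. *)
Lemma derive_eq0_off_int (f : R -> R) (tau : int) (t : R) : tau%:~R <= t ->
  {within `[tau%:~R, +oo[, continuous f} ->
  (forall s : R, tau%:~R < s -> s \isn't a Num.int -> is_derive s 1 f 0) ->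
  f t = f tau%:~R.
Proof.
move=> Tt cf df.
have step (n : nat) (s : R) : (tau + n%:Z)%:~R <= s <= (tau + n.+1%:Z)%:~R ->
    f s = f (tau + n%:Z)%:~R.
  move=> /andP[ns sn]; apply/esym/derive_eq0_eq => //.
    apply: continuous_subspaceW cf => x/=; rewrite !in_itv/= andbT => /andP[nx _].
    by apply: le_trans nx; rewrite ler_int lerDl.
  move=> x /andP[nx xs]; apply: df.
    by apply: le_lt_trans nx; rewrite ler_int lerDl.
  apply/negP => /intrP[m xm].
  move: nx (lt_le_trans xs sn); rewrite xm !ltr_int; lia.
have base (n : nat) : f (tau + n%:Z)%:~R = f tau%:~R.
  elim: n => [|n IH]; first by rewrite addr0.
  by rewrite (step n) ?IH// lexx andbT ler_int lerD2l lez_nat.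
have /andP[ft tf] := floor_itv t.
have : tau <= Num.floor t by rewrite floor_ge_int.
move=> /int_le_addn[k E].
rewrite (step k) ?base// -E ft/= ltW//.
by apply: lt_le_trans tf _; rewrite ler_int E; lia.
Qed.

Variables a b : R.
Hypotheses (a0 : 0 < a) (b0 : 0 < b).
Variables (eta : Gamma) (tau : int) (u0 : l2 R).
Let S := pot a b eta.
Let T : R := tau%:~R.
Let c := lead_param S T (u0 0%N).
Let cS : continuous S. Proof. exact: pot_continuous. Qed.

Let crd (j : nat) (t : R) : R :=
  if j == 0%N then lead S c t else mode S c (rate j) T (u0 j) t.

Let crd_summable t : T <= t -> square_summable (crd ^~ t).
Proof.
move=> Tt; apply: (@square_summable_ge0 _ _ (fun k => if k == 0%N then lead S c t ^+ 2 else
   expR (2 * (leadint S c t - leadint S c T)) * u0 k ^+ 2)).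
  apply: is_cvg_series_head; apply: (is_cvg_seriesZ (f := fun k => u0 k ^+ 2)).
  exact: l2P.
move=> k; rewrite /crd; case: ifP => // _; rewrite mulrC.
by apply: mode_bound => //; exact: rate_ge0.
Qed.

Let flow (t : R) : l2 R := l2_of (crd ^~ (Num.max t T)).

Let flowE t j : T <= t -> flow t j = crd j t.
Proof.
by move=> Tt; rewrite /flow max_l// l2_ofE//; exact: crd_summable.
Qed.

Let cont_crd j t : T <= t -> {for t, continuous (crd j)}.
Proof.
move=> Tt; case: j => [|j]; first exact: cont_lead.
exact: is_derive_continuous (isder_mode cS _ _ _ Tt).
Qed.

(* The maximum with T freezes the flow before T, where the formula for the modes
   may blow up. *)
Let flow_continuous : continuous flow.
Proof.
move=> t; set t' := Num.max t T; have Tt' : T <= t' by rewrite le_max lexx orbT.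
have cM := @continuous_maxl T.
pose A := `|lead S c t'| + 1; pose E := expR (2 * (leadint S c t' - leadint S c T)) + 1.
apply: (@l2_dominated_cvg _ _ _ _ _ _ (fun k => if k == 0%N then A ^+ 2 else E * u0 k ^+ 2)).
- apply: is_cvg_series_head; apply: (is_cvg_seriesZ (f := fun k => u0 k ^+ 2)).
  exact: l2P.
- move=> k; have -> : (fun t => flow t k) = (fun t => crd k (Num.max t T)).
    apply/funext => s; rewrite /flow l2_ofE//; apply: crd_summable.
    by rewrite le_max lexx orbT.
  have -> : flow t k = crd k t'.
    by rewrite /flow l2_ofE//; exact: crd_summable.
  apply: (@continuous_comp _ _ _ (fun t => Num.max t T) (crd k)); first exact: cM.
  exact: cont_crd.
- have cE : {for t, continuous (fun s => expR (2 * (leadint S c (Num.max s T) - leadint S c T)))}.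
    apply: (cont_comp (f := fun s => expR (2 * (leadint S c s - leadint S c T))) _ cM).
    apply/cont_exp/cont_scale/cont_add; first exact: cont_leadint.
    exact: cont_cst.
  have cL : {for t, continuous (fun s => lead S c (Num.max s T))}.
    by apply: (cont_comp _ cM); exact: cont_lead.
  move/cvgrPdist_lt : cE => /(_ 1 ltr01) nE; move/cvgrPdist_lt : cL => /(_ 1 ltr01) nL.
  near=> s => k.
  have Ts' : T <= (Num.max s T) by rewrite le_max lexx orbT.
  rewrite /flow l2_ofE; last exact: crd_summable.
  rewrite /crd; case: ifP => _.
    rewrite -(real_normK (num_real (lead _ _ _))) ler_pXn2r ?nnegrE ?addr_ge0//.
    have : `|lead S c t' - lead S c (Num.max s T)| < 1 by near: s.
    rewrite /A distrC -lerBlDl => /ltW; apply: le_trans; exact: lerB_dist.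
  apply: le_trans (mode_bound cS _ _ (rate_ge0 k) Ts') _.
  rewrite mulrC ler_wpM2r ?sqr_ge0//.
  have : `|expR (2 * (leadint S c t' - leadint S c T)) -
           expR (2 * (leadint S c (Num.max s T) - leadint S c T))| < 1 by near: s.
  rewrite /E distrC -lerBlDl => /ltW; apply: le_trans; exact: ler_norm.
Unshelve. all: by end_near. Qed.

Let flow_solution : solution a b eta T flow.
Proof.
have near_flow j t : T < t -> \forall s \near t, crd j s = flow s j.
  move=> Tt; near=> s; rewrite flowE//.
  by near: s; apply: filterS (lt_nbhsr Tt) => s; exact: ltW.
split.
- exact: continuous_subspaceT.
- move=> t Tt tZ; apply: (near_eq_is_derive (near_flow 0%N t Tt)).
  rewrite flowE ?ltW//.
  have D := isder_lead cS c (isder_pot a b eta tZ).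
  exact: (is_derive_eq D).
- move=> [//|[//|k]] t _ Tt /=; apply: (near_eq_is_derive (near_flow k.+1 t Tt)).
  rewrite (flowE 0%N (ltW Tt)) (flowE k.+1 (ltW Tt)).
  exact: isder_mode (ltW Tt).
Unshelve. all: by end_near. Qed.

Let flow_init : flow T = u0.
Proof.
apply: l2_ext => j; rewrite flowE// /crd; case: eqP => [->|_].
  by rewrite /c lead_paramK.
exact: mode_init.
Qed.

(* The first coordinate is determined first; it is the coefficient of the others. *)
Let solution_unique u t j : solution a b eta T u -> u T = u0 -> T <= t ->
  u t j = crd j t.
Proof.
move=> [cu du dv] uT Tt.
have cuj i : {within `[T, +oo[, continuous (fun s => u s i)}.
  move=> s; apply: (@cvg_comp _ _ _ u (fun v : l2 R => v i) _ (nbhs (u s))).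
    exact: cu.
  exact: continuous_l2_coord.
have lead_eq s : T <= s -> u s 0%N = lead S c s.
  move=> Ts; pose f s := expR (S s) * u s 0%N - expint S s.
  have : f s = f T.
    apply: derive_eq0_off_int => //.
      move=> x; apply: cvgB; first apply: cvgM.
      - by apply: continuous_subspaceT; exact: cont_exp.
      - exact: cuj.
      - by apply: continuous_subspaceT; exact: cont_expint.
    move=> x Tx xZ.
    have D := isder_sub (isder_mul (isder_exp (isder_pot a b eta xZ)) (du x Tx xZ))
      (is_derive_prim x (cont_exp cS)).
    by apply: (is_derive_eq D); rewrite /S; ring.
  rewrite /f uT -/(lead_param S T (u0 0%N)) -/c => cE.
  rewrite /lead -cE subrK mulrA -expRD addNr expR0 mul1r//.
case: j => [|j]; first by rewrite lead_eq.
rewrite /crd /= -uT; apply: (mode_unique cS (y := fun s => u s j.+1)) => //.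
  by apply: continuous_subspaceW (cuj j.+1) => x/=; rewrite !in_itv/= andbT => /andP[].
move=> s /andP[Ts _]; have := dv j.+2 s isT Ts.
by rewrite /= lead_eq// ltW.
Qed.

Lemma evolutionE t j : T <= t -> evolution a b eta t T u0 j =
  if j == 0%N then lead S c t else mode S c (rate j) T (u0 j) t.
Proof.
move=> Tt; rewrite /evolution; case: xgetP => [v _ [u [su uT] <-]|].
  exact: solution_unique.
by move=> /(_ (flow t)); case; exists flow.
Qed.

End evolution_formula.

(** * Stationary trajectories and the box *)

Section rsup.
Variable R : realType.
Implicit Types (f : nat -> R) (F : R -> R) (C x t : R).

(** The extended supremum makes this measurable in a parameter without any
    assumption of boundedness. *)
Definition rsup f : R := fine (ereal_sup (range (EFin \o f))).

Lemma rsup_cvg f C : nondecreasing_seq f -> (forall n, f n <= C) ->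
  f @ \oo --> rsup f.
Proof.
move=> ndf fC; rewrite /rsup.
have ub : has_ubound (range f) by exists C => _ [n _ <-].
have -> : range (EFin \o f) = EFin @` range f by rewrite image_comp.
rewrite ereal_sup_EFin//; last by exists (f 0%N), 0%N.
exact: nondecreasing_cvgn.
Qed.

(** By monotonicity the limit at - oo may be taken along any arithmetic progression
    x - n, which is what a change of the origin of time requires. *)
Lemma rsup_anti F C : {homo F : s t / s <= t >-> t <= s} -> (forall t, F t <= C) ->
  [/\ forall t, F t <= rsup (fun n => F (- n%:R)) &
      forall x, F (x - n%:R) @[n --> \oo] --> rsup (fun n => F (- n%:R)) ].
Proof.
move=> aF FC; set f := fun n : nat => F (- n%:R).
have ndf : nondecreasing_seq f.
  by move=> n m nm; apply: aF; rewrite lerN2 ler_nat.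
have cf : f @ \oo --> rsup f by apply: (rsup_cvg (C := C)) => // n; exact: FC.
have ub t : F t <= rsup f.
  have [n tn] : exists n : nat, - n%:R <= t.
    exists (Num.bound `|t|); have := archi_boundP (normr_ge0 t).
    by have := ler_norm (- t); rewrite normrN; lra.
  apply: (le_trans (aF _ _ tn)); rewrite -(cvg_lim _ cf)//.
  by apply: nondecreasing_cvgn_le => //; apply/cvg_ex; exists (rsup f).
split=> // x; apply/cvgrPdist_lt => e e0.
move/cvgrPdist_lt : (cf) => /(_ e e0)[N _ /(_ N (leqnn N))/= fN].
have {}fN : rsup f - f N < e by apply: le_lt_trans fN; exact: ler_norm.
near=> n; rewrite ger0_norm ?subr_ge0//.
have : f N <= F (x - n%:R).
  apply: aF; have : x + N%:R <= n%:R by near: n; exact: nbhs_infty_ger.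
  lra.
lra.
Unshelve. all: by end_near. Qed.

Lemma prim_exp_bound (f : R -> R) (C mu s t : R) : 0 < mu -> s <= t -> continuous f ->
  (forall u, u <= t -> f u <= expR (C + mu * u)) ->
  prim f t - prim f s <= expR (C + mu * t) / mu.
Proof.
move=> mu0 st cf fC.
have cg : continuous (fun u => expR (C + mu * u)).
  apply/cont_exp/cont_add; [exact: cont_cst|apply: cont_scale; exact: cont_id].
pose g (u : R) := expR (C + mu * u) * mu^-1.
have dg (u : R) : is_derive u 1 g (expR (C + mu * u)).
  have D := isder_mul (isder_exp (isder_add (isder_cst C u)
     (isder_scale mu (isder_id u)))) (isder_cst mu^-1 u).
  apply: (is_derive_eq D); rewrite mulr0 addr0 add0r mulr1 -mulrA mulfV ?mulr1//.
  exact: lt0r_neq0.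
apply: (@le_trans _ _ (g t - g s)).
  have -> : g t - g s = prim (fun u => expR (C + mu * u)) t -
                     prim (fun u => expR (C + mu * u)) s.
    by rewrite !(prim_unique _ cg dg); ring.
  by apply: prim_le => // u /andP[_ ut]; exact: fC.
by rewrite /g gerBl mulr_ge0 ?expR_ge0// invr_ge0 ltW.
Qed.

End rsup.

Section stationary.
Variable R : realType.
Implicit Types (S : R -> R) (c k l s t m : R).

(** The integral of e^S over the past: the value at time 0 of the trajectory
    u_1(t) = e^-S(t) int_-oo^t e^S. *)
Definition stat_param S : R := rsup (fun n => - expint S (- n%:R)).
(** The integral of [growth] over the past. At time 0 the entire solutions of the
    mode fill the interval of the y with 2 * stat_mass * y ^+ 2 <= 1. *)
Definition stat_mass S c k : R := rsup (fun n => - growthint S c k (- n%:R)).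

(** The integrals over the past that define the box converge. *)
Definition confined S : Prop :=
  (exists C, forall t, - expint S t <= C) /\
  forall k, exists C, forall t, - growthint S (stat_param S) k t <= C.

Variable S : R -> R.
Hypothesis (cS : continuous S) (hS : confined S).
Let L := stat_param S.

Lemma expint_le_stat t : - expint S t <= L.
Proof.
case: hS => -[C hC] _; have [|//|h _] := @rsup_anti _ (fun t => - expint S t) C.
  by move=> s u su; rewrite lerN2; exact: expint_le.
exact: h.
Qed.

Lemma cvg_expint x : - expint S (x - n%:R) @[n --> \oo] --> L.
Proof.
case: hS => -[C hC] _; have [|//|_ h] := @rsup_anti _ (fun t => - expint S t) C.
  by move=> s u su; rewrite lerN2; exact: expint_le.
exact: h.
Qed.

Lemma lead_stat_ge0 t : 0 <= lead S L t.
Proof.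
by rewrite mulr_ge0 ?expR_ge0// -lerBlDr sub0r expint_le_stat.
Qed.

Lemma growthint_le_stat k t : - growthint S L k t <= stat_mass S L k.
Proof.
case: hS => _ /(_ k)[C hC]; have [|//|h _] := @rsup_anti _ (fun t => - growthint S L k t) C.
  by move=> s u su; rewrite lerN2; exact: growthint_le.
exact: h.
Qed.

Lemma cvg_growthint k x : - growthint S L k (x - n%:R) @[n --> \oo] --> stat_mass S L k.
Proof.
case: hS => _ /(_ k)[C hC]; have [|//|_ h] := @rsup_anti _ (fun t => - growthint S L k t) C.
  by move=> s u su; rewrite lerN2; exact: growthint_le.
exact: h.
Qed.

Lemma stat_mass_gt k t : 0 < stat_mass S L k + growthint S L k t.
Proof.
have := growthint_le_stat k (t - 1).
have : growthint S L k (t - 1) < growthint S L k t.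
  by apply: growthint_lt => //; rewrite gtrBl.
lra.
Qed.

Variable l : R.
Let S' t := S (t + l) - S l.

Let cS' : continuous S'.
Proof. by apply: cont_add; [exact: cont_shift|exact: cont_cst]. Qed.

Lemma stat_param_shift : stat_param S' = lead S L l.
Proof.
pose f n := - expint S' (- n%:R).
have fE : f = (fun n => expR (- S l) * (expint S l - expint S (l - n%:R))).
  by apply/funext => n; rewrite /f /S' expint_shift// (addrC _ l) -mulrN opprB.
have f1 : f @ \oo --> stat_param S'.
  apply: (rsup_cvg (C := expR (- S l) * (expint S l + L))) => [n m nm|n].
    by rewrite lerN2; apply: expint_le => //; rewrite lerN2 ler_nat.
  by rewrite -/(f n) fE ler_wpM2l ?expR_ge0// lerD2l expint_le_stat.
have f2 : f @ \oo --> lead S L l.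
  rewrite /lead (addrC L) fE.
  by apply: cvgM; [exact: cvg_cst|apply: cvgD; [exact: cvg_cst|exact: cvg_expint]].
by rewrite -(cvg_lim _ f1)// (cvg_lim _ f2).
Qed.

Lemma stat_mass_shift k : stat_mass S' (lead S L l) k =
  (growth S L k l)^-1 * (stat_mass S L k + growthint S L k l).
Proof.
pose f n := - growthint S' (lead S L l) k (- n%:R).
have fE : f = (fun n => (growth S L k l)^-1 * (growthint S L k l - growthint S L k (l - n%:R))).
  by apply/funext => n; rewrite /f /S' growthint_shift// (addrC _ l) -mulrN opprB.
have h0 : 0 <= (growth S L k l)^-1 by rewrite invr_ge0 ltW// growth_gt0.
have f1 : f @ \oo --> stat_mass S' (lead S L l) k.
  apply: (rsup_cvg (C := (growth S L k l)^-1 * (growthint S L k l + stat_mass S L k))).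
    by move=> n m nm; rewrite lerN2; apply: growthint_le => //; rewrite lerN2 ler_nat.
  by move=> n; rewrite -/(f n) fE ler_wpM2l// lerD2l growthint_le_stat.
have f2 : f @ \oo --> (growth S L k l)^-1 * (stat_mass S L k + growthint S L k l).
  rewrite (addrC (stat_mass _ _ _)) fE.
  by apply: cvgM; [exact: cvg_cst|apply: cvgD; [exact: cvg_cst|exact: cvg_growthint]].
by rewrite -(cvg_lim _ f1)// (cvg_lim _ f2).
Qed.

End stationary.

Section attractor_box.
Variable R : realType.
Implicit Types (S : R -> R) (c k s t m : R) (u v w : l2 R).

(** Coordinate 0 is the one of the linear equation. *)
Definition abox S : set (l2 R) := [set u | u 0%N = stat_param S /\
  forall j, (0 < j)%N -> 2 * stat_mass S (stat_param S) (rate R j) * u j ^+ 2 <= 1].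

(** The box at time t along the path that S describes. *)
Definition abox_at S t : set (l2 R) := let L := stat_param S in
  [set u | u 0%N = lead S L t /\ forall j, (0 < j)%N ->
    2 * (stat_mass S L (rate R j) + growthint S L (rate R j) t) * u j ^+ 2 <=
    growth S L (rate R j) t].

Variable S : R -> R.
Hypothesis (cS : continuous S) (hS : confined S).
Let L := stat_param S.

Lemma abox_shift t : abox (fun s => S (s + t) - S t) = abox_at S t.
Proof.
apply/seteqP; split=> u; rewrite /abox /abox_at /= stat_param_shift// => -[-> uj];
    split=> // j j0; have := uj _ j0; rewrite stat_mass_shift//.
  by rewrite (mulrCA 2) -[_^-1 * _ * _]mulrA ler_pdivrMl ?growth_gt0// mulr1.
by rewrite (mulrCA 2) -[_^-1 * _ * _]mulrA ler_pdivrMl ?growth_gt0// mulr1.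
Qed.

Lemma rate_gt0 j : 0 < rate R j. Proof. by rewrite exprn_gt0. Qed.

Lemma is_cvg_series_rate (z : R) : cvgn (series (fun j => z / rate R j)).
Proof.
apply: (is_cvg_seriesZ (f := fun j => (rate R j)^-1)).
apply: nondecreasing_is_cvgn.
  by apply: nondecreasing_series => j _ _; rewrite invr_ge0 rate_ge0.
exists 3 => _ [n _ <-].
suff : series (fun j => (rate R j)^-1) n <= 3 - 2 / n.+1%:R.
  by move=> /le_trans; apply; rewrite gerBl divr_ge0.
elim: n => [|n IH]; first by rewrite /series/= big_geq// divr1; lra.
rewrite /series/= big_nat_recr//=; apply: (le_trans (lerD IH (lexx _))).
rewrite /rate; set x : R := n.+1%:R; have x1 : 1 <= x by rewrite ler1n.
have -> : n.+2%:R = x + 1 :> R by rewrite natr1.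
have x0 : 0 < x by lra.
have x3 : x <= x ^+ 3 by rewrite -[leLHS]expr1 ler_weXn2l.
rewrite -subr_ge0 (_ : _ - _ = (2 * x ^+ 3 - x - 1) / (x ^+ 4 * (x + 1))).
  by rewrite divr_ge0 ?mulr_ge0 ?exprn_ge0//; lra.
by field; rewrite !gt_eqF//; lra.
Qed.

End attractor_box.

(** * Size and invariance of the box *)

Section box_bounds.
Variable R : realType.
Variables (S : R -> R) (L0 : R).
Hypothesis (cS : continuous S) (hS : confined S).
Hypotheses (L00 : 0 <= L0) (SL : forall s t, `|S t - S s| <= L0 * `|t - s|).
Implicit Types (t : R) (u : l2 R) (j : nat).
Let L := stat_param S.

(** Bounds (j + 1)^2 |u_j| on the box at time t, for every j. *)
Definition box_radius (L0 : R) (S : R -> R) t : R :=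
  1 + expR L0 * `|lead S (stat_param S) t|.

Lemma growth_window c j t : rate R j * growth S c (rate R j) t <=
  (1 + expR L0 * `|lead S c t|) ^+ 2 *
  (growthint S c (rate R j) t - growthint S c (rate R j) (t - 1)).
Proof.
apply: (growthint_window cS _ (rate_ge0 R j)) => [|s st].
  by rewrite mulr_ge0 ?expR_ge0.
exact: lead_window st.
Qed.

Lemma rate_growth_le j t : rate R j * growth S L (rate R j) t <=
  box_radius L0 S t ^+ 2 *
  (stat_mass S L (rate R j) + growthint S L (rate R j) t).
Proof.
apply: le_trans (growth_window _ _ _) _; rewrite ler_wpM2l ?sqr_ge0//.
by rewrite addrC lerD2r growthint_le_stat.
Qed.

(** As [rate 0] is 1, the same bound covers coordinate 0. *)
Lemma abox_at_sqr_le t u : abox_at S t u ->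
  forall j, u j ^+ 2 <= box_radius L0 S t ^+ 2 / rate R j.
Proof.
move=> [u0 uj] [|j].
  rewrite u0 /rate expr1n divr1 -(real_normK (num_real (lead _ _ _))).
  rewrite ler_pXn2r ?nnegrE ?addr_ge0 ?mulr_ge0 ?expR_ge0//.
  rewrite /box_radius -[leLHS]add0r lerD// ler_peMl//.
  by apply: le_trans (expR_ge1Dx _); rewrite lerDl.
rewrite ler_pdivlMr ?rate_gt0//.
have m0 := stat_mass_gt cS hS (rate R j.+1) t.
rewrite -(ler_pM2r m0); apply: le_trans (rate_growth_le _ _).
have := uj j.+1 isT; have := rate_gt0 R j.+1; rewrite -/L.
set m := stat_mass _ _ _ + _ in m0 *; set g := growth _ _ _ _.
move=> r0 mu; rewrite mulrAC (mulrC _ (rate _ _)) ler_pM2l//.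
have : 0 <= m * u j.+1 ^+ 2 by rewrite mulr_ge0 ?sqr_ge0// ltW.
rewrite -mulrA in mu; lra.
Qed.

Lemma abox_at_norm_le t u : abox_at S t u ->
  `|u| <= box_radius L0 S t * Num.sqrt (limn (series (fun j => 1 / rate R j))).
Proof.
move=> /abox_at_sqr_le uj; set Z := limn _.
have r0 : 0 <= box_radius L0 S t by rewrite addr_ge0// mulr_ge0 ?expR_ge0.
have cg := @is_cvg_series_rate R (box_radius L0 S t ^+ 2).
have := sqnorm_tail 0 cg uj; rewrite /series/= !big_geq// add0r subr0.
have -> : limn (series (fun j => box_radius L0 S t ^+ 2 / rate R j)) =
    box_radius L0 S t ^+ 2 * Z.
  rewrite -[RHS](lim_seriesZ _ (@is_cvg_series_rate R 1)); congr (limn (series _)).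
  by apply/funext => j; rewrite -[RHS]/(_ * (1 / _)) mul1r.
rewrite -l2_normE => le; rewrite -(@ler_pXn2r _ 2)// ?nnegrE ?mulr_ge0 ?sqrtr_ge0//.
have Z0 : 0 <= Z.
  have nd : nondecreasing_seq (series (fun j => 1 / rate R j)).
    by apply: nondecreasing_series => j _ _; rewrite divr_ge0// rate_ge0.
  apply: le_trans (nondecreasing_cvgn_le nd (@is_cvg_series_rate R 1) 0%N).
  by rewrite /series/= big_geq.
by rewrite exprMn (sqr_sqrtr Z0).
Qed.

Lemma abox_compact : S 0 = 0 -> compact (abox S).
Proof.
move=> S0.
pose g j := box_radius L0 S 0 ^+ 2 / rate R j.
(* The half-width of the box in direction j. *)
pose r j := Num.sqrt (2 * stat_mass S L (rate R j))^-1.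
have m0 j : 0 < stat_mass S L (rate R j).
  by have := stat_mass_gt cS hS (rate R j) 0; rewrite growthint0// addr0.
have rm j : 2 * stat_mass S L (rate R j) * r j ^+ 2 = 1.
  by rewrite sqr_sqrtr ?invr_ge0 ?mulr_ge0 ?mulfV ?mulf_neq0 ?gt_eqF// ltW.
pose f : nat -> R := fun j => if j == 0%N then L else r j.
have sg : cvgn (series g) := @is_cvg_series_rate R (box_radius L0 S 0 ^+ 2).
have fg j : f j ^+ 2 <= g j.
  case: j => [|j].
    rewrite /f /g /= /rate expr1n divr1 -(real_normK (num_real L)).
    have LL : lead S (stat_param S) 0 = L by rewrite /lead S0 oppr0 expR0 mul1r expint0// addr0.
    rewrite ler_pXn2r ?nnegrE ?addr_ge0 ?mulr_ge0 ?expR_ge0// /box_radius LL.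
    rewrite -[leLHS]add0r lerD// ler_peMl//.
    by apply: le_trans (expR_ge1Dx _); rewrite lerDl.
  rewrite /f /g /= ler_pdivlMr ?rate_gt0//.
  have := rate_growth_le j.+1 0; rewrite growth0// growthint0// addr0 mulr1 -/L => h.
  have := rm j.+1; have := m0 j.+1; set m := stat_mass _ _ _ in h *.
  move=> mp rmj; have r0 : 0 <= r j.+1 ^+ 2 by rewrite sqr_ge0.
  have : r j.+1 ^+ 2 * rate R j.+1 <= r j.+1 ^+ 2 * (box_radius L0 S 0 ^+ 2 * m).
    by rewrite ler_wpM2l.
  move=> /le_trans; apply.
  have -> : r j.+1 ^+ 2 * (box_radius L0 S 0 ^+ 2 * m) =
    box_radius L0 S 0 ^+ 2 * ((2 * m * r j.+1 ^+ 2) / 2) by field.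
  rewrite rmj -[leRHS]mulr1 ler_wpM2l ?sqr_ge0//; lra.
pose lo : nat -> R := fun j => if j == 0%N then L else - r j.
have log j : lo j ^+ 2 <= g j.
  by rewrite -[lo j ^+ 2](_ : f j ^+ 2 = _)// /lo /f; case: eqP; rewrite ?sqrrN.
rewrite [X in compact X](_ : _ = [set u : l2 R | forall j, lo j <= u j <= f j]).
  exact: compact_l2_box log fg.
have rE j x : (2 * stat_mass S L (rate R j) * x ^+ 2 <= 1) = (- r j <= x <= r j).
  rewrite -[X in _ <= X](rm j) ler_pM2l ?mulr_gt0// -ler_norml -(real_normK (num_real x)).
  by rewrite ler_pXn2r ?nnegrE// sqrtr_ge0.
apply/seteqP; split=> u /=.
  move=> [u0 uj] [|j]; rewrite /lo /f/=; first by rewrite u0 lexx.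
  by rewrite -rE uj.
move=> h; split; first by apply/le_anti; rewrite andbC; exact: h 0%N.
by move=> [//|j] _; rewrite rE; exact: h j.+1.
Qed.

End box_bounds.

Section invariance.
Variable R : realType.
Variables a b : R.
Hypotheses (a0 : 0 < a) (b0 : 0 < b).
Variables (eta : Gamma).
Let S := pot a b eta.
Let L := stat_param S.
Hypothesis hS : confined S.
Let cS : continuous S. Proof. exact: pot_continuous. Qed.

Lemma lead_paramE c T : lead_param S T (lead S c T) = c.
Proof. by rewrite /lead_param /lead mulrA -expRD subrr expR0 mul1r addrK. Qed.

(** With z the ratio of u_j to [amp], which is constant for the linearized equation,
    membership in the box at T says 2 (J + Q T) z^2 <= 1, and the explicit solution
    turns this into membership at t. Conversely, the initial value that leads to a
    given point of the box at t is found by solving for z. *)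
Lemma evolution_abox_at (m n : int) : m <= n ->
  evolution a b eta n%:~R m%:~R @` abox_at S m%:~R = abox_at S n%:~R.
Proof.
rewrite -(ler_int R); set T : R := m%:~R; set t : R := n%:~R => Tt.
pose J j := stat_mass S L (rate R j); pose Q j := growthint S L (rate R j).
pose h j := growth S L (rate R j); pose A j := amp S L (rate R j).
have JQ j s : 0 < J j + Q j s by exact: stat_mass_gt.
have hA j s : h j s = A j s ^+ 2 by exact: growthE.
have A0 j s : 0 < A j s by exact: amp_gt0.
have QQ j : Q j T <= Q j t by apply: growthint_le.
apply/seteqP; split=> [_ [u [u0 uj] <-]|w [w0 wj]].
  split; first by rewrite evolutionE//= u0 lead_paramE.
  move=> j j0; rewrite evolutionE// gtn_eqF// u0 lead_paramE -/L.
  have D1 := mode_den_ge1 cS L (rate R j) (u j) Tt.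
  have := mode_sqr cS L (rate R j) (u j) Tt.
  set y := mode _ _ _ _ _ _; set D := mode_den _ _ _ _ _ _ in D1 *.
  set z := u j / _; move=> yD.
  have D0 : 0 < D by lra.
  rewrite -(ler_pM2r D0) -[leLHS]mulrA yD -/(J j) -/(Q j t) -/(h j t).
  have h0 : 0 < h j t by rewrite hA exprn_gt0.
  rewrite (mulrC (h j t)) mulrA ler_pM2r//.
  have -> : D = 1 + 2 * z ^+ 2 * (Q j t - Q j T) by [].
  have : 2 * (J j + Q j T) * z ^+ 2 <= 1.
    have := uj j j0; rewrite -/(J j) -/(Q j T) -/(h j T) hA => le.
    by rewrite /z expr_div_n -/(A j T) mulrA ler_pdivrMr ?exprn_gt0// mul1r.
  lra.
(* The solution reaches w j at t exactly if its z satisfies z ^+ 2 * E j = w j ^+ 2. *)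
pose E j := h j t - 2 * (w j) ^+ 2 * (Q j t - Q j T).
have E0 j : (0 < j)%N -> 0 < E j.
  move=> j0; have := wj j j0; rewrite -/(J j) -/(Q j t) -/(h j t) => le.
  have := JQ j T; have h0 : 0 < h j t by rewrite hA exprn_gt0.
  have [wz|wz] := eqVneq (w j) 0; first by rewrite /E wz expr0n/= mulr0 mul0r subr0.
  have w2 : 0 < w j ^+ 2 by rewrite lt_neqAle eq_sym sqrf_eq0 wz sqr_ge0.
  rewrite /E; nra.
pose z j := w j / Num.sqrt (E j).
pose f j := if j == 0%N then lead S L T else z j * A j T.
have zE j : (0 < j)%N -> z j ^+ 2 * E j = w j ^+ 2.
  move=> j0; rewrite /z expr_div_n sqr_sqrtr ?ltW ?E0//.
  by rewrite divfK// gt_eqF// E0.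
have zJ j : (0 < j)%N -> 2 * (J j + Q j T) * z j ^+ 2 <= 1.
  move=> j0; rewrite -(ler_pM2r (E0 j j0)) -[leLHS]mulrA zE// mul1r.
  have := wj j j0; rewrite -/(J j) -/(Q j t) -/(h j t) /E; lra.
have fbox j : (0 < j)%N -> 2 * (J j + Q j T) * f j ^+ 2 <= h j T.
  move=> j0; rewrite /f gtn_eqF// exprMn hA mulrA -[leRHS]mul1r ler_pM2r ?zJ//.
  by rewrite exprn_gt0.
have sf : square_summable f.
  pose L0 := a + b; have L00 : 0 <= L0 by rewrite addr_ge0// ltW.
  have SL s s' := pot_lipschitz eta s s' a0 b0.
  apply: (square_summable_ge0 (@is_cvg_series_rate R (box_radius L0 S T ^+ 2 + lead S L T ^+ 2))).
  case=> [|j].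
    by rewrite /f/= /rate expr1n divr1 lerDr sqr_ge0.
  apply: (@le_trans _ _ (box_radius L0 S T ^+ 2 / rate R j.+1)); last first.
    by rewrite ler_pM2r ?invr_gt0 ?rate_gt0// lerDl sqr_ge0.
  rewrite ler_pdivlMr ?rate_gt0//.
  have := rate_growth_le cS hS L00 SL j.+1 T; rewrite -/L -/(J _) -/(Q _ _) -/(h _ _) => le.
  have := fbox j.+1 isT; have := JQ j.+1 T; have := rate_gt0 R j.+1.
  set G := J _ + _ in le *; set r := rate _ _ in le * => r0 G0 fG.
  rewrite -(ler_pM2r G0); apply: le_trans le; rewrite -mulrA mulrCA ler_pM2l//.
  have : 0 <= G * f j.+1 ^+ 2 by rewrite mulr_ge0 ?sqr_ge0// ltW.
  rewrite -mulrA in fG; lra.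
exists (l2_of f).
  split; first by rewrite l2_ofE.
  by move=> j j0; rewrite l2_ofE//; exact: fbox.
apply: l2_ext => j; rewrite evolutionE//; case: ifP => [/eqP->|/negbT].
  by rewrite l2_ofE// /f/= lead_paramE w0.
rewrite -lt0n => j0; rewrite !l2_ofE// /f/= lead_paramE gtn_eqF// /mode.
rewrite -/(A j T) -/(A j t) mulfK ?gt_eqF//.
have -> : mode_den S L (rate R j) T (z j * A j T) t = h j t / E j.
  rewrite /mode_den -/(A j T) mulfK ?gt_eqF// -/(Q j t) -/(Q j T).
  apply: (mulIf (x := E j)); first by rewrite gt_eqF// E0.
  rewrite divfK ?gt_eqF ?E0//.
  have := zE j j0 => zE'.
  have -> : (1 + 2 * z j ^+ 2 * (Q j t - Q j T)) * E j =
     E j + 2 * (z j ^+ 2 * E j) * (Q j t - Q j T) by ring.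
  by rewrite zE' /E; ring.
have e0 : 0 < Num.sqrt (E j) by rewrite sqrtr_gt0 E0.
rewrite sqrtrM ?hA ?sqr_ge0// sqrtr_sqr gtr0_norm// sqrtrV ?(ltW (E0 j j0))//.
by rewrite /z; field; rewrite !gt_eqF.
Qed.

End invariance.

(** * Pullback attraction *)

Section attraction.
Variable R : realType.
Variables a b : R.
Hypotheses (a0 : 0 < a) (b0 : 0 < b).
Variables (eta : Gamma).
Let S := pot a b eta.
Let L := stat_param S.
Hypothesis hS : confined S.
Let cS : continuous S. Proof. exact: pot_continuous. Qed.
Let S0 : S 0 = 0. Proof. exact: pot0. Qed.
Let L0 := a + b.
Let L00 : 0 <= L0. Proof. by rewrite addr_ge0// ltW. Qed.
Let SL s t : `|S t - S s| <= L0 * `|t - s|. Proof. exact: pot_lipschitz. Qed.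
Implicit Types (c d x : R) (j n : nat) (u : l2 R).

Let J j := stat_mass S L (rate R j).
Let past j n c := - growthint S c (rate R j) (- n%:R).

Let J0 j : 0 < J j.
Proof. by have := stat_mass_gt cS hS (rate R j) 0; rewrite growthint0// addr0. Qed.

Let past_gt0 j n c : (0 < n)%N -> 0 < past j n c.
Proof.
move=> n0; rewrite oppr_gt0 -(growthint0 cS c (rate R j)).
by apply: growthint_lt => //; rewrite oppr_lt0 ltr0n.
Qed.

Let past_mono j n m c : (n <= m)%N -> past j n c <= past j m c.
Proof. by move=> nm; rewrite lerN2; apply: growthint_le => //; rewrite lerN2 ler_nat. Qed.

Let past_anti j n c c' : c <= c' -> past j n c' <= past j n c.
Proof.
by move=> cc; rewrite lerN2; apply: growthint_lead_le => //; rewrite oppr_le0.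
Qed.

Let rad x := Num.sqrt (2 * x)^-1.

Let rad_sqr x : 0 < x -> rad x ^+ 2 = (2 * x)^-1.
Proof. by move=> x0; rewrite sqr_sqrtr// invr_ge0 mulr_ge0// ltW. Qed.

Let rad_ge0 x : 0 <= rad x. Proof. exact: sqrtr_ge0. Qed.

Let rad_anti x y : 0 < x -> x <= y -> rad y <= rad x.
Proof.
move=> x0 xy; rewrite ler_wsqrtr// lef_pV2 ?posrE ?mulr_gt0 ?ler_pM2l//.
exact: lt_le_trans xy.
Qed.

(* A bound for the distance to the box in coordinate j, for trajectories started at
   - n with parameter at distance at most d from L. *)
Let excess d n j : R :=
  if j == 0%N then d else rad (Num.min (past j n (L + d)) (J j)) - rad (J j).

Let lead0 c : lead S c 0 = c.
Proof. by rewrite /lead S0 oppr0 expR0 mul1r expint0// addr0. Qed.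

(** Whatever its value at - n, a mode satisfies u_j(0)^2 <= 1 / (2 past j n c):
    infinity is the worst initial value. This exceeds the half-width of the box by
    little, and clamping u_j(0) to the box gives the point p. *)
Lemma evolution_near_box n u d : (0 < n)%N ->
  `|lead_param S (- n%:R) (u 0%N) - L| <= d ->
  exists2 p, abox S p &
    forall j, (evolution a b eta 0 (- n%:R) u j - p j) ^+ 2 <= excess d n j ^+ 2.
Proof.
move=> n0 cd; set c := lead_param _ _ _ in cd; set v := evolution _ _ _ _ _ _.
have d0 : 0 <= d by apply: le_trans cd.
have TE : - n%:R = (- n%:Z)%:~R :> R by rewrite mulrNz.
have T0 : (- n%:Z)%:~R <= 0 :> R by rewrite -TE oppr_le0.
have vE j : v j = if j == 0%N then c else mode S c (rate R j) (- n%:R) (u j) 0.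
  have := evolutionE a0 b0 eta u j T0; rewrite -TE => ->.
  by case: eqP => // _; exact: lead0.
have vle j : (0 < j)%N -> `|v j| <= rad (past j n c).
  move=> j0; rewrite -(@ler_pXn2r _ 2)// ?nnegrE//.
  rewrite real_normK ?num_real// rad_sqr ?past_gt0//.
  have T0' : - n%:R <= 0 :> R by rewrite TE.
  have D1 := mode_den_ge1 cS c (rate R j) (u j) T0'.
  have := mode_sqr cS c (rate R j) (u j) T0'.
  rewrite vE gtn_eqF// growth0// mulr1 /mode_den.
  set y := mode _ _ _ _ _ _; set z := u j / _; rewrite growthint0// sub0r -/(past j n c).
  move=> yE; have p0 := past_gt0 j c n0.
  rewrite -[leRHS]mul1r ler_pdivlMr ?mulr_gt0//.
  have [z0|z0] := eqVneq z 0.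
    move: yE; rewrite z0 expr0n/= mulr0 mul0r addr0 mulr1 => ->.
    by rewrite mul0r.
  have z2 : 0 < z ^+ 2 by rewrite lt_neqAle eq_sym sqrf_eq0 z0 sqr_ge0.
  rewrite -(ler_pM2r z2) mul1r -[leRHS]yE.
  have := sqr_ge0 y; lra.
pose r j := rad (J j).
pose p j : R := if j == 0%N then L else Num.max (- r j) (Num.min (v j) (r j)).
have ple j : (0 < j)%N -> `|p j| <= r j.
  move=> j0; rewrite /p gtn_eqF// ler_norml le_max lexx/= ge_max ge_min lexx orbT andbT.
  by have := rad_ge0 (J j); rewrite -/(r j); lra.
have pv j : (0 < j)%N -> `|p j| <= `|v j|.
  move=> j0; rewrite /p gtn_eqF//; have := rad_ge0 (J j); rewrite -/(r j) => r0.
  by case: (leP (v j) (r j)) => h1; case: (leP (- r j) _) => h2;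
    rewrite ?normrN ?(ger0_norm r0) ?(ger0_norm (le_trans r0 (ltW h1)))//; try lra;
    rewrite ltr0_norm; lra.
have sp : square_summable p.
  apply: (@square_summable_ge0 _ _ (fun k => if k == 0%N then L ^+ 2 else v k ^+ 2)).
    apply: is_cvg_series_head; exact: l2P.
  move=> [|j]; first by rewrite /p/=.
  by have := pv j.+1 isT; rewrite -(@ler_pXn2r _ 2)// ?nnegrE// !real_normK ?num_real.
exists (l2_of p).
  split; first by rewrite l2_ofE.
  move=> j j0; rewrite l2_ofE// -/(J j).
  have := ple j j0; rewrite -(@ler_pXn2r _ 2)// ?nnegrE ?rad_ge0//.
  rewrite real_normK ?num_real// /r rad_sqr// => h.
  by rewrite -ler_pdivlMl ?mulr_gt0// mulr1.
move=> j; rewrite l2_ofE//; have [->|j0] := posnP j.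
  rewrite /p /excess/= vE/= -(real_normK (num_real (c - L))).
  by rewrite ler_pXn2r ?nnegrE.
have ex0 : r j <= rad (Num.min (past j n (L + d)) (J j)).
  apply: rad_anti; last by rewrite ge_min lexx orbT.
  by rewrite lt_min J0 past_gt0.
have vr : `|v j| <= rad (Num.min (past j n (L + d)) (J j)).
  apply: le_trans (vle j j0) _; apply: rad_anti.
    by rewrite lt_min J0 past_gt0.
  rewrite ge_min; apply/orP; left; apply: past_anti.
  by move: cd; rewrite ler_norml => /andP[_]; lra.
rewrite /excess gtn_eqF// -/(r j); set X := rad _ in ex0 vr *.
rewrite -(real_normK (num_real (v j - p j))) ler_pXn2r ?nnegrE ?subr_ge0//.
rewrite /p gtn_eqF//; have := rad_ge0 (J j); rewrite -/(r j) => r0.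
move: vr; rewrite ler_norml => /andP[v1 v2].
case: (leP (v j) (r j)) => h1; case: (leP (- r j) _) => h2; rewrite ler_norml; lra.
Qed.

Let excess_bound := (1 + expR L0 * (`|L| + 1)) ^+ 2.

Let excess_sqr_le d n j : 0 <= d <= 1 -> (0 < n)%N ->
  excess d n j ^+ 2 <= excess_bound / rate R j.
Proof.
move=> /andP[d0 d1] n0.
have B1 : 1 <= 1 + expR L0 * (`|L| + 1) by rewrite lerDl mulr_ge0 ?expR_ge0 ?addr_ge0.
have [->|j0] := posnP j.
  rewrite /excess/= /rate expr1n divr1 /excess_bound.
  by move: B1; set B := 1 + _ => B1; rewrite ler_pXn2r ?nnegrE//; lra.
have mono c : `|c| <= `|L| + 1 -> (1 + expR L0 * `|c|) ^+ 2 <= excess_bound.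
  move=> cL; rewrite /excess_bound ler_pXn2r ?nnegrE ?addr_ge0 ?mulr_ge0 ?expR_ge0 ?addr_ge0//.
  by rewrite lerD2l ler_wpM2l ?expR_ge0.
have window c : `|c| <= `|L| + 1 -> rate R j / excess_bound <= past j 1 c.
  move=> cL; rewrite ler_pdivrMr; last by rewrite exprn_gt0// (lt_le_trans ltr01).
  have := growth_window cS L00 SL c j 0.
  rewrite growth0// mulr1 growthint0// lead0 !sub0r => /le_trans; apply.
  by rewrite mulrC -/(past j 1 c) ler_wpM2l ?mono// ltW// past_gt0.
have P0 : 0 < rate R j / excess_bound.
  by rewrite divr_gt0 ?rate_gt0// exprn_gt0// (lt_le_trans ltr01).
have mge : rate R j / excess_bound <= Num.min (past j n (L + d)) (J j).
  rewrite le_min; apply/andP; split.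
    apply: le_trans (past_mono j (L + d) n0); apply: window.
    by apply: le_trans (ler_normD _ _) _; rewrite lerD2l ger0_norm.
  apply: (@le_trans _ _ (past j 1 L)); first by apply: window; rewrite lerDl.
  exact: growthint_le_stat.
have m0 := lt_le_trans P0 mge.
rewrite /excess gtn_eqF//.
apply: (@le_trans _ _ (rad (Num.min (past j n (L + d)) (J j)) ^+ 2)).
  have ex0 : rad (J j) <= rad (Num.min (past j n (L + d)) (J j)).
    by apply: rad_anti => //; rewrite ge_min lexx orbT.
  rewrite ler_pXn2r ?nnegrE ?subr_ge0//.
  by have := rad_ge0 (J j); lra.
rewrite rad_sqr// -[leRHS]invf_div lef_pV2 ?posrE ?mulr_gt0//.
lra.
by rewrite invr_gt0 exprn_gt0// (lt_le_trans ltr01).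
Qed.

Let cvg_excess (d : nat -> R) j : (forall n, 0 <= d n) -> d @ \oo --> (0 : R) ->
  excess (d n) n j @[n --> \oo] --> (0 : R).
Proof.
move=> d0 cd; rewrite /excess; case: eqP => [//|/eqP]; rewrite -lt0n => j0.
have cm : Num.min (past j n (L + d n)) (J j) @[n --> \oo] --> J j.
  apply/cvgrPdist_lt => e e0.
  have cL : past j n L @[n --> \oo] --> J j.
    have -> : (fun n => past j n L) = (fun n => - growthint S L (rate R j) (0 - n%:R)).
      by apply/funext => n; rewrite sub0r.
    exact: cvg_growthint.
  move/cvgrPdist_lt : cL => /(_ e e0)[N _ /(_ N (leqnn N))/= NL].
  have {}NL : J j - e < past j N L by have := ler_norm (J j - past j N L); lra.
  have ce : expR (2 * (d n * prim (fun s => expR (- S s)) (- N%:R))) * past j N L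
      @[n --> \oo] --> past j N L.
    set C := prim _ _.
    have c1 : 2 * (d n * C) @[n --> \oo] --> (2 * (0 * C) : R).
      have cC : d n * C @[n --> \oo] --> (0 * C : R) by apply: cvgM; [exact: cd|exact: cvg_cst].
      by apply: (@cvgM _ _ _ _ (fun=> 2) _ _ _ _ cC); exact: cvg_cst.
    have c2 : expR (2 * (d n * C)) @[n --> \oo] --> expR (2 * (0 * C)).
      by apply: (cvg_comp _ _ c1); exact: continuous_expR.
    rewrite mul0r mulr0 expR0 in c2.
    by rewrite -[X in _ --> X]mul1r; apply: cvgM; [exact: c2|exact: cvg_cst].
  near=> n.
  rewrite ger0_norm ?subr_ge0 ?ge_min ?lexx ?orbT//.
  rewrite ltrBlDr -ltrBlDl lt_min; apply/andP; split; last by rewrite gtrBl.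
  have h1 : J j - e < expR (2 * (d n * prim (fun s => expR (- S s)) (- N%:R))) * past j N L.
    near: n; exact: cvgr_gt _ ce _ NL.
  apply: (lt_le_trans h1); apply: (@le_trans _ _ (past j N (L + d n))).
    rewrite /past mulrN lerN2; by apply: growthint_lead_perturb => //; rewrite oppr_le0.
  by apply: past_mono; near: n; exact: nbhs_infty_ge.
have -> : 0 = rad (J j) - rad (J j) by rewrite subrr.
apply: cvgB; last exact: cvg_cst.
have cv : (2 * x)^-1 @[x --> J j] --> (2 * J j)^-1.
  apply: cvgV; first by rewrite mulf_neq0// gt_eqF.
  by apply: cvgM; [exact: cvg_cst|exact: cvg_id].
have cr : rad x @[x --> J j] --> rad (J j).
  by apply: (cvg_comp _ _ cv); exact: sqrt_continuous.
exact: (cvg_comp _ _ cm cr).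
Unshelve. all: by end_near. Qed.

(** The parameter of a trajectory started at - n with first coordinate x differs
    from L by at most the part of the integral before - n plus e^S(- n) |x|. *)
Lemma abox_attracts (beta : nat -> R) :
  (expR (S (- n%:R)) * beta n @[n --> \oo] --> (0 : R)) ->
  exists2 w : nat -> l2 R, w @ \oo --> (0 : l2 R) &
    \forall n \near \oo, forall u, `|u 0%N| <= beta n ->
      exists2 p, abox S p & `|evolution a b eta 0 (- n%:R) u - p| <= `|w n|.
Proof.
move=> cb.
pose d n := (L + expint S (- n%:R)) + expR (S (- n%:R)) * `|beta n|.
have d0 n : 0 <= d n.
  rewrite addr_ge0 ?mulr_ge0 ?expR_ge0// -lerBlDr sub0r.
  exact: expint_le_stat.
have cd : d @ \oo --> (0 : R).
  rewrite -[X in _ --> X]addr0; apply: cvgD.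
    rewrite -[X in _ --> X](subrr L); apply: cvgD; first exact: cvg_cst.
    have -> : (fun n => expint S (- n%:R)) = (fun n => - - expint S (0 - n%:R)).
      by apply/funext => n; rewrite sub0r opprK.
    by apply: cvgN; exact: cvg_expint.
  have -> : (fun n => expR (S (- n%:R)) * `|beta n|) = (fun n => `|expR (S (- n%:R)) * beta n|).
    by apply/funext => n; rewrite normrM (ger0_norm (expR_ge0 _)).
  by rewrite -[X in _ --> X](@normr0 R R); exact: cvg_norm cb.
have near_d : \forall n \near \oo, 0 <= d n <= 1 /\ (0 < n)%N.
  near=> n; split; last by near: n; exact: nbhs_infty_gt.
  rewrite d0/=; near: n; exact: cvgr_le _ cd _ ltr01.
have sw n : 0 <= d n <= 1 -> (0 < n)%N -> square_summable (excess (d n) n).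
  move=> dn n0; apply: (square_summable_ge0 (@is_cvg_series_rate R excess_bound)) => j.
  exact: excess_sqr_le.
exists (fun n => l2_of (excess (d n) n)).
  apply: (@l2_dominated_cvg _ _ _ _ _ _ (fun j => excess_bound / rate R j)).
  - exact: is_cvg_series_rate.
  - move=> j; apply: (cvg_trans _ (@cvg_excess d j d0 cd)).
    apply: near_eq_cvg; near=> n.
    have [dn n0] : 0 <= d n <= 1 /\ (0 < n)%N by near: n.
    by rewrite l2_ofE//; exact: sw.
  - near=> n => j; have [dn n0] : 0 <= d n <= 1 /\ (0 < n)%N by near: n.
    by rewrite l2_ofE; [exact: excess_sqr_le|exact: sw].
near=> n => u ub; have [dn n0] : 0 <= d n <= 1 /\ (0 < n)%N by near: n.
have [|p pS pe] := @evolution_near_box n u (d n) n0.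
  have := expint_le_stat cS hS (- n%:R); rewrite -/L => eL.
  have -> : lead_param S (- n%:R) (u 0%N) - L =
      expR (S (- n%:R)) * u 0%N - (L + expint S (- n%:R)) by rewrite /lead_param; ring.
  apply: le_trans (ler_normB _ _) _; rewrite /d addrC; apply: lerD.
    rewrite ger0_norm//; lra.
  rewrite normrM (ger0_norm (expR_ge0 _)) ler_wpM2l ?expR_ge0//.
  by apply: le_trans ub _; exact: ler_norm.
exists p => //; apply: l2_norm_le => j; rewrite l2_subE l2_ofE; first exact: pe.
exact: sw.
Unshelve. all: by end_near. Qed.

End attraction.

(** * Averages over blocks of the Bernoulli scheme *)

Section bernoulli.
Variables (R : realType) (q : R) (mu : probability Gamma R).
Hypotheses (q01 : 0 < q < 1) (hmu : bernoulli_scheme q mu).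

Definition wt (x : bool) : R := if x then q else 1 - q.

Lemma wt_ge0 x : 0 <= wt x.
Proof. by case: x; rewrite /wt; move: q01 => /andP[? ?]; lra. Qed.

Lemma measurable_coord (n : int) (b : bool) :
  measurable ([set eta | eta n = b] : set Gamma).
Proof. by apply: sub_sigma_algebra; exists n, b. Qed.

(** The blocks partition the past, and are read backwards from the site - 1. *)
Definition block n (eta : Gamma) (i : nat) : {ffun 'I_n -> bool} :=
  [ffun j : 'I_n => eta (Negz (i * n + j)%N)].

Definition block_weight n (sigma : {ffun 'I_n -> bool}) : R := \prod_j wt (sigma j).

Lemma block_weight_ge0 n (sigma : {ffun 'I_n -> bool}) : 0 <= block_weight sigma.
Proof. by apply: prodr_ge0 => j _; exact: wt_ge0. Qed.

Lemma sum_block_weight n : \sum_(sigma : {ffun 'I_n -> bool}) block_weight sigma = 1.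
Proof.
rewrite -(bigA_distr_bigA (fun (_ : 'I_n) x => wt x)) big1// => j _.
by rewrite big_bool /wt/= addrC subrK.
Qed.

Definition cylinder n I (tau : {ffun 'I_I -> {ffun 'I_n -> bool}}) : set Gamma :=
  [set eta | forall i : 'I_I, block n eta i = tau i].

Lemma measurable_cyl (s : seq int) (b : int -> bool) :
  measurable ([set eta | forall n, n \in s -> eta n = b n] : set Gamma).
Proof.
elim: s => [|m s IH].
  rewrite [X in measurable X](_ : _ = setT); first exact: measurableT.
  by apply/seteqP; split.
rewrite [X in measurable X](_ : _ = [set eta | eta m = b m] `&`
    [set eta | forall n, n \in s -> eta n = b n]); last first.
  apply/seteqP; split=> eta /=.
    by move=> h; split=> [|n ns]; apply: h; rewrite inE ?eqxx// ns orbT.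
  by move=> [h1 h2] n; rewrite inE => /predU1P[->//|]; exact: h2.
by apply: measurableI => //; exact: measurable_coord.
Qed.

Lemma site_inj n (i i' : nat) (j j' : 'I_n) :
  (i * n + j = i' * n + j')%N -> i = i' /\ j = j'.
Proof.
move=> E; have n0 : (0 < n)%N by apply: leq_ltn_trans (ltn_ord j).
have := congr1 (divn^~ n) E; rewrite !divnMDl// !divn_small// !addn0 => ii.
by split=> //; apply/val_inj; move: E; rewrite ii => /addnI.
Qed.

Let sites n I : seq int :=
  [seq Negz (ij.1 * n + ij.2)%N | ij : 'I_I * 'I_n <- enum {: 'I_I * 'I_n}].

Let pattern n I (tau : {ffun 'I_I -> {ffun 'I_n -> bool}}) (m : int) : bool :=
  [exists ij : 'I_I * 'I_n, (m == Negz (ij.1 * n + ij.2)%N) && tau ij.1 ij.2].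

Let patternE n I (tau : {ffun 'I_I -> {ffun 'I_n -> bool}}) (i : 'I_I) (j : 'I_n) :
  pattern tau (Negz (i * n + j)%N) = tau i j.
Proof.
apply/existsP/idP => [[[i' j'] /= /andP[/eqP[/site_inj[/val_inj-> ->]]]//]|t].
by exists (i, j); rewrite eqxx.
Qed.

Let cylinderE n I (tau : {ffun 'I_I -> {ffun 'I_n -> bool}}) :
  cylinder tau = [set eta | forall m, m \in sites n I -> eta m = pattern tau m].
Proof.
apply/seteqP; split=> eta /= h.
  move=> m /mapP[[i j] _ ->] /=; rewrite patternE -h.
  by rewrite ffunE.
move=> i; apply/ffunP => j; rewrite ffunE -patternE; apply: h.
by apply/mapP; exists (i, j) => //; rewrite mem_enum.
Qed.

Lemma measurable_cylinder n I (tau : {ffun 'I_I -> {ffun 'I_n -> bool}}) :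
  measurable (cylinder tau).
Proof. by rewrite cylinderE; exact: measurable_cyl. Qed.

Lemma mu_cylinder n I (tau : {ffun 'I_I -> {ffun 'I_n -> bool}}) :
  mu (cylinder tau) = (\prod_i block_weight (tau i))%:E.
Proof.
rewrite cylinderE hmu; last first.
  rewrite map_inj_uniq ?enum_uniq// => -[i j] [i' j'] [/site_inj[/val_inj-> ->]] //.
congr EFin; rewrite big_map big_enum/= [RHS]pair_big/=.
by apply: eq_bigr => -[i j] _ /=; rewrite patternE /wt.
Qed.

Lemma mu_bigsetU_le (T : Type) (r : seq T) (P : pred T) (A : T -> set Gamma) :
  (forall x, measurable (A x)) ->
  measurable (\big[setU/set0]_(x <- r | P x) A x) /\
  (mu (\big[setU/set0]_(x <- r | P x) A x) <= \sum_(x <- r | P x) mu (A x))%E.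
Proof.
move=> mA; elim: r => [|x r [mB IH]]; first by rewrite !big_nil measure0.
rewrite !big_cons; case: ifP => // _; split; first exact: measurableU.
apply: (@le_trans _ _ (mu (A x) + mu (\big[setU/set0]_(x <- r | P x) A x))%E).
  exact: measureU2.
exact: leeD2l.
Qed.

Definition deficient n (F : {ffun 'I_n -> bool} -> R) (k : R) (I : nat) : set Gamma :=
  [set eta | \sum_(i < I) F (block n eta i) < k * I%:R].

(** Chernoff's bound. The factor expR (- th * sum (F - k)) is at least 1 on the
    deficient patterns, and its sum over all patterns factorizes, the blocks being
    independent. *)
Lemma deficient_le n (F : {ffun 'I_n -> bool} -> R) k th I : 0 <= th ->
  measurable (deficient F k I) /\ (mu (deficient F k I) <=
    ((\sum_sigma block_weight sigma * expR (- th * (F sigma - k))) ^+ I)%:E)%E.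
Proof.
move=> th0; pose bad (tau : {ffun 'I_I -> {ffun 'I_n -> bool}}) := \sum_i F (tau i) < k * I%:R.
have -> : deficient F k I = \big[setU/set0]_(tau | bad tau) cylinder tau.
  apply/seteqP; split=> eta.
    move=> h; pose t : {ffun 'I_I -> {ffun 'I_n -> bool}} := [ffun i : 'I_I => block n eta i].
    have bt : bad t by rewrite /bad; under eq_bigr do rewrite ffunE.
    rewrite (bigD1 t)//=; left => i; by rewrite ffunE.
  elim/big_rec: _ => // tau A bt IH [h|/IH//].
  by rewrite /deficient/=; under eq_bigr do rewrite h.
have [mB le] := mu_bigsetU_le (index_enum _) bad (fun tau => measurable_cylinder tau).
split=> //; apply: le_trans le _.
under eq_bigr do rewrite mu_cylinder.
rewrite sumEFin lee_fin -[X in _ ^+ X](card_ord I) -prodr_const bigA_distr_bigA/=.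
apply: (@le_trans _ _ (\sum_(tau | bad tau) \prod_i
   (block_weight (tau i) * expR (- th * (F (tau i) - k))))).
  apply: ler_sum => tau bt; rewrite big_split/= ler_peMr//.
    by apply: prodr_ge0 => i _; exact: block_weight_ge0.
  rewrite -expR_sum -[leLHS](expR0 R) ler_expR -mulr_sumr mulNr oppr_ge0.
  rewrite mulr_ge0_le0// sumrB sumr_const card_ord -mulr_natr subr_le0.
  exact: ltW.
rewrite [leRHS](bigID bad)/= lerDl; apply: sumr_ge0 => tau _.
by apply: prodr_ge0 => i _; rewrite mulr_ge0 ?expR_ge0 ?block_weight_ge0.
Qed.

Lemma expR_le_quadratic (y : R) : y <= 1 / 2 -> expR y <= 1 + y + 2 * y ^+ 2.
Proof.
move=> y2; have := expR_ge1Dx (- y); rewrite expRN => h.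
have e0 := expR_gt0 y.
have {}h : (1 - y) * expR y <= 1.
  by rewrite -ler_pdivlMr// mul1r.
have : 1 <= (1 - y) * (1 + y + 2 * y ^+ 2).
  have -> : (1 - y) * (1 + y + 2 * y ^+ 2) = 1 + y ^+ 2 * (1 - 2 * y) by ring.
  by rewrite lerDl mulr_ge0 ?sqr_ge0//; lra.
move=> /(le_trans h); rewrite ler_pM2l//; lra.
Qed.

(** The sum is 1 at th = 0 with derivative k - mean F < 0. The quadratic bound on
    the exponential makes this explicit. *)
Lemma contraction n (F : {ffun 'I_n -> bool} -> R) k :
  k < \sum_sigma block_weight sigma * F sigma ->
  exists2 th, 0 <= th & \sum_sigma block_weight sigma * expR (- th * (F sigma - k)) < 1.
Proof.
move=> km; set m := \sum_sigma _ in km.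
pose V := \sum_sigma block_weight sigma * (F sigma - k) ^+ 2.
pose M := \sum_sigma `|F sigma - k|.
have V0 : 0 <= V by apply: sumr_ge0 => s _; rewrite mulr_ge0 ?block_weight_ge0 ?sqr_ge0.
have M0 : 0 <= M by apply: sumr_ge0.
(* The first bound makes the quadratic estimate applicable, the second makes the
   quadratic term smaller than the linear one. *)
pose th := Num.min (2 * (M + 1))^-1 ((m - k) / (2 * (V + 1))).
have th0 : 0 < th.
  by rewrite lt_min invr_gt0 divr_gt0 ?mulr_gt0//; lra.
have thM : th * M <= 1 / 2.
  apply: (@le_trans _ _ ((2 * (M + 1))^-1 * M)).
    by rewrite ler_wpM2r// ge_min lexx.
  rewrite mulrC ler_pdivrMr; lra.
have thV : 2 * (th * V) < m - k.
  apply: (@le_lt_trans _ _ (2 * ((m - k) / (2 * (V + 1)) * V))).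
    by rewrite ler_pM2l// ler_wpM2r// ge_min lexx orbT.
  rewrite -subr_gt0 (_ : _ - _ = (m - k) / (V + 1)).
    by rewrite divr_gt0//; lra.
  by field; rewrite gt_eqF//; lra.
exists th; first exact: ltW.
apply: (@le_lt_trans _ _ (\sum_sigma (block_weight sigma + (- th) * (block_weight sigma * F sigma)
   + th * k * block_weight sigma + 2 * th ^+ 2 * (block_weight sigma * (F sigma - k) ^+ 2)))).
  apply: ler_sum => s _.
  apply: (@le_trans _ _ (block_weight s * (1 + (- th * (F s - k)) + 2 * (- th * (F s - k)) ^+ 2))).
    rewrite ler_wpM2l ?block_weight_ge0//; apply: expR_le_quadratic.
    apply: (le_trans _ thM); apply: (le_trans (ler_norm _)).
    rewrite normrM normrN (gtr0_norm th0) ler_pM2l//.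
    by rewrite /M (bigD1 s)//= lerDl; apply: sumr_ge0.
  by rewrite le_eqVlt; apply/orP; left; apply/eqP; ring.
rewrite !big_split/= -!mulr_sumr sum_block_weight -/m -/V.
have := mulr_gt0 th0 (_ : 0 < m - k - 2 * (th * V)).
rewrite subr_gt0 => /(_ thV); lra.
Qed.

(** The probabilities of being deficient are at most the terms of a convergent
    geometric series, so that Borel-Cantelli applies. *)
Lemma block_averages n (F : {ffun 'I_n -> bool} -> R) k :
  k < \sum_sigma block_weight sigma * F sigma ->
  {ae mu, forall eta, exists N, forall I, (N <= I)%N ->
     k * I%:R <= \sum_(i < I) F (block n eta i)}.
Proof.
move=> /contraction[th th0]; set rho := \sum_sigma _ => rho1.
have rho0 : 0 <= rho.
  by apply: sumr_ge0 => s _; rewrite mulr_ge0 ?expR_ge0 ?block_weight_ge0.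
have mD I := (deficient_le F k I th0).1.
have dle I := (deficient_le F k I th0).2.
have null : mu (lim_sup_set (deficient F k)) = 0.
  apply: lim_sup_set_cvg0 => //.
  apply: (@le_lt_trans _ _ ((1 - rho)^-1%:E)); last by rewrite ltry.
  apply: lime_le; first by apply: is_cvg_nneseries.
  apply: nearW => I; apply: (@le_trans _ _ (\sum_(0 <= i < I) (rho ^+ i)%:E)%E).
    by apply: lee_sum => i _; exact: dle.
  rewrite sumEFin lee_fin -[leRHS]mul1r ler_pdivlMr; last by lra.
  rewrite (_ : _ * _ = 1 - rho ^+ I); first by rewrite gerBl exprn_ge0.
  elim: I => [|I IH]; first by rewrite big_geq// mul0r expr0 subrr.
  by rewrite big_nat_recr//= mulrDl IH exprS; ring.
have mL : measurable (lim_sup_set (deficient F k)).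
  by apply: bigcapT_measurable => i; apply: bigcup_measurable => j _; exact: mD.
apply: negligibleS (proj2 (negligibleP mu mL) null) => eta /= h i _.
apply: contrapT => hi; apply: h; exists i => I iI.
rewrite leNgt; apply/negP => lt; apply: hi; exists I => //.
Qed.

End bernoulli.

(** * Consequences of the averages for the potential *)

Section good_paths.
Variable R : realType.
Implicit Types (S : R -> R) (C K m s t th : R).

Definition drift m S := forall e, 0 < e ->
  exists C, forall s, s <= 0 -> `|S s - m * s| <= C - e * s.

Definition superlinear S := forall K,
  exists C, forall s, s <= 0 -> leadint S (stat_param S) s <= C + K * s.

Lemma drift_upper m S mu : drift m S -> mu < m ->
  exists C, forall s, s <= 0 -> S s <= C + mu * s.
Proof.
move=> dS mum; have [|C hC] := dS (m - mu); first by rewrite subr_gt0.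
exists C => s s0; have := hC s s0; rewrite ler_norml => /andP[_]; lra.
Qed.

Lemma drift_expint m S : 0 < m -> continuous S -> drift m S ->
  exists C, forall t, - expint S t <= C.
Proof.
move=> m0 cS dS; have [|C hC] := drift_upper dS (_ : m / 2 < m); first by lra.
have m2 : 0 < m / 2 by lra.
exists (expR (C + m / 2 * 0) / (m / 2)) => t.
have e0 : 0 <= expR (C + m / 2 * 0) / (m / 2) by rewrite divr_ge0 ?expR_ge0// ltW.
have [t0|/ltW t0] := leP t 0.
  rewrite -sub0r -{1}(expint0 cS); apply: prim_exp_bound => //.
    exact: cont_exp.
  by move=> u u0; rewrite ler_expR; exact: hC.
by apply: le_trans e0; rewrite oppr_le0 -(expint0 cS); exact: expint_le.
Qed.

Lemma drift_confined m S : 0 < m -> continuous S -> drift m S -> superlinear S ->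
  confined S.
Proof.
move=> m0 cS dS sS; split; first exact: drift_expint dS.
move=> k; have [C hC] := sS (k + 1 / 2).
exists (expR (2 * C + 1 * 0) / 1) => t.
have e0 : 0 <= expR (2 * C + 1 * 0) / 1 :> R by rewrite divr_ge0 ?expR_ge0.
have [t0|/ltW t0] := leP t 0.
  rewrite -sub0r -{1}(growthint0 cS (stat_param S) k); apply: prim_exp_bound => //.
    exact: cont_growth.
  by move=> u u0; rewrite ler_expR; have := hC u u0; lra.
by apply: le_trans e0; rewrite oppr_le0 -(growthint0 cS (stat_param S) k); exact: growthint_le.
Qed.

(** The trajectory at t is e^-S(t) times the integral of e^S before t, and the
    linear parts of the two exponents cancel. *)
Lemma drift_lead m S th : 0 < m -> continuous S -> drift m S -> confined S -> 0 < th ->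
  exists C, forall t, t <= 0 -> lead S (stat_param S) t <= C * expR (- th * t).
Proof.
move=> m0 cS dS hS th0; pose e := Num.min (m / 2) (th / 2).
have e0 : 0 < e by rewrite lt_min !divr_gt0.
have em : e <= m / 2 by rewrite ge_min lexx.
have eth : e <= th / 2 by rewrite ge_min lexx orbT.
have [C hC] := dS e e0; exists (expR (2 * C) / (m - e)) => t t0.
have mu0 : 0 < m - e by lra.
have lim : stat_param S + expint S t <= expR (C + (m - e) * t) / (m - e).
  have cl : (fun n => - expint S (t - n%:R)) @ \oo --> stat_param S by exact: cvg_expint.
  rewrite -lerBrDr -[stat_param S](cvg_lim _ cl)//.
  apply: limr_le; first by apply/cvg_ex; exists (stat_param S).
  apply: nearW => n; rewrite lerBrDr addrC.
  apply: prim_exp_bound => //; first by rewrite gerBl.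
    exact: cont_exp.
  move=> u ut; rewrite ler_expR; have := hC u (le_trans ut t0).
  by rewrite ler_norml => /andP[_]; lra.
rewrite /lead; apply: (@le_trans _ _ (expR (- S t) * (expR (C + (m - e) * t) / (m - e)))).
  by rewrite ler_pM2l ?expR_gt0.
rewrite [leRHS]mulrAC mulrA ler_pM2r ?invr_gt0// -!expRD ler_expR.
have := hC t t0; rewrite ler_norml => /andP[+ _].
have : th / 2 * t <= e * t by rewrite ler_wnM2r.
lra.
Qed.

Variables (a b : R).
Hypotheses (a0 : 0 < a) (b0 : 0 < b).
Variable (eta : Gamma).
Let S := pot a b eta.
Let L0 := a + b.
Let cS : continuous S. Proof. exact: pot_continuous. Qed.
Let L00 : 0 <= L0. Proof. by rewrite addr_ge0// ltW. Qed.
Let SL s t : `|S t - S s| <= L0 * `|t - s|. Proof. exact: pot_lipschitz. Qed.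

Lemma pot_past (I : nat) : S (- I%:R) = - \sum_(i < I) letter a b (eta (Negz i)).
Proof.
have -> : - I%:R = (- I%:Z)%:~R :> R by rewrite mulrNz.
rewrite /S pot_int; case: I => [|I]; first by rewrite oppr0/= !big_ord0 oppr0.
by rewrite -NegzE.
Qed.

Lemma pot_block (n i : nat) : S (- (i * n)%:R) - S (- (i * n + n)%:R) =
  \sum_(j < n) letter a b (eta (Negz (i * n + j)%N)).
Proof. by rewrite !pot_past big_split_ord/=; ring. Qed.

Lemma averages_drift m :
  (forall k, k < m -> exists N, forall I, (N <= I)%N ->
     k * I%:R <= \sum_(i < I) letter a b (eta (Negz i))) ->
  (forall k, m < k -> exists N, forall I, (N <= I)%N ->
     \sum_(i < I) letter a b (eta (Negz i)) <= k * I%:R) ->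
  drift m S.
Proof.
move=> lo hi e e0.
have [|N1 h1] := lo (m - e); first by lra.
have [|N2 h2] := hi (m + e); first by lra.
pose N := maxn N1 N2; pose B := L0 + `|m|.
have B0 : 0 <= B by rewrite addr_ge0.
exists (B * N.+1%:R) => s s0.
have S0 : S 0 = 0 by exact: pot0.
have Lip u v : `|(S u - m * u) - (S v - m * v)| <= B * `|u - v|.
  have -> : S u - m * u - (S v - m * v) = (S u - S v) - m * (u - v) by ring.
  by apply: le_trans (ler_normB _ _) _; rewrite mulrDl normrM lerD.
pose I := Num.truncn (- s).
have /andP[I1 I2] : I%:R <= - s < I.+1%:R by apply: truncn_itv; rewrite oppr_ge0.
have es : 0 <= - (e * s) by rewrite oppr_ge0 mulr_ge0_le0// ltW.
have [IN|NI] := leqP N I.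
  have := h1 I (leq_trans (leq_maxl _ _) IN); have := h2 I (leq_trans (leq_maxr _ _) IN).
  have -> : \sum_(i < I) letter a b (eta (Negz i)) = - S (- I%:R) by rewrite pot_past opprK.
  move=> u2 u1.
  have H : `|S (- I%:R) - m * (- I%:R)| <= e * I%:R by rewrite ler_norml; lra.
  have := Lip s (- I%:R); rewrite opprK.
  have : `|s + I%:R| <= 1 by rewrite -natr1 in I2; rewrite ler_norml; lra.
  move=> sI /le_trans/(_ (ler_wpM2l B0 sI)); rewrite mulr1 => H2.
  have -> : S s - m * s = (S s - m * s - (S (- I%:R) - m * - I%:R)) + (S (- I%:R) - m * (- I%:R)) by ring.
  apply: le_trans (ler_normD _ _) _.
  apply: (le_trans (lerD H2 H)); apply: lerD.
    by rewrite ler_peMr// ler1n.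
  by rewrite -mulrN ler_pM2l.
have := Lip s 0; rewrite S0 mulr0 !subr0 => /le_trans; apply.
apply: (@le_trans _ _ (B * N.+1%:R)); last by rewrite lerDl.
rewrite ler_wpM2l// ler0_norm//; apply: (le_trans (ltW I2)).
by rewrite ler_nat ltnW.
Qed.

(** Let t = - i n and t' = - (i + 1) n be the ends of a block. Already the last unit
    of time before t' contributes to the trajectory at t an amount of order
    e^(S(t') - S(t)), the exponential of minus the sum of the letters of the block,
    and the trajectory keeps this order during the unit of time after t. Hence the
    integral of the trajectory over the past n I units dominates the sum of these
    exponentials over I blocks. *)
Lemma averages_superlinear n k (C0 : R) : (0 < n)%N -> 0 <= k ->
  (forall t, - expint S t <= C0) ->
  (exists N, forall I, (N <= I)%N ->
    k * I%:R <= \sum_(i < I) expR (- \sum_(j < n) letter a b (eta (Negz (i * n + j)%N)))) ->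
  exists C, forall s, s <= 0 ->
    leadint S (stat_param S) s <= C + expR (- (2 * L0)) * k / n%:R * s.
Proof.
move=> n0 k0 hC [N hN]; set W := leadint S _; set L := stat_param S.
set c := expR (- (2 * L0)).
have eL t : - expint S t <= L.
  have [|//|h _] := @rsup_anti _ (fun t => - expint S t) C0.
    by move=> s u su; rewrite lerN2; exact: expint_le.
  exact: h.
have x0 t : 0 <= L + expint S t by rewrite -lerBlDr sub0r.
have near_S s t : `|t - s| <= 1 -> S t - L0 <= S s.
  move=> st; have := SL s t; have : L0 * `|t - s| <= L0 by rewrite -[leRHS]mulr1 ler_wpM2l.
  move=> h1 /le_trans/(_ h1); rewrite ler_norml => /andP[_]; lra.
have Wmono u v : u <= v -> W u <= W v.
  move=> uv; apply: prim_ge0 => //; first exact: cont_lead.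
  by move=> t _; rewrite mulr_ge0 ?expR_ge0.
have lowP t : expR (S t - L0) <= L + expint S t.
  have ce := cont_exp cS.
  have : expR (S t - L0) <= expint S t - expint S (t - 1).
    have := @prim_le R (fun=> expR (S t - L0)) (fun s => expR (S s)) (t - 1) t.
    rewrite !prim_cst -/(expint S); set E := expR _.
    have -> : E * t - E * (t - 1) = E by ring.
    apply=> //; [by rewrite gerBl|exact: cont_cst|move=> s /andP[s1 s2]].
    by rewrite ler_expR near_S// ger0_norm; lra.
  by have := eL (t - 1); lra.
have step i : c * expR (- \sum_(j < n) letter a b (eta (Negz (i * n + j)%N))) <=
    W (- (i * n)%:R + 1) - W (- (i * n)%:R).
  rewrite -pot_block; set t : R := - (i * n)%:R; set t' : R := - (i * n + n)%:R.
  have := @prim_le R (fun=> c * expR (- (S t - S t'))) (lead S L) t (t + 1).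
  rewrite !prim_cst -/W; set E := c * _.
  have -> : E * (t + 1) - E * t = E by ring.
  apply; [by rewrite lerDl|exact: cont_cst|exact: cont_lead|move=> s /andP[s1 s2]].
  rewrite /E /c -expRD /lead.
  apply: (@le_trans _ _ (expR (- S t - L0) * expR (S t' - L0))).
    by rewrite -expRD ler_expR; lra.
  apply: ler_pM; rewrite ?expR_ge0//.
    rewrite ler_expR; have : S s - L0 <= S t by apply: near_S; rewrite ger0_norm; lra.
    by lra.
  apply: le_trans (lowP t') _; rewrite lerD2l; apply: expint_le => //.
  by apply: le_trans s1; rewrite lerN2 ler_nat leq_addr.
have iter I : W (- (I * n)%:R + 1) <= W 1 - c *
    \sum_(i < I) expR (- \sum_(j < n) letter a b (eta (Negz (i * n + j)%N))).
  elim: I => [|I IH]; first by rewrite mul0n oppr0 add0r big_ord0 mulr0 subr0.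
  rewrite big_ord_recr/= mulrDr; have := step I.
  have : W (- (I.+1 * n)%:R + 1) <= W (- (I * n)%:R).
    apply: Wmono; rewrite mulSn natrD opprD addrAC gerDr.
    have : (1 : R) <= n%:R by rewrite ler1n.
    lra.
  lra.
have nR : 0 < n%:R :> R by rewrite ltr0n.
have c0 : 0 < c by exact: expR_gt0.
have W10 : 0 <= W 1 by rewrite -(leadint0 cS L); exact: Wmono.
set K := c * k / n%:R.
have K0 : 0 <= K by rewrite divr_ge0 ?mulr_ge0// ltW.
exists (W 1 + K * n%:R * N.+1%:R) => s s0.
pose I := Num.truncn (- s / n%:R).
have /andP[I1 I2] : I%:R <= - s / n%:R < I.+1%:R.
  by apply: truncn_itv; rewrite divr_ge0 ?oppr_ge0// ltW.
rewrite ler_pdivlMr// in I1; rewrite ltr_pdivrMr// in I2.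
have KI : K * - s <= K * n%:R * I.+1%:R.
  by rewrite -mulrA ler_wpM2l// mulrC ltW.
have [IN|NI] := leqP N I; last first.
  have : W s <= W 0 by exact: Wmono.
  have -> : W 0 = 0 by exact: leadint0.
  move=> Ws.
  have : K * n%:R * I.+1%:R <= K * n%:R * N.+1%:R.
    apply: ler_wpM2l; first by rewrite mulr_ge0.
    by rewrite ler_nat ltnW.
  lra.
have Ws : W s <= W (- (I * n)%:R + 1).
  by apply: Wmono; rewrite natrM; lra.
have := iter I; have := hN I IN.
rewrite -(ler_pM2l c0) => h1 h2.
have -> : K * n%:R * N.+1%:R = K * n%:R + K * n%:R * N%:R by rewrite -natr1; ring.
have : 0 <= K * n%:R * N%:R.
  by apply: mulr_ge0 => //; apply: mulr_ge0 => //; exact: ltW.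
have Kn : K * n%:R = c * k by rewrite /K divfK// gt_eqF.
move: KI; rewrite -natr1 Kn; lra.
Qed.

End good_paths.

(** * Almost every path *)

Lemma ae_and d (T : measurableType d) (R : realType) (mu : {measure set T -> \bar R}) (P Q : T -> Prop) :
  {ae mu, forall x, P x} -> {ae mu, forall x, Q x} -> {ae mu, forall x, P x /\ Q x}.
Proof.
move=> p q; apply: negligibleS (negligibleU p q) => x /= h.
have [Px|nPx] := pselect (P x); last by left.
by right => Qx; apply: h.
Qed.

Section almost_sure.
Variables (R : realType) (a b q : R) (mu : probability Gamma R).
Hypotheses (a0 : 0 < a) (b0 : 0 < b) (q01 : 0 < q < 1) (hmu : bernoulli_scheme q mu).

Lemma mean_block_prod n (g : bool -> R) :
  \sum_(sigma : {ffun 'I_n -> bool}) block_weight q sigma * \prod_j g (sigma j) =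
  (q * g true + (1 - q) * g false) ^+ n.
Proof.
under eq_bigr do rewrite -big_split/=.
rewrite -(bigA_distr_bigA (fun (_ : 'I_n) x => wt q x * g x)) /=.
by rewrite prodr_const card_ord big_bool.
Qed.

Lemma letter_averages (g : bool -> R) :
  {ae mu, forall eta, forall k, k < q * g true + (1 - q) * g false ->
    exists N, forall I, (N <= I)%N -> k * I%:R <= \sum_(i < I) g (eta (Negz i))}.
Proof.
set m := _ + _.
have ae_j (j : nat) : {ae mu, forall eta, exists N, forall I, (N <= I)%N ->
    (m - j.+1%:R^-1) * I%:R <= \sum_(i < I) g (eta (Negz i))}.
  have h : m - j.+1%:R^-1 < \sum_(sigma : {ffun 'I_1 -> bool})
      block_weight q sigma * g (sigma ord0).
    rewrite [ltRHS](_ : _ = m); first by rewrite gtrBl invr_gt0.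
    rewrite -[m]expr1 -mean_block_prod; apply: eq_bigr => s _.
    by rewrite big_ord1.
  apply: filterS (block_averages q01 hmu h) => eta [N hN]; exists N => I NI.
  apply: le_trans (hN I NI) _; rewrite le_eqVlt; apply/orP; left; apply/eqP.
  by apply: eq_bigr => i _; rewrite ffunE muln1 addn0.
apply: filterS (ae_foralln ae_j) => eta h k km.
have [j jk] : exists j : nat, k <= m - j.+1%:R^-1.
  have mk : 0 < m - k by rewrite subr_gt0.
  exists (Num.bound (m - k)^-1).
  have := archi_boundP (ltW (_ : 0 < (m - k)^-1)).
  rewrite invr_gt0 => /(_ mk) le; rewrite lerBrDr -lerBrDl.
  rewrite -[leRHS]invrK lef_pV2 ?posrE ?invr_gt0//.
  by apply: (le_trans (ltW le)); rewrite ler_nat.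
have [N hN] := h j; exists N => I /hN; apply: le_trans.
by rewrite ler_wpM2r.
Qed.

Lemma ae_drift : {ae mu, forall eta, drift (a * q - (1 - q) * b) (pot a b eta)}.
Proof.
apply: filterS (ae_and (letter_averages (letter a b))
  (letter_averages (fun x => - letter a b x))).
move=> eta [lo hi]; apply: averages_drift => // k km.
  by apply: lo; rewrite /letter; lra.
have [|N hN] := hi (- k); first by rewrite /letter; lra.
exists N => I /hN; rewrite sumrN mulNr lerN2; exact.
Qed.

(** Bernoulli's inequality for both factors of la^(2k) = la^k la^k gives quadratic
    growth. *)
Lemma exists_expr_gt (la B : R) : 1 < la -> exists2 n, (0 < n)%N & B * n%:R < la ^+ n.
Proof.
move=> la1; pose d := la - 1; have d0 : 0 < d by rewrite subr_gt0.
have bern (k : nat) : 1 + k%:R * d <= la ^+ k.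
  elim: k => [|k IH]; first by rewrite mul0r addr0 expr0.
  rewrite exprS; have la0 : 0 <= la by lra.
  apply: le_trans (ler_wpM2l la0 IH).
  have : 0 <= k%:R * d * d by rewrite !mulr_ge0// ltW.
  by rewrite -natr1 /d; lra.
pose B' := `|B|; have B'0 : 0 <= B' by exact: normr_ge0.
pose k := (Num.bound (2 * B' / (d ^+ 2))).+1.
have hk : 2 * B' < k%:R * d ^+ 2.
  rewrite -ltr_pdivrMr ?exprn_gt0//; apply: lt_le_trans (archi_boundP _) _.
    by rewrite divr_ge0 ?sqr_ge0 ?mulr_ge0.
  by rewrite ler_nat.
have k0 : 0 < k%:R :> R by rewrite ltr0n.
exists (k * 2)%N => //; rewrite exprM natrM.
apply: (@lt_le_trans _ _ ((k%:R * d) ^+ 2)).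
  have : B <= B' by exact: ler_norm.
  rewrite -(ler_pM2r k0) => BB.
  rewrite -(ltr_pM2r k0) in hk.
  rewrite exprMn; lra.
have kd : 0 <= k%:R * d by rewrite mulr_ge0// ltW.
have lak := bern k; have kla : k%:R * d <= la ^+ k by lra.
by rewrite ler_pXn2r ?nnegrE//; exact: le_trans kla.
Qed.

(** The exponential of minus the sum of the letters of a block of length n has
    mean la ^+ n, and la ^+ n / n is unbounded in n. *)
Lemma ae_superlinear : 0 < a * q - (1 - q) * b -> 1 < q * expR (- a) + (1 - q) * expR b ->
  {ae mu, forall eta, superlinear (pot a b eta)}.
Proof.
move=> m0 la1; set la := _ + _ in la1; set c := expR (- (2 * (a + b))).
have c0 : 0 < c by exact: expR_gt0.
have ae_K (K : nat) : {ae mu, forall eta, exists C, forall s, s <= 0 ->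
    leadint (pot a b eta) (stat_param (pot a b eta)) s <= C + K%:R * s}.
  have [n n0 hn] := exists_expr_gt (K%:R / c) la1.
  have nR : n%:R != 0 :> R by rewrite pnatr_eq0 -lt0n.
  have h : K%:R / c * n%:R < \sum_(sigma : {ffun 'I_n -> bool})
      block_weight q sigma * expR (- \sum_j letter a b (sigma j)).
    rewrite [ltRHS](_ : _ = la ^+ n)//.
    have -> : la ^+ n = (q * expR (- letter a b true) + (1 - q) * expR (- letter a b false)) ^+ n.
      by rewrite /la /letter opprK.
    rewrite -(mean_block_prod n (fun x => expR (- letter a b x))).
    by apply: eq_bigr => s _; rewrite -sumrN expR_sum.
  apply: filterS (ae_and ae_drift (block_averages q01 hmu h)) => eta [dS [N hN]].
  have cS : continuous (pot a b eta) by exact: pot_continuous.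
  have [C0 hC0] := drift_expint m0 cS dS.
  have [||C hC] := @averages_superlinear R a b a0 b0 eta n (K%:R / c * n%:R) C0 n0 _ hC0.
  - by rewrite !mulr_ge0// invr_ge0 ltW.
  - exists N => I /hN; congr (_ <= _); apply: eq_bigr => i _; congr (expR (- _)).
    by apply: eq_bigr => j _; rewrite ffunE.
  exists C => s /hC; rewrite -/c.
  by have -> : c * (K%:R / c * n%:R) / n%:R = K%:R :> R by field; rewrite nR gt_eqF.
apply: filterS (ae_foralln ae_K) => eta h K.
have [C hC] := h (Num.bound `|K|); exists C => s s0.
apply: (le_trans (hC s s0)); rewrite lerD2l ler_wnM2r//.
apply: le_trans (ler_norm K) _; apply: ltW; exact: archi_boundP.
Qed.

End almost_sure.

(** * Measurability of the box *)

Section finite_dependence.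
Variable R : realType.

(** Induction on s, splitting according to the letter at its first site. *)
Lemma measurable_finite_dep (s : seq int) (X : Gamma -> set R) (l : Gamma -> R) :
  measurable_fun setT l -> (forall eta, measurable (X eta)) ->
  (forall eta eta' : Gamma, (forall n, n \in s -> eta n = eta' n) -> X eta = X eta') ->
  measurable [set eta | X eta (l eta)].
Proof.
move=> ml; elim: s X => [|m s IH] X mX dX.
  pose e0 : Gamma := fun=> true.
  rewrite [X in measurable X](_ : _ = setT `&` l @^-1` (X e0)); first exact: ml.
  by rewrite setTI; apply/seteqP; split=> eta /=; rewrite (dX eta e0).
pose upd (eta : Gamma) b : Gamma := fun n => if n == m then b else eta n.
have E eta : upd eta (eta m) = eta.
  by apply/funext => n; rewrite /upd; case: eqP => [->|].
rewrite [X in measurable X](_ : _ =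
    ([set eta | eta m = true] `&` [set eta | X (upd eta true) (l eta)]) `|`
    ([set eta | eta m = false] `&` [set eta | X (upd eta false) (l eta)])); last first.
  apply/seteqP; split=> eta /=.
    by case em : (eta m) => h; [left|right]; split=> //; rewrite -em E.
  by case=> -[em]; rewrite -em E.
have mU b : measurable [set eta | X (upd eta b) (l eta)].
  apply: (IH (fun eta => X (upd eta b))) => // eta eta' h; apply: dX => n.
  by rewrite inE /upd; case: eqP => //= _; exact: h.
by apply: measurableU; apply: measurableI => //; exact: measurable_coord.
Qed.

Lemma measurable_fun_finite_dep (s : seq int) (f : Gamma -> R -> R) (l : Gamma -> R) :
  measurable_fun setT l -> (forall eta, measurable_fun setT (f eta)) ->
  (forall eta eta' : Gamma, (forall n, n \in s -> eta n = eta' n) -> f eta = f eta') ->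
  measurable_fun setT (fun eta => f eta (l eta)).
Proof.
move=> ml mf df _ Y mY; rewrite setTI.
apply: (@measurable_finite_dep s (fun eta => f eta @^-1` Y) l ml).
  by move=> eta; rewrite -[X in measurable X]setTI; exact: mf.
by move=> eta eta' h; rewrite (df _ _ h).
Qed.

Lemma measurable_rsup (f : nat -> Gamma -> R) : (forall n, measurable_fun setT (f n)) ->
  measurable_fun setT (fun eta => rsup (fun n => f n eta)).
Proof.
move=> mf; rewrite /rsup.
apply: measurableT_comp; first exact: fine_measurable.
rewrite (_ : (fun eta => ereal_sup _) =
  (fun eta => esups (fun n => (f n eta)%:E) 0%N)); last first.
  apply/funext => eta; rewrite /esups/= /sdrop; congr ereal_sup.
  by apply/seteqP; split=> _ [n _ <-]; exists n.
apply: measurable_fun_esups => n; apply/measurable_EFinP; exact: mf.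
Qed.

Variables (a b : R).
Hypotheses (a0 : 0 < a) (b0 : 0 < b).

Definition past_sites (n : nat) : seq int := [seq Negz i | i <- iota 0 n].

Lemma pot_past_dep n (eta eta' : Gamma) t :
  (forall m, m \in past_sites n -> eta m = eta' m) -> - n%:R <= t <= 0 ->
  pot a b eta t = pot a b eta' t.
Proof.
move=> h /andP[nt]; rewrite le_eqVlt => /predU1P[->|t0]; first by rewrite !pot0.
have hi i : (i < n)%N -> eta (Negz i) = eta' (Negz i).
  by move=> lin; apply: h; apply/mapP; exists i => //; rewrite mem_iota.
have : Num.floor t < 0 by rewrite floor_lt_int.
have : (- n%:Z)%R <= Num.floor t by rewrite floor_ge_int mulrNz.
rewrite /pot; case: (Num.floor t) => // i; rewrite NegzE lerN2 lez_nat => iN _.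
rewrite -NegzE /= hi//; congr (- _ + _); apply: eq_bigr => k _; rewrite hi//.
exact: leq_trans (ltn_ord k) iN.
Qed.

Lemma past_functionals_dep n (eta eta' : Gamma) :
  (forall m, m \in past_sites n -> eta m = eta' m) ->
  expint (pot a b eta) (- n%:R) = expint (pot a b eta') (- n%:R) /\
  forall k c, growthint (pot a b eta) c k (- n%:R) = growthint (pot a b eta') c k (- n%:R).
Proof.
move=> h; have cS e : continuous (pot a b e) by exact: pot_continuous.
have n0 : - n%:R <= 0 :> R by rewrite oppr_le0.
have cancel0 (x y x' y' : R) : x - y = x' - y' -> x = 0 -> x' = 0 -> y = y' by lra.
have E t : - n%:R <= t <= 0 -> expint (pot a b eta) t = expint (pot a b eta') t.
  move=> /andP[nt t0].
  have := @prim_eq R (fun t => expR (pot a b eta t)) (fun t => expR (pot a b eta' t)) t 0 t0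
    (cont_exp (cS eta)) (cont_exp (cS eta')).
  rewrite -!/(expint _) !expint0// !sub0r => H; apply: oppr_inj; apply: H => s /andP[ts s0].
  by rewrite (pot_past_dep h)// (le_trans nt ts).
have X c t : - n%:R <= t <= 0 -> lead (pot a b eta) c t = lead (pot a b eta') c t.
  by move=> nt; rewrite /lead E// (pot_past_dep h nt).
have W c t : - n%:R <= t <= 0 -> leadint (pot a b eta) c t = leadint (pot a b eta') c t.
  move=> /andP[nt t0].
  have H : leadint (pot a b eta) c 0 - leadint (pot a b eta) c t =
      leadint (pot a b eta') c 0 - leadint (pot a b eta') c t.
    apply: (prim_eq t0 (@cont_lead _ _ (cS eta) c) (@cont_lead _ _ (cS eta') c)) => s /andP[ts s0].
    by rewrite X// (le_trans nt ts).
  exact: cancel0 H (leadint0 (cS eta) c) (leadint0 (cS eta') c).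
split; first by rewrite E// lexx.
move=> k c.
have H : growthint (pot a b eta) c k 0 - growthint (pot a b eta) c k (- n%:R) =
    growthint (pot a b eta') c k 0 - growthint (pot a b eta') c k (- n%:R).
  apply: (prim_eq n0 (@cont_growth _ _ (cS eta) c k) (@cont_growth _ _ (cS eta') c k)) => s ns.
  by rewrite /growth W.
exact: cancel0 H (growthint0 (cS eta) c k) (growthint0 (cS eta') c k).
Qed.

Lemma measurable_stat_param : measurable_fun setT (fun eta => stat_param (pot a b eta)).
Proof.
apply: measurable_rsup => n.
apply: (@measurable_fun_finite_dep (past_sites n)
  (fun eta _ => - expint (pot a b eta) (- n%:R)) (fun=> 0)).
- exact: measurable_cst.
- by move=> eta; exact: measurable_cst.
- by move=> eta eta' /past_functionals_dep[-> _].
Qed.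

(** The past up to - n is a function of n letters and of the parameter, in which it
    is monotone. *)
Lemma measurable_stat_mass k : measurable_fun setT
  (fun eta => stat_mass (pot a b eta) (stat_param (pot a b eta)) k).
Proof.
apply: measurable_rsup => n.
apply: (@measurable_fun_finite_dep (past_sites n)
  (fun eta c => - growthint (pot a b eta) c k (- n%:R)) (fun eta => stat_param (pot a b eta))).
- exact: measurable_stat_param.
- move=> eta; apply: nonincreasing_measurable => // c c' cc.
  by rewrite lerN2; apply: growthint_lead_le => //; exact: pot_continuous.
- by move=> eta eta' /past_functionals_dep[_ h]; apply/funext => c; rewrite h.
Qed.

End finite_dependence.

Section measurable_box.
Variables (R : realType) (a b : R) (mu : probability Gamma R).
Hypotheses (a0 : 0 < a) (b0 : 0 < b).

Lemma rat_shrink (x e : R) : 0 < e -> exists y : rat, `|ratr y : R| <= `|x| /\ `|x - ratr y| <= e.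
Proof.
move=> e0.
have pos z : 0 < z -> exists y : rat, `|ratr y : R| <= z /\ `|z - ratr y| <= e.
  move=> z0; have [|y] := @rat_in_itvoo R (Num.max 0 (z - e)) z.
    by rewrite gt_max z0/= gtrBl.
  rewrite in_itv/= gt_max => /andP[/andP[y0 ye] yz]; exists y.
  split; first by rewrite ger0_norm ?ltW.
  rewrite ger0_norm; lra.
have [x0|x0|->] := ltgtP x 0.
- have [|y [y1 y2]] := pos (- x); first by rewrite oppr_gt0.
  exists (- y); rewrite rmorphN normrN opprK (ltr0_norm x0); split=> //.
  by rewrite -normrN opprD.
- by have [y [y1 y2]] := pos x x0; exists y; rewrite (gtr0_norm x0).
- by exists 0; rewrite rmorph0 normr0 subrr normr0; split=> //; exact: ltW.
Qed.

Definition rat_point (s : seq rat) (x : R) : l2 R :=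
  l2_of (fun j => if j == 0%N then x else ratr (nth 0 s j)).

Let rat_point_summable s x :
  square_summable (fun j => if j == 0%N then x else ratr (nth 0 s j) : R).
Proof.
apply: (@square_summable_fin _ _ (size s).+1) => -[//|j]; rewrite ltnS => sj /=.
by rewrite nth_default ?rmorph0// ltnW.
Qed.

Lemma rat_pointE s x j : rat_point s x j = if j == 0%N then x else ratr (nth 0 s j).
Proof. by rewrite l2_ofE. Qed.

Lemma continuous_rat_point s : continuous (rat_point s).
Proof.
move=> x; apply: (@l2_dominated_cvg _ _ _ _ _ _ (fun j => if j == 0%N then (`|x| + 1) ^+ 2 else
  rat_point s x j ^+ 2)).
- by apply: is_cvg_series_head; exact: l2P.
- move=> j; rewrite rat_pointE; have -> : (fun t => rat_point s t j) =
      (fun t => if j == 0%N then t else ratr (nth 0 s j)).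
    by apply/funext => t; rewrite rat_pointE.
  by case: eqP => _; [exact: cvg_id|exact: cvg_cst].
- near=> y => j; rewrite !rat_pointE; case: eqP => // _.
  rewrite -(real_normK (num_real y)) ler_pXn2r ?nnegrE ?addr_ge0//.
  rewrite -lerBlDl; apply: le_trans (lerB_dist _ _) _; rewrite distrC.
  by apply: ltW; near: y; exact: (@nbhsx_ballx _ R x 1 ltr01).
Unshelve. all: by end_near. Qed.

(** Each coordinate is moved towards 0 to a rational. The approximations then stay in
    the box and are dominated by p itself. *)
Lemma rat_point_dense S (p : l2 R) (O : set (l2 R)) :
  (forall j, (0 < j)%N -> 0 <= stat_mass S (stat_param S) (rate R j)) ->
  abox S p -> open O -> O p ->
  exists s, abox S (rat_point s (stat_param S)) /\ O (rat_point s (stat_param S)).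
Proof.
move=> J0 [p0 pj] oO Op.
have e0 (n : nat) : 0 < n.+1%:R^-1 :> R by rewrite invr_gt0.
pose y n j : rat := projT1 (cid (rat_shrink (p j) (e0 n))).
have yP n j : `|ratr (y n j) : R| <= `|p j| /\ `|p j - ratr (y n j)| <= n.+1%:R^-1.
  by rewrite /y; case: cid.
pose s n := [seq y n j | j <- iota 0 n].
have sE n j : nth 0 (s n) j = if (j < n)%N then y n j else 0.
  case: ltnP => jn; first by rewrite (nth_map 0%N) ?size_iota// nth_iota.
  by rewrite nth_default// size_map size_iota.
have sp n j : (rat_point (s n) (p 0%N) j) ^+ 2 <= p j ^+ 2.
  rewrite rat_pointE; case: eqP => [->//|_]; rewrite sE; case: ifP => _.
    rewrite -(real_normK (num_real (ratr _))) -(real_normK (num_real (p j))).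
    by rewrite ler_pXn2r ?nnegrE//; case: (yP n j).
  by rewrite rmorph0 expr0n sqr_ge0.
have cs : (fun n => rat_point (s n) (p 0%N)) @ \oo --> p.
  apply: (@l2_dominated_cvg _ _ _ _ _ _ (fun j => p j ^+ 2)); first exact: l2P.
  - move=> j; apply/cvgrPdist_le => e ep; near=> n; rewrite rat_pointE.
    case: eqP => [->|_]; first by rewrite subrr normr0 ltW.
    rewrite sE; have -> : (j < n)%N by near: n; exact: nbhs_infty_gt.
    apply: le_trans (yP n j).2 _; near: n.
    have := @near_infty_natSinv_lt R (PosNum ep).
    by apply: filterS => n; exact: ltW.
  - by near=> n.
have [n On] : exists n, O (rat_point (s n) (p 0%N)).
  have : nbhs p O by exact: open_nbhs_nbhs.
  by move=> /cs[N _ /(_ N (leqnn N))]; exists N.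
exists (s n); rewrite -p0; split=> //; split=> [|j j0]; first by rewrite rat_pointE.
apply: le_trans (pj j j0); rewrite ler_wpM2l//; first by rewrite mulr_ge0// J0.
Unshelve. all: by end_near. Qed.

(** The points with rational coordinates other than coordinate 0, finitely many of
    them nonzero, are dense in the box. For each of them, membership in the box and in
    the open set is a condition on [stat_param] and [stat_mass]. *)
Lemma measurable_abox :
  {ae mu, forall eta, confined (pot a b eta)} ->
  measurable_set_valued mu (fun eta => abox (pot a b eta)).
Proof.
move=> [N0 [mN0 N00 cN0]] O oO.
pose L eta := stat_param (pot a b eta).
pose J j eta := stat_mass (pot a b eta) (L eta) (rate R j).
pose X s := (L @^-1` [set x | O (rat_point s x)]) `&`
  \bigcap_j [set eta | (0 < j)%N -> 2 * J j eta * (ratr (nth 0 s j)) ^+ 2 <= 1].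
have mX s : measurable (X s).
  apply: measurableI.
    rewrite -[X in measurable X]setTI; apply: measurable_stat_param => //.
    apply: open_measurable; have := @continuous_rat_point s => /continuousP; exact.
  apply: bigcapT_measurable => j; case: j => [|j].
    rewrite [X in measurable X](_ : _ = setT); first exact: measurableT.
    by apply/seteqP; split.
  pose Y := [set z : R | 2 * z * (ratr (nth 0 s j.+1)) ^+ 2 <= 1].
  rewrite [X in measurable X](_ : _ = setT `&` J j.+1 @^-1` Y); last first.
    by rewrite setTI; apply/seteqP; split=> eta /=; [exact|move=> h _].
  apply: measurable_stat_mass => //; apply: is_interval_measurable => x z /= hx hz t /andP[_ tz].
  apply: le_trans hz; rewrite ler_wpM2r ?sqr_ge0// ler_pM2l//.
pose M := \bigcup_n (if unpickle n is Some s then X s else set0).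
have mM : measurable M by apply: bigcupT_measurable => n; case: unpickle.
set Y := [set eta | _].
have YM eta : ~ N0 eta -> Y eta <-> M eta.
  move=> nN; have hS : confined (pot a b eta) by apply: contrapT => h; apply/nN/cN0.
  have cS : continuous (pot a b eta) by exact: pot_continuous.
  split.
    move=> [p [pA Op]]; have [|s [sA Os]] := rat_point_dense _ pA oO Op.
      move=> j _; have := stat_mass_gt cS hS (rate R j) 0.
      by rewrite growthint0// addr0 => /ltW.
    exists (pickle s) => //; rewrite pickleK; split=> // j _ j0.
    by have := sA.2 j j0; rewrite rat_pointE gtn_eqF.
  move=> [n _]; case: unpickle => // s [Os h].
  exists (rat_point s (L eta)); split=> //; split; first by rewrite rat_pointE.
  by move=> j j0; rewrite rat_pointE gtn_eqF//; exact: h j I j0.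
exists (M `\` N0); first exact: measurableD.
exists (Y `\` (M `\` N0)).
  exists N0; split=> // eta [Yeta h]; apply: contrapT => nN; apply: h; split=> //.
  exact/YM.
apply/seteqP; split=> eta /=; last by case: (pselect ((M `\` N0) eta)); [left|right].
by case=> [[Meta nN]|[]//]; exact/YM.
Qed.

End measurable_box.

(** * Lower bounds for coverings *)

Section covers.
Variables (R : realType) (V : normedModType R).
Implicit Types (A C : set V) (s K : R).

Lemma diam_ge C x y : C x -> C y -> (`|x - y|%:E <= diam C)%E.
Proof.
move=> Cx Cy; rewrite /diam le_max; apply/orP; right.
by apply: ereal_sup_ubound; exists x => //; exists y.
Qed.

Lemma diam_ge0 C : (0 <= diam C)%E. Proof. by rewrite /diam le_max lexx. Qed.

(** The parameters t with x t in C i lie in an interval of length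
    2 K diam (C i)^s, and these intervals cover [0, 1[. *)
Lemma cover_sum_ge_of_holder A (x : R -> V) K s : 0 < K -> 0 < s ->
  (forall t, 0 <= t < 1 -> A (x t)) ->
  (forall t t', 0 <= t < 1 -> 0 <= t' < 1 -> `|t - t'| <= K * `|x t - x t'| `^ s) ->
  forall C : (set V)^nat, A `<=` \bigcup_i C i ->
    ((2 * K)^-1%:E <= \sum_(0 <= i <oo) poweR (diam (C i)) s)%E.
Proof.
move=> K0 s0 xA xK C AC.
pose D i := [set t : R | 0 <= t < 1 /\ C i (x t)].
have E_ i : exists E : set R, [/\ measurable E, D i `<=` E &
    (lebesgue_measure E <= (2 * K)%:E * poweR (diam (C i)) s)%E].
  have K2 : 0 < 2 * K by rewrite mulr_gt0.
  have [[t0 Dt0]|nD] := pselect (exists t, D i t); last first.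
    exists set0; split=> //.
      by move=> t Dt; exfalso; apply: nD; exists t.
    by rewrite measure0 mule_ge0 ?poweR_ge0// lee_fin ltW.
  have := diam_ge0 (C i); case dC : (diam (C i)) => [d| |]// d0; last first.
    exists setT; split=> //.
    by rewrite poweRyr ?gt_eqF// gt0_muley ?lte_fin// leey.
  pose w := K * d `^ s.
  have w0 : 0 <= w by rewrite mulr_ge0 ?powR_ge0// ltW.
  exists `[t0 - w, t0 + w]%classic; split=> //.
    move=> t Dt; rewrite /= in_itv/= -ler_distl.
    apply: le_trans (xK t t0 Dt.1 Dt0.1) _; rewrite ler_pM2l//.
    have d0' : 0 <= d by rewrite -lee_fin.
    have xd : `|x t - x t0| <= d by rewrite -lee_fin -dC; exact: diam_ge Dt.2 Dt0.2.
    by apply: ge0_ler_powR; rewrite ?nnegrE// ltW.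
  rewrite lebesgue_measure_itv/= lte_fin; case: ifP => _.
    by rewrite -EFinB -EFinM lee_fin /w; lra.
  by rewrite mule_ge0 ?lee_fin ?powR_ge0// ltW.
have [E hE] := choice E_.
have le1 : (lebesgue_measure (`[0%R, 1%R[%classic : set R) <= \sum_(0 <= i <oo) lebesgue_measure (E i))%E.
  apply: measure_sigma_subadditive => //.
    by move=> i; have [] := hE i.
  move=> t; rewrite /= in_itv/= => t01; have [i _ Ci] := AC _ (xA t t01).
  by exists i => //; have [_ + _] := hE i; apply.
have le2 : (\sum_(0 <= i <oo) lebesgue_measure (E i) <=
    (2 * K)%:E * \sum_(0 <= i <oo) poweR (diam (C i)) s)%E.
  rewrite -nneseriesZl; last by move=> i _; exact: poweR_ge0.
  apply: lee_nneseries => [i _ _|i _]; first exact: measure_ge0.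
  by have [_ _] := hE i.
have := le_trans le1 le2.
rewrite lebesgue_measure_itv/= lte_fin ltr01 oppr0 adde0 => H.
have K2 : 0 < 2 * K by rewrite mulr_gt0.
have i0 : (0 <= (2 * K)^-1%:E)%E by rewrite lee_fin invr_ge0 ltW.
have := lee_wpmul2l i0 H.
by rewrite mule1 muleA -EFinM mulVf ?gt_eqF// mul1e.
Qed.

End covers.

Section cantor_digits.
Variable R : realType.
Implicit Types (t : R) (d : nat -> bool) (p m n i : nat).

Definition dyadic p t : nat := Num.truncn (2 ^+ p * t).
Definition digit t p : bool := odd (dyadic p.+1 t).

Lemma dyadicS p t : 0 <= t -> dyadic p.+1 t = ((dyadic p t).*2 + digit t p)%N.
Proof.
move=> t0; rewrite /digit -[LHS]odd_double_half addnC; congr (_.*2 + _)%N.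
have pt : 0 <= 2 ^+ p * t by rewrite mulr_ge0 ?exprn_ge0.
have pt' : 0 <= 2 ^+ p.+1 * t by rewrite mulr_ge0 ?exprn_ge0.
apply/esym/truncn_def.
have /andP[h1 h2] := truncn_itv pt'; rewrite -/(dyadic p.+1 t) in h1 h2.
move: (odd_double_half (dyadic p.+1 t)) h1 h2; set y := dyadic _ _; set h := y./2 => <-.
rewrite exprS -mulrA; set z := _ ^+ p * t => h1 h2.
have h3 : (h.*2)%:R <= (odd y + h.*2)%:R :> R by rewrite ler_nat leq_addl.
have h4 : (odd y + h.*2).+1%:R <= (h.*2.+2)%:R :> R.
  by rewrite ler_nat ltnS; case: (odd y).
have e1 : (h.*2)%:R = 2 * h%:R :> R by rewrite -mul2n natrM.
have e2 : (h.*2.+2)%:R = 2 * h.+1%:R :> R by rewrite -doubleS -mul2n natrM.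
by apply/andP; split; lra.
Qed.

Lemma dyadic_close p t t' : 0 <= t -> 0 <= t' -> dyadic p t = dyadic p t' ->
  `|t - t'| <= (2 ^+ p)^-1.
Proof.
move=> t0 t0' E; have p0 : 0 < 2 ^+ p :> R by rewrite exprn_gt0.
have /andP[h1 h2] : (dyadic p t)%:R <= 2 ^+ p * t < (dyadic p t).+1%:R.
  by apply: truncn_itv; rewrite mulr_ge0// ltW.
have /andP[h3 h4] : (dyadic p t')%:R <= 2 ^+ p * t' < (dyadic p t').+1%:R.
  by apply: truncn_itv; rewrite mulr_ge0// ltW.
rewrite -(ler_pM2l p0) mulfV ?gt_eqF// -[X in X * _](gtr0_norm p0) -normrM mulrBr.
move: h1 h2 h3 h4; rewrite -E; set y := dyadic p t; rewrite -[y.+1%:R]natr1.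
by rewrite ler_norml; lra.
Qed.

Lemma digit_agree p t t' : 0 <= t < 1 -> 0 <= t' < 1 ->
  (forall k, (k < p)%N -> digit t k = digit t' k) -> dyadic p t = dyadic p t'.
Proof.
move=> /andP[t0 t1] /andP[t0' t1'].
have d0 u : 0 <= u < 1 -> dyadic 0 u = 0%N.
  by move=> /andP[u0 u1]; apply: truncn_def; rewrite expr0 mul1r u0.
elim: p => [_|p IH h]; first by rewrite !d0 ?t0 ?t0'.
by rewrite !dyadicS// IH ?h// => k kp; apply: h; rewrite ltnS ltnW.
Qed.

(** If all the binary digits agreed, t and t' would be within 2^-p of each other
    for every p. *)
Lemma first_digit t t' : 0 <= t < 1 -> 0 <= t' < 1 -> t != t' ->
  exists p, [/\ forall k, (k < p)%N -> digit t k = digit t' k,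
    digit t p != digit t' p & `|t - t'| <= (2 ^+ p)^-1].
Proof.
move=> t01 t01' tt.
have ex_dp : exists p, digit t p != digit t' p.
  apply/not_existsP => h.
  have agree p : dyadic p t = dyadic p t'.
    by apply: digit_agree => // k _; apply/eqP/negPn/negP/h.
  have e0 : 0 < `|t - t'| by rewrite normr_gt0 subr_eq0.
  have [p hp] : exists p, (2 ^+ p)^-1 < `|t - t'|.
    exists (Num.bound (`|t - t'|^-1)).
    rewrite -[ltRHS]invrK ltf_pV2 ?posrE ?exprn_gt0 ?invr_gt0//.
    have ie : 0 <= `|t - t'|^-1 by rewrite invr_ge0.
    apply: lt_le_trans (archi_boundP ie) _.
    by rewrite -natrX ler_nat ltnW// ltn_expl.
  case/andP: t01 => t0 _; case/andP: t01' => t0' _.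
  by have := dyadic_close t0 t0' (agree p); rewrite leNgt hp.
have [p' dp' hmin] := ex_minnP ex_dp.
have ag k : (k < p')%N -> digit t k = digit t' k.
  by move=> kp; apply/eqP/negPn/negP => /hmin; rewrite leqNgt kp.
exists p'; split=> //; apply: dyadic_close; [by case/andP: t01|by case/andP: t01'|].
exact: digit_agree.
Qed.

(** A number with digits 0 and 1 in base 3. *)
Definition cantor_term d m : R := (d m)%:R / 3 ^+ m.
Definition cantor d : R := limn (series (cantor_term d)).

Lemma cantor_partial_le d m N : (m <= N)%N ->
  series (cantor_term d) N <=
  series (cantor_term d) m + (3 / 2 * (3 ^+ m)^-1 - 3 / 2 * (3 ^+ N)^-1) :> R.
Proof.
move=> mN; rewrite -(subnKC mN); elim: (N - m)%N => [|k IH].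
  by rewrite addn0 subrr addr0.
have -> : series (cantor_term d) (m + k.+1)%N =
    series (cantor_term d) (m + k)%N + cantor_term d (m + k)%N.
  by rewrite addnS /series/= big_nat_recr.
rewrite addnS; have : cantor_term d (m + k)%N <= (3 ^+ (m + k)%N)^-1.
  rewrite -[leRHS]mul1r ler_pM2r ?invr_gt0 ?exprn_gt0//.
  by case: (d _) => /=; rewrite ?ler01.
have : (3 ^+ (m + k).+1)^-1 = (3 ^+ (m + k)%N)^-1 / 3 :> R by rewrite exprS invfM mulrC.
move=> ->; lra.
Qed.

Lemma is_cvg_cantor d : cvgn (series (cantor_term d)).
Proof.
apply: nondecreasing_is_cvgn.
  by apply: nondecreasing_series => m _ _; rewrite divr_ge0 ?exprn_ge0.
exists (3 / 2) => _ [N _ <-]; have := @cantor_partial_le d 0 N (leq0n N).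
rewrite {2}/series/= big_geq// expr0 invr1.
have : 0 < (3 ^+ N)^-1 :> R by rewrite invr_gt0 exprn_gt0.
lra.
Qed.

Lemma cantor_itv d m : series (cantor_term d) m <= cantor d <=
  series (cantor_term d) m + 3 / 2 * (3 ^+ m)^-1.
Proof.
apply/andP; split.
  apply: nondecreasing_cvgn_le; last exact: is_cvg_cantor.
  by apply: nondecreasing_series => k _ _; rewrite divr_ge0 ?exprn_ge0.
apply: limr_le; first exact: is_cvg_cantor.
near=> N; have mN : (m <= N)%N by near: N; exact: nbhs_infty_ge.
apply: le_trans (cantor_partial_le d mN) _.
have : 0 < (3 ^+ N)^-1 :> R by rewrite invr_gt0 exprn_gt0.
lra.
Unshelve. all: by end_near. Qed.

Lemma cantor_bounds d : 0 <= cantor d <= 3 / 2.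
Proof. by have := cantor_itv d 0; rewrite {1 2}/series/= big_geq// expr0 invr1 add0r mulr1. Qed.

(** The digits after the first difference contribute at most half of it. *)
Lemma cantor_sep d d' m : (forall k, (k < m)%N -> d k = d' k) -> d m != d' m ->
  (2 * 3 ^+ m)^-1 <= `|cantor d - cantor d'|.
Proof.
wlog : d d' / d m.
  move=> H h dd; case dm : (d m); first exact: H.
  have dm' : d' m by move: dd; rewrite dm; case: (d' m).
  by rewrite distrC; apply: H => //; [move=> k /h ->|rewrite eq_sym].
move=> dm h; rewrite dm => dm'; have {}dm' : d' m = false by case: (d' m) dm'.
have /andP[h1 _] := cantor_itv d m.+1; have /andP[_ h2] := cantor_itv d' m.+1.
have E : series (cantor_term d) m = series (cantor_term d') m :> R.
  by rewrite /series/=; apply: eq_big_nat => k /andP[_ km]; rewrite /cantor_term h.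
move: h1 h2 E; rewrite /series/= !big_nat_recr//= [X in _ + X <= _]/cantor_term [cantor_term d' m]/cantor_term dm dm' mul0r addr0 mul1r.
have -> : (3 ^+ m.+1)^-1 = (3 ^+ m)^-1 / 3 :> R by rewrite exprS invfM mulrC.
rewrite invfM; set x := (3 ^+ m)^-1 => h1 h2 E.
apply: le_trans (ler_norm _); lra.
Qed.

End cantor_digits.

(** * Dimensions of the box *)

Section dimensions.
Variable R : realType.
Variable S : R -> R.
Hypothesis (cS : continuous S) (hS : confined S).
Let L := stat_param S.

(** The binary digits of t are dealt out in turn to the coordinates 1, ..., n, each of
    which reads its share in base 3. The constant 2 / 3 normalizes the sum of all the
    powers 3^-m to r. *)
Definition cantor_coord (n : nat) (r : R) (x0 : R) (t : R) (j : nat) : R :=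
  if j == 0%N then x0 else if (j <= n)%N then
    r * (2 / 3) * cantor R (fun m => digit t (m * n + j.-1)) else 0.

Lemma cantor_coord_summable n r x0 t : square_summable (cantor_coord n r x0 t).
Proof.
apply: (@square_summable_fin _ _ n.+1) => j nj.
by rewrite /cantor_coord gtn_eqF ?(leq_ltn_trans _ nj)// leqNgt nj.
Qed.

(** The box contains a cube in any finite set of directions other than 0, as its
    half-widths are positive. *)
Lemma abox_cantor n : exists2 r, 0 < r &
  forall t, abox S (l2_of (cantor_coord n r L t)).
Proof.
pose J j := stat_mass S L (rate R j).
have J0 j : 0 < J j.
  by have := stat_mass_gt cS hS (rate R j) 0; rewrite growthint0// addr0.
pose M := \sum_(1 <= j < n.+1) 2 * J j.
have M0 : 0 <= M by apply: sumr_ge0 => j _; rewrite mulr_ge0// ltW.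
have M1 : 0 < 1 + M by lra.
exists (1 + M)^-1; first by rewrite invr_gt0.
move=> t; split; first by rewrite l2_ofE//; exact: cantor_coord_summable.
move=> j j0; rewrite l2_ofE; last exact: cantor_coord_summable.
rewrite /cantor_coord gtn_eqF// -/(J j); case: ifP => jn; last first.
  by rewrite expr0n mulr0.
set d := cantor R _; have /andP[d0 d1] : 0 <= d <= 3 / 2 by exact: cantor_bounds.
have JM : 2 * J j <= 1 + M.
  apply: (@le_trans _ _ M); last by rewrite lerDr.
  rewrite /M (bigD1_seq j) ?mem_index_iota ?j0 ?iota_uniq//= lerDl.
  by apply: sumr_ge0 => k _; rewrite mulr_ge0// ltW.
have r0 : 0 <= (1 + M)^-1 by rewrite invr_ge0 ltW.
have r1 : (1 + M)^-1 <= 1 by rewrite invf_le1// lerDl.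
have z0 : 0 <= (1 + M)^-1 * (2 / 3) * d by rewrite !mulr_ge0.
have z1 : (1 + M)^-1 * (2 / 3) * d <= (1 + M)^-1.
  by rewrite -mulrA -[leRHS]mulr1 ler_wpM2l//; lra.
apply: (@le_trans _ _ ((1 + M) * ((1 + M)^-1 * 1))); last by rewrite mulr1 mulfV ?gt_eqF.
by rewrite expr2; apply: ler_pM => //; rewrite ?mulr_ge0 ?(ltW (J0 j))//;
  apply: ler_pM => //; exact: le_trans r1.
Qed.

(** If the first difference is digit p = m n + i, then |t - t'| <= 2^-(m n), whereas
    the points differ by at least r 3^-m / 3 in coordinate i + 1. The condition on n
    makes 2^-(m n) at most (3^-m)^s. *)
Lemma cantor_holder n r x0 s t t' : (0 < n)%N -> 0 < r -> 0 < s -> 3 `^ s <= 2 ^+ n ->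
  0 <= t < 1 -> 0 <= t' < 1 ->
  `|t - t'| <= (3 / r) `^ s *
     `|l2_of (cantor_coord n r x0 t) - l2_of (cantor_coord n r x0 t')| `^ s.
Proof.
move=> n0 r0 s0 sn t01 t01'; set D := `|l2_of _ - _|.
have [->|tt] := eqVneq t t'; first by rewrite subrr normr0 mulr_ge0 ?powR_ge0.
have [p [ag dp tp]] := first_digit t01 t01' tt.
pose m := (p %/ n)%N; pose i := (p %% n)%N.
have pE : p = (m * n + i)%N by exact: divn_eq.
have iln : (i < n)%N by rewrite ltn_pmod.
have := cantor_sep R (d := fun m => digit t (m * n + i)) (d' := fun m => digit t' (m * n + i)) (m := m).
rewrite -pE => /(_ _ dp) sep.
have {}sep : (2 * 3 ^+ m)^-1 <= `|cantor R (fun m => digit t (m * n + i)) -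
                                  cantor R (fun m => digit t' (m * n + i))|.
  apply: sep => k km; apply: ag; rewrite pE.
  apply: (@leq_trans (k.+1 * n)); first by rewrite mulSn addnC ltn_add2r.
  by apply: leq_trans (leq_addr _ _); rewrite leq_mul2r km orbT.
have lo : r / 3 * (3 ^+ m)^-1 <= D.
  have xE u : l2_of (cantor_coord n r x0 u) i.+1 = cantor_coord n r x0 u i.+1.
    by rewrite l2_ofE//; exact: cantor_coord_summable.
  have coord (X Y : l2 R) (A B : R) : X i.+1 = A -> Y i.+1 = B -> `|A - B| <= `|X - Y|.
    by move=> <- <-; exact: l2_coord_dist.
  apply: (le_trans _ (coord _ _ _ _ (xE t) (xE t'))).
  rewrite /cantor_coord/= iln -mulrBr normrM gtr0_norm; last by rewrite mulr_gt0.
  apply: le_trans (ler_wpM2l _ sep); last by rewrite mulr_ge0// ltW.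
  by rewrite invfM; lra.
have m3 : 0 < (3 ^+ m)^-1 :> R by rewrite invr_gt0 exprn_gt0.
have r3 : 0 < 3 / r by rewrite divr_gt0.
have D0 : 0 <= D by exact: normr_ge0.
rewrite -powRM ?(ltW r3)//; apply: (le_trans tp).
apply: (@le_trans _ _ ((3 ^+ m)^-1 `^ s)); last first.
  have le3 : (3 ^+ m)^-1 <= 3 / r * D.
    have -> : (3 ^+ m)^-1 = 3 / r * (r / 3 * (3 ^+ m)^-1).
      by field; rewrite expf_neq0 //= gt_eqF.
    by rewrite ler_pM2l.
  by apply: ge0_ler_powR; rewrite ?nnegrE ?(ltW s0) ?(ltW m3) ?(le_trans _ le3) ?(ltW m3).
rewrite -powR_inv1 ?exprn_ge0// -powRrM mulN1r powRN lef_pV2 ?posrE ?exprn_gt0 ?powR_gt0//.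
rewrite -powR_mulrn// -powRrM mulrC powRrM powR_mulrn ?powR_ge0//.
apply: (@le_trans _ _ ((2 ^+ n) ^+ m)).
  by rewrite lerXn2r ?nnegrE ?powR_ge0 ?exprn_ge0.
by rewrite -exprM ler_weXn2l ?ler1n// mulnC pE leq_addr.
Qed.

Lemma exists_pow3_le s : exists2 n, (0 < n)%N & 3 `^ s <= 2 ^+ n :> R.
Proof.
exists (Num.bound (2 * `|s|)).+1 => //.
apply: (@le_trans _ _ (4 `^ `|s|)).
  apply: (@le_trans _ _ (3 `^ `|s|)).
    by apply: ler_powR; [rewrite ler1n|exact: ler_norm].
  by apply: ge0_ler_powR; rewrite ?nnegrE//; lra.
have -> : 4 = 2 `^ 2 :> R by rewrite powR_mulrn//; ring.
rewrite -powRrM -powR_mulrn//; apply: ler_powR; first by rewrite ler1n.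
apply: (le_trans (ltW (archi_boundP _))); first by rewrite mulr_ge0.
by rewrite ler_nat.
Qed.

Lemma abox_cover_sum s : 0 < s -> exists2 c, 0 < c &
  forall C : (set (l2 R))^nat, abox S `<=` \bigcup_i C i ->
    (c%:E <= \sum_(0 <= i <oo) poweR (diam (C i)) s)%E.
Proof.
move=> s0; have [n n0 sn] := exists_pow3_le s; have [r r0 hr] := abox_cantor n.
have K0 : 0 < (3 / r) `^ s by rewrite powR_gt0// divr_gt0.
exists (2 * (3 / r) `^ s)^-1; first by rewrite invr_gt0 mulr_gt0.
move=> C AC.
apply: (@cover_sum_ge_of_holder R (l2 R) (abox S) (fun t => l2_of (cantor_coord n r L t))) => //.
by move=> t t' t01 t01'; exact: cantor_holder.
Qed.

End dimensions.

Section infinite_dimension.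
Variables (R : realType) (V : normedModType R).
Variable A : set V.
Hypothesis cover_sum : forall s : R, 0 < s -> exists2 c, 0 < c &
  forall C : (set V)^nat, A `<=` \bigcup_i C i ->
    (c%:E <= \sum_(0 <= i <oo) poweR (diam (C i)) s)%E.

Lemma hausdorff_dim_infinite : hausdorff_dim A = +oo%E.
Proof.
rewrite /hausdorff_dim (_ : [set _ | _ in _] = set0) ?ereal_inf0//.
apply/seteqP; split=> // x [s [s0 hs] _].
have [c c0 hc] := cover_sum s0.
have : (c%:E <= hausdorff_measure s A)%E.
  apply: (@le_trans _ _ (hausdorff_premeasure s 1 A)).
    by apply: le_ereal_inf_tmp => _ [C [AC _] <-]; exact: hc.
  by apply: ereal_sup_ubound; exists 1 => //; exact: ltr01.
by rewrite hs lee_fin leNgt c0.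
Qed.

(** A ball of radius eps has diameter at most 2 eps. *)
Lemma covering_number_ge s c eps : 0 < s -> 0 < c -> 0 < eps ->
  (forall C : (set V)^nat, A `<=` \bigcup_i C i ->
    (c%:E <= \sum_(0 <= i <oo) poweR (diam (C i)) s)%E) ->
  ((c / (2 * eps) `^ s)%:E <= covering_number eps A)%E.
Proof.
move=> s0 c0 e0 hc; apply: le_ereal_inf_tmp => _ [l Al <-].
pose C i : set V := if (i < size l)%N then ball (nth 0 l i) eps else set0.
have := hc C; have e2 : 0 < (2 * eps) `^ s by apply: powR_gt0; rewrite mulr_gt0.
rewrite lee_fin ler_pdivrMr// => H; rewrite -lee_fin.
apply: (le_trans (H _)).
  move=> x /Al[y /= yl xy]; exists (index y l) => //.
  by rewrite /C index_mem yl nth_index.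
rewrite (@nneseries_split _ _ 0 (size l)); last by move=> k _; exact: poweR_ge0.
rewrite add0n eseries0 ?adde0; last first.
  move=> i si _; rewrite /C ltnNge si/= /diam.
  rewrite (_ : [set _ | _ in _ & _ in _] = set0) ?ereal_sup0.
    by rewrite maxeNy poweR0r// gt_eqF.
  by apply/seteqP; split=> // z [x []].
apply: (@le_trans _ _ (\sum_(0 <= k < size l) ((2 * eps) `^ s)%:E)%E); last first.
  by rewrite sumEFin lee_fin sumr_const_nat subn0 -[leLHS]mulr_natl.
apply: lee_sum => i _; rewrite /C; case: ifP => _; last first.
  rewrite /diam (_ : [set _ | _ in _ & _ in _] = set0) ?ereal_sup0.
    by rewrite maxeNy poweR0r ?gt_eqF// lee_fin ltW.
  by apply/seteqP; split=> // z [x []].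
have dle : (diam (ball (nth (0%R : V) l i) eps) <= (2 * eps)%:E)%E.
  rewrite /diam ge_max lee_fin mulr_ge0 ?(ltW e0)//=.
  apply: ge_ereal_sup => _ [x bx [y b_y <-]]; rewrite lee_fin.
  rewrite -ball_normE/= in bx b_y.
  have -> : x - y = (nth 0 l i - y) - (nth 0 l i - x) by rewrite opprB [RHS]addrC addrA subrK.
  by apply: le_trans (ler_normB _ _) _; lra.
rewrite -[leRHS]/(poweR (2 * eps)%:E s); apply: gt0_ler_poweR => //; first exact: ltW.
- by rewrite in_itv/= diam_ge0 leey.
- by rewrite in_itv/= lee_fin leey mulr_ge0// ltW.
Qed.

(** With exponent M + 1, the quotient is at least M for all small radii, the
    constants being absorbed by the additional 1. *)
Lemma fractal_dim_infinite : fractal_dim A = +oo%E.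
Proof.
apply/eqP; rewrite -leye_eq; apply: le_ereal_inf_tmp => _ [X X0 <-].
rewrite leye_eq; apply/eqP/eqyP => M M0.
have s0 : 0 < M + 1 by lra.
have [c c0 hc] := cover_sum s0.
set s := M + 1 in s0 hc *; pose B := `|ln c - s * ln 2| + 1.
have B0 : 0 < B by rewrite ltr_pwDr.
have [e [Xe e0 eB]] : exists e : R, [/\ X e, 0 < e & e <= expR (- B)].
  have : \forall e \near (0 : R)^'+, [/\ X e, 0 < e & e <= expR (- B)].
    near=> e; split; first by near: e; exact: X0.
      by near: e; exact: nbhs_right_gt.
    by near: e; apply: nbhs_right_le; exact: expR_gt0.
  by case/filter_ex => e he; exists e.
have lB : B <= ln e^-1.
  by rewrite lnV ?posrE// -[B]opprK lerN2 -[- B]expRK ler_ln ?posrE ?expR_gt0.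
have l0 : 0 < ln e^-1 by exact: lt_le_trans lB.
apply: (@le_trans _ _ (lne (covering_number e A) * ((ln e^-1)^-1)%:E)%E); last first.
  by apply: ereal_sup_ubound; exists e.
have cov := covering_number_ge s0 c0 e0 hc.
set x := c / _ in cov; have x0 : 0 < x by rewrite divr_gt0 ?powR_gt0 ?mulr_gt0.
apply: (@le_trans _ _ ((ln x)%:E * ((ln e^-1)^-1)%:E)%E).
  rewrite -EFinM lee_fin ler_pdivlMr// /x ln_div ?posrE ?powR_gt0 ?mulr_gt0//.
  rewrite ln_powR lnM ?posrE//.
  have -> : ln e = - ln e^-1 by rewrite lnV ?posrE// opprK.
  have : - (ln c - s * ln 2) <= B.
    by rewrite /B; have := ler_norm (- (ln c - s * ln 2)); rewrite normrN; lra.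
  rewrite /s; lra.
apply: lee_wpmul2r; first by rewrite lee_fin invr_ge0 ltW.
have -> : (ln x)%:E = lne x%:E by rewrite /lne leNgt x0.
by rewrite lee_lne// in_itv/= ?lee_fin ?leey ?(ltW x0)// (le_trans _ cov)// lee_fin ltW.
Unshelve. all: by end_near. Qed.

End infinite_dimension.

(** * The random attractor *)

Section semidistance.
Variables (R : realType) (V : normedModType R).
Implicit Types (X Y : set V).

Lemma set_norm_ge X x : X x -> (`|x|%:E <= set_norm X)%E.
Proof. by move=> Xx; apply: ereal_sup_ubound; exists x. Qed.

Lemma set_norm_fin_nonempty X : set_norm X \is a fin_num -> X !=set0.
Proof.
apply: contraPP => /set0P/negP/negPn/eqP ->.
by rewrite /set_norm image_set0 ereal_sup0.
Qed.

Lemma hdist_ge0 X Y : X !=set0 -> (0 <= hdist X Y)%E.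
Proof.
move=> [x Xx]; apply: (@le_trans _ _ (ereal_inf [set `|x - y|%:E | y in Y])).
  by apply: le_ereal_inf_tmp => _ [y _ <-]; rewrite lee_fin.
by apply: ereal_sup_ubound; exists x.
Qed.

Lemma hdist_le X Y (e : R) :
  (forall x, X x -> exists2 y, Y y & `|x - y| <= e) -> (hdist X Y <= e%:E)%E.
Proof.
move=> h; apply: ge_ereal_sup => _ [x Xx <-]; have [y Yy xy] := h x Xx.
apply: (@le_trans _ _ `|x - y|%:E); last by rewrite lee_fin.
by apply: ereal_inf_lbound; exists y.
Qed.

Lemma hdist0_subset X Y : compact Y -> (hdist X Y <= 0)%E -> X `<=` Y.
Proof.
move=> cY h0 x Xx.
have clY : closed Y by apply: compact_closed => //; exact: norm_hausdorff.
apply: clY => B /nbhs_ballP[e e0 eB].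
have : (ereal_inf [set `|x - y|%:E | y in Y] < e%:E)%E.
  apply: le_lt_trans (_ : (0 < e%:E)%E); last by rewrite lte_fin.
  by apply: le_trans h0; apply: ereal_sup_ubound; exists x.
move=> /ereal_inf_lt[_ [y Yy <-]]; rewrite lte_fin => xy.
by exists y; split=> //; apply: eB; rewrite -ball_normE.
Qed.

Lemma squeeze_cvge0 (f : nat -> \bar R) (g : nat -> R) :
  (\forall n \near \oo, (0 <= f n <= (g n)%:E)%E) -> g @ \oo --> (0 : R) ->
  f @ \oo --> 0%E.
Proof.
move=> fg g0; apply/fine_cvgP; split.
  apply: filterS fg => n /andP[h1 h2].
  by rewrite fin_numElt (lt_le_trans _ h1)// (le_lt_trans h2)// ltry.
apply: (@squeeze_cvgr _ _ _ _ (cst 0) g) => //; last exact: cvg_cst.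
apply: filterS fg => n /andP[h1 h2] /=; rewrite fine_ge0//= -lee_fin fineK//.
by rewrite fin_numElt (lt_le_trans _ h1)// (le_lt_trans h2)// ltry.
Qed.

Lemma tempered_of_bound (phi : int -> \bar R) (C : int -> R) :
  (forall l, 0 <= phi l <= (C l)%:E)%E ->
  (forall theta, 0 < theta ->
    expR (theta * - n%:R) * C (- n%:Z) @[n --> \oo] --> (0 : R)) ->
  tempered phi.
Proof.
move=> phiC hC; split=> [l|theta theta0].
  by have /andP[h1 h2] := phiC l; rewrite fin_numElt (lt_le_trans _ h1)// (le_lt_trans h2)// ltry.
apply: squeeze_cvge0 (hC theta theta0); near=> n.
have /andP[h1 h2] := phiC (- n%:Z).
rewrite gee0_abs// mule_ge0 ?lee_fin ?expR_ge0//= EFinM.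
by apply: lee_wpmul2l => //; rewrite lee_fin expR_ge0.
Unshelve. all: by end_near. Qed.

Lemma cvg_expR_neg (th : R) : 0 < th -> expR (- (th * n%:R)) @[n --> \oo] --> (0 : R).
Proof.
move=> th0.
have -> : (fun n : nat => expR (- (th * n%:R))) = geometric 1 (expR (- th)).
  by apply/funext => n; rewrite /geometric/= mul1r -expRM_natl; congr expR; rewrite -mulr_natl; ring.
apply: cvg_geometric; rewrite ger0_norm ?expR_ge0// -[ltRHS](@expR0 R) ltr_expR.
by rewrite oppr_lt0.
Qed.

End semidistance.

Section attractor.
Variables (R : realType) (a b : R) (mu : probability Gamma R).
Hypotheses (a0 : 0 < a) (b0 : 0 < b).
Variable m : R.
Hypothesis m0 : 0 < m.
Hypothesis ae_good : {ae mu, forall eta, drift m (pot a b eta) /\ superlinear (pot a b eta)}.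

Let cS eta : continuous (pot a b eta). Proof. exact: pot_continuous. Qed.
Let L00 : 0 <= a + b. Proof. by rewrite addr_ge0// ltW. Qed.
Let SL eta s t : `|pot a b eta t - pot a b eta s| <= (a + b) * `|t - s|.
Proof. exact: pot_lipschitz. Qed.

Let good_confined eta : drift m (pot a b eta) /\ superlinear (pot a b eta) ->
  confined (pot a b eta).
Proof. by move=> [dS sS]; exact: drift_confined dS sS. Qed.

Definition box_attractor (a b : R) (eta : Gamma) : set (l2 R) := abox (pot a b eta).

Lemma box_attractor_shift eta l : confined (pot a b eta) ->
  box_attractor a b (bshift l eta) = abox_at (pot a b eta) l%:~R.
Proof.
move=> hS; rewrite /box_attractor -(abox_shift (@cS eta) hS); congr abox.
by apply/funext => t; rewrite pot_shift.
Qed.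

Lemma evolution_box_attractor eta (i j : int) : confined (pot a b eta) -> i <= j ->
  evolution a b eta j%:~R i%:~R @` box_attractor a b (bshift i eta) =
  box_attractor a b (bshift j eta).
Proof. by move=> hS ij; rewrite !box_attractor_shift//; exact: evolution_abox_at. Qed.

Lemma bshift0 eta : bshift 0 eta = eta.
Proof. by apply/funext => n; rewrite /bshift addr0. Qed.

(** The norm of the box is bounded by an affine function of u_1, which grows
    subexponentially in the past. *)
Lemma box_attractor_tempered : tempered_random_set mu (box_attractor a b).
Proof.
split; first by apply: measurable_abox => //; exact: filterS ae_good.
apply: filterS ae_good => eta good; have hS := good_confined good; case: good => dS _.
set S := pot a b eta in dS hS.
pose Z : R := Num.sqrt (limn (series (fun j => 1 / rate R j))).
have Z0 : 0 <= Z by exact: sqrtr_ge0.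
apply: (@tempered_of_bound _ _ (fun l => box_radius (a + b) S l%:~R * Z)).
  move=> l; rewrite box_attractor_shift//; apply/andP; split.
    pose f j : R := if j == 0%N then lead S (stat_param S) l%:~R else 0.
    have sf : square_summable f.
      by apply: (@square_summable_fin _ _ 1) => -[].
    apply: (@le_trans _ _ `|l2_of f|%:E); first by rewrite lee_fin.
    apply: set_norm_ge; split; first by rewrite l2_ofE.
    move=> j j0; rewrite l2_ofE// /f gtn_eqF// expr0n mulr0.
    exact/ltW/growth_gt0.
  apply: ge_ereal_sup => _ [u uA <-]; rewrite lee_fin.
  exact: (abox_at_norm_le (@cS eta) hS L00 (SL eta) uA).
move=> th th0; have th2 : 0 < th / 2 by rewrite divr_gt0.
have [C hC] := drift_lead m0 (@cS eta) dS hS th2.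
have C0 : 0 <= C.
  have := hC 0 (lexx _); rewrite mulr0 expR0 mulr1; apply: le_trans.
  exact: lead_stat_ge0.
pose g n := (expR (- (th * n%:R)) + expR (a + b) * C * expR (- (th / 2 * n%:R))) * Z.
have cg : g @ \oo --> (0 + expR (a + b) * C * 0) * Z.
  apply: cvgM; last exact: cvg_cst.
  apply: cvgD; first exact: cvg_expR_neg.
  by apply: cvgM; [exact: cvg_cst|exact: cvg_expR_neg].
rewrite mulr0 addr0 mul0r in cg.
apply: (@squeeze_cvgr _ _ _ _ (cst 0) g); last 2 first.
- exact: cvg_cst.
- exact: cg.
near=> n; have r0 : 0 <= box_radius (a + b) S (- n%:Z)%:~R.
  by rewrite addr_ge0// mulr_ge0 ?expR_ge0.
apply/andP; split; first by rewrite !mulr_ge0 ?expR_ge0.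
rewrite /g mulrA ler_wpM2r// /box_radius mulrNz.
rewrite (ger0_norm (lead_stat_ge0 (@cS eta) hS _)) mulrDr mulr1 mulrN lerD2l.
have n0 : - n%:R <= 0 :> R by rewrite oppr_le0.
have := hC _ n0; rewrite mulrN mulNr opprK => le.
rewrite mulrCA -mulrA ler_pM2l ?expR_gt0//.
apply: (@le_trans _ _ (expR (- (th * n%:R)) * (C * expR (th / 2 * n%:R)))).
  by rewrite ler_pM2l ?expR_gt0.
rewrite mulrCA -expRD ler_wpM2l// ler_expR; lra.
Unshelve. all: by end_near. Qed.

(** In e^S(- n) beta n, the exponential decays at rate m / 2, which absorbs the
    subexponential growth of the norm beta n of the tempered set. *)
Lemma box_attractor_attracts (B : Gamma -> set (l2 R)) : tempered_random_set mu B ->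
  {ae mu, forall eta,
    hdist (evolution a b eta 0 (- n%:R) @` B (bshift (- n%:Z) eta)) (box_attractor a b eta)
      @[n --> \oo] --> 0%E}.
Proof.
move=> [_ tB]; apply: filterS (ae_and ae_good tB) => eta [good [Bfin Btemp]].
have hS := good_confined good; case: good => dS _; set S := pot a b eta in dS hS.
pose beta n := fine (set_norm (B (bshift (- n%:Z) eta))).
have mm : m / 2 < m by move: m0; lra.
have [C hC] := drift_upper dS mm.
have m2 : 0 < m / 2 by move: m0; lra.
have cb : expR (S (- n%:R)) * beta n @[n --> \oo] --> (0 : R).
  have /fine_cvgP[_ h] := Btemp _ m2.
  have h2 : expR C * (expR (m / 2 * - n%:R) * `|beta n|) @[n --> \oo] --> (0 : R).
    rewrite -[X in _ --> X](mulr0 (expR C)); apply: cvgM; first exact: cvg_cst.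
    apply: cvg_trans h; apply: near_eq_cvg; near=> n.
    by rewrite /beta /=; case: (set_norm _) (Bfin (- n%:Z)).
  apply: norm_cvg0; apply: (@squeeze_cvgr _ _ _ _ (cst 0) _ _ _ _ _ h2); last exact: cvg_cst.
  near=> n; rewrite normr_ge0/= normrM (ger0_norm (expR_ge0 _)) mulrA -expRD.
  rewrite ler_wpM2r// ler_expR mulrN -mulrN; apply: hC.
  by rewrite oppr_le0.
have [w w0 hw] := abox_attracts a0 b0 hS cb.
apply: (@squeeze_cvge0 _ _ (fun n => `|w n|)); last first.
  by rewrite -[X in _ --> X](@normr0 R (l2 R)); exact: cvg_norm.
near=> n; apply/andP; split.
  apply: hdist_ge0.
  have [u Bu] := set_norm_fin_nonempty (Bfin (- n%:Z)).
  by exists (evolution a b eta 0 (- n%:R) u), u.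
apply: hdist_le => _ [u Bu <-].
have hwn : forall u : l2 R, `|u 0%N| <= beta n -> exists2 p, abox S p &
  `|evolution a b eta 0 (- n%:R) u - p| <= `|w n| by near: n.
apply: hwn; apply: le_trans (l2_coord_le _ _) _.
by rewrite -lee_fin fineK//; exact: set_norm_ge.
Unshelve. all: by end_near. Qed.

Lemma box_attractorP : random_attractor mu (evolution a b) (box_attractor a b).
Proof.
split.
- exact: box_attractor_tempered.
- apply: filterS ae_good => eta good.
  exact: (abox_compact (@cS eta) (good_confined good) L00 (SL eta) (pot0 a b eta)).
- apply: filterS ae_good => eta good l.
  have := evolution_box_attractor (good_confined good) (_ : 0 <= l%:Z).
  by rewrite mulr0z bshift0; apply.
- exact: box_attractor_attracts.
Qed.

(** The box is tempered, so it is attracted by A; being invariant, it is at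
    semidistance 0 from A, which is closed. *)
Lemma box_attractor_subset A : random_attractor mu (evolution a b) A ->
  {ae mu, forall eta, confined (pot a b eta) /\ box_attractor a b eta `<=` A eta}.
Proof.
move=> [_ cA _ attA].
apply: filterS (ae_and ae_good (ae_and cA (attA _ box_attractor_tempered))).
move=> eta [good [cAe att]]; have hS := good_confined good; split=> //.
apply: hdist0_subset cAe _.
have E n : evolution a b eta 0 (- n%:R) @` box_attractor a b (bshift (- n%:Z) eta) =
    box_attractor a b eta.
  have := @evolution_box_attractor eta (- n%:Z) 0 hS.
  by rewrite mulrNz mulr0z bshift0; apply; rewrite oppr_le0.
have {}att : (fun=> hdist (box_attractor a b eta) (A eta)) @ \oo --> 0%E.
  by apply: cvg_trans att; apply: near_eq_cvg; near=> n; rewrite E.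
by rewrite (cvg_unique _ (cvg_cst _) att).
Unshelve. all: by end_near. Qed.

End attractor.

Theorem theorem7p4 (R : realType) (a b q : R) (mu : probability Gamma R) :
  0 < a -> 0 < b -> 0 < q < 1 ->
  0 < ln (q * expR (- a) + (1 - q) * expR b) ->
  - a * q + (1 - q) * b < 0 ->
  bernoulli_scheme q mu ->
  (exists A : Gamma -> set (l2 R), random_attractor mu (evolution a b) A) /\
  (forall A : Gamma -> set (l2 R), random_attractor mu (evolution a b) A ->
    {ae mu, forall eta,
      hausdorff_dim (A eta) = +oo%E /\ fractal_dim (A eta) = +oo%E}).
Proof.
move=> a0 b0 q01 ln0 drift0 hmu.
have m0 : 0 < a * q - (1 - q) * b by lra.
have la1 : 1 < q * expR (- a) + (1 - q) * expR b.
  by rewrite ltNge; apply: contraTN ln0 => le1; rewrite -leNgt; exact: ln_le0.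
have ae_good := ae_and (ae_drift a0 b0 q01 hmu) (ae_superlinear a0 b0 q01 hmu m0 la1).
split; first by exists (box_attractor a b); exact: box_attractorP m0 ae_good.
move=> A hA; apply: filterS (box_attractor_subset a0 b0 m0 ae_good hA) => eta [hS sub].
have cS : continuous (pot a b eta) by exact: pot_continuous.
have cover s : 0 < s -> exists2 c, 0 < c & forall C : (set (l2 R))^nat,
    A eta `<=` \bigcup_i C i -> (c%:E <= \sum_(0 <= i <oo) poweR (diam (C i)) s)%E.
  move=> s0; have [c c0 hc] := abox_cover_sum cS hS s0; exists c => // C AC.
  by apply: hc; exact: subset_trans AC.
by split; [exact: hausdorff_dim_infinite|exact: fractal_dim_infinite].
Qed.
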